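(* There is a universal constant $C_{\mathrm{sob}}>0$ such that for every $E,B\ge0$, $m\in\mathbb{N}$ and $f\in\operatorname{Ran}\mathbf{1}_{(-\infty,E]}(H_B)$ we have $$\sum_{\alpha\in\{1,2\}^m}\lVert\partial^\alpha\lvert f\rvert^2\rVert_{L^1(\mathbb{R}^2)}\le C_B'(m)\lVert f\rVert_{L^2(\mathbb{R}^2)}^2,\qquad\text{where } C_B'(m)=2^{3m/2}(E+Bm)^{m/2},$$ and furthermore $$\sum_{\alpha\in\{1,2\}^m}\lVert\partial^\alpha\lvert f\rvert^2\rVert_{L^\infty(\mathbb{R}^2)}\le C_{\mathrm{sob}}\sum_{m'=m}^{m+3}C_B'(m')\lVert f\rVert_{L^2(\mathbb{R}^2)}^2 .$$
   Context: The Landau operator at field strength $B$ is $H_B=\tilde\partial_1^2+\tilde\partial_2^2$ with $\tilde\partial_1=i\partial_1-\frac B2x_2$, $\tilde\partial_2=i\partial_2+\frac B2x_1$, a self-adjoint operator in $L^2(\mathbb{R}^2)$ with operator core $C_0^\infty(\mathbb{R}^2)$; for $B=0$ it is $-\Delta$. $\mathbf{1}_{(-\infty,E]}(H_B)$ is the spectral projector onto energies up to $E$, and $\operatorname{Ran}$ denotes the range. Functions in $\operatorname{Ran}\mathbf{1}_{(-\infty,E]}(H_B)$ are smooth. For a finite sequence $\alpha=(\alpha_1,\dots,\alpha_m)\in\{1,2\}^m$, $\partial^\alpha=\partial_{\alpha_1}\partial_{\alpha_2}\cdots\partial_{\alpha_m}$ (ordinary partial derivatives). *)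

(* Defs.v *)
From HB Require Import structures.
From mathcomp Require Import all_boot all_order all_algebra.
From mathcomp Require Import complex.
From mathcomp Require Import all_classical all_reals all_analysis.

Set Implicit Arguments.
Unset Strict Implicit.
Unset Printing Implicit Defensive.

Import Order.TTheory GRing.Theory Num.Theory.
Import numFieldNormedType.Exports.

Local Open Scope classical_set_scope.
Local Open Scope ring_scope.
Local Open Scope complex_scope.

(* Elements of L^2(R^2; C) are handled as functions R * R -> R[i], equality in
   L^2 being equality almost everywhere for the product Lebesgue measure. *)
Definition leb2 (R : realType) :
    {measure set (measurableTypeR R * measurableTypeR R) -> \bar R} :=
  (@lebesgue_measure R \x @lebesgue_measure R)%E.

Section Smooth.
Variable R : realType.

Definition dir (j : 'I_2) : R * R := if j == ord0 then (1, 0) else (0, 1).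

(* [:: a1; ...; am] stands for the operator d_a1 d_a2 ... d_am. *)
Definition partials (a : seq 'I_2) (h : R * R -> R) : R * R -> R :=
  foldr (fun j k x => 'D_(dir j) k x) h a.

Definition smooth (h : R * R -> R) : Prop := forall a : seq 'I_2,
  continuous (partials a h) /\
  forall (j : 'I_2) (x : R * R), derivable (partials a h) x (dir j).

Definition re (f : R * R -> R[i]) : R * R -> R := fun x => complex.Re (f x).
Definition im (f : R * R -> R[i]) : R * R -> R := fun x => complex.Im (f x).
Definition absf (f : R * R -> R[i]) : R * R -> R := fun x => Normc.normc (f x).

Definition abs2 (f : R * R -> R[i]) : R * R -> R := fun x => absf f x ^+ 2.

Definition csmooth (f : R * R -> R[i]) : Prop := smooth (re f) /\ smooth (im f).

Definition cpartial (j : 'I_2) (f : R * R -> R[i]) : R * R -> R[i] :=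
  fun x => 'D_(dir j) (re f) x +i* 'D_(dir j) (im f) x.

Definition test_function (f : R * R -> R[i]) : Prop :=
  csmooth f /\ compact (closure [set x | f x != 0]).

End Smooth.

Section L2.
Variable R : realType.
Implicit Types f g : R * R -> R[i].

Definition L2norm f : \bar R := ('N[leb2 R]_(2%:E)[EFin \o absf f])%E.

Definition L2 f : Prop :=
  [/\ measurable_fun setT (re f), measurable_fun setT (im f)
    & (L2norm f < +oo)%E].

Definition inner f g : R[i] :=
  let h x := f x * (g x)^*%C in
  (\int[leb2 R]_x re h x) +i* (\int[leb2 R]_x im h x).

Definition L2cvg (u : nat -> R * R -> R[i]) f : Prop :=
  L2norm (u n \- f) @[n --> \oo] --> 0%E.

End L2.

(* Unbounded operators in L^2 are represented by their graph: [H f u] means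
   that f is in the domain of H and that H f = u. *)
Definition operator (R : realType) := (R * R -> R[i]) -> (R * R -> R[i]) -> Prop.

Section Landau.
Variables (R : realType) (B : R).

Definition magnetic (j : 'I_2) (f : R * R -> R[i]) : R * R -> R[i] := fun x =>
  if j == ord0 then 'i%C * cpartial j f x - (B / 2 * x.2)%:C * f x
  else 'i%C * cpartial j f x + (B / 2 * x.1)%:C * f x.

Definition landau_expr (f : R * R -> R[i]) : R * R -> R[i] :=
  \sum_(j < 2) magnetic j (magnetic j f).

(* As the test functions form an operator core, H_B is the closure of its
   restriction to them. *)
Definition landau : operator R := fun f u => [/\ L2 f, L2 u &
  exists phi : nat -> R * R -> R[i], [/\ forall n, test_function (phi n),
    L2cvg phi f & L2cvg (fun n => landau_expr (phi n)) u]].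

End Landau.

Section SpectralMeasure.
Variable R : realType.

(* Symmetry on all of L^2 forces linearity and compatibility with a.e.
   equality. *)
Definition orthogonal_projector (Q : (R * R -> R[i]) -> (R * R -> R[i])) : Prop :=
  [/\ forall f, L2 f -> L2 (Q f),
      forall f g, L2 f -> L2 g -> inner (Q f) g = inner f (Q g)
    & forall f, L2 f -> ae_eq (leb2 R) setT (Q (Q f)) (Q f)].

(* P is the projection-valued measure A |-> 1_A(H) of the spectral theorem for
   the self-adjoint operator H, i.e. H = \int t dP(t): with
   mu_f(A) = ||P(A) f||^2 = <P(A) f, f>, the domain of H is
   {f | \int t^2 dmu_f(t) < oo}, on which <H f, f> = \int t dmu_f(t) (by
   polarization, this determines H).  It exists and is unique (up to a.e.
   equality, and on Borel sets A) by the spectral theorem. *)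
Definition spectral_measure (H : operator R)
    (P : set R -> (R * R -> R[i]) -> (R * R -> R[i])) : Prop :=
  [/\ forall A, measurable A -> orthogonal_projector (P A),
      forall f, L2 f -> ae_eq (leb2 R) setT (P setT f) f,
      forall A A' f, measurable A -> measurable A' -> L2 f ->
        ae_eq (leb2 R) setT (P (A `&` A') f) (P A (P A' f))
    & forall f, L2 f -> exists mu : {measure set R -> \bar R},
        [/\ forall A, measurable A -> mu A = (L2norm (P A f) ^+ 2)%E,
            (exists u, H f u) <-> (\int[mu]_t (t ^+ 2)%:E < +oo)%E
          & forall u, H f u -> inner u f = (\int[mu]_t t)%:C]].

Definition L2range (Q : (R * R -> R[i]) -> (R * R -> R[i]))
    (f : R * R -> R[i]) : Prop :=
  L2 f /\ exists2 g, L2 g & ae_eq (leb2 R) setT f (Q g).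

End SpectralMeasure.

Definition C' (R : realType) (E B : R) (m : nat) : R :=
  2 `^ (3 * m%:R / 2) * (E + B * m%:R) `^ (m%:R / 2).

(* Main.v *)
Require Import Defs.
From HB Require Import structures.
From mathcomp Require Import all_boot all_order all_algebra.
From mathcomp Require Import complex.
From mathcomp Require Import all_classical all_reals all_analysis.
From mathcomp Require Import measurable_realfun ess_sup_inf.
From mathcomp Require Import ring lra.
Set Implicit Arguments.
Unset Strict Implicit.
Unset Printing Implicit Defensive.
Import Order.TTheory GRing.Theory Num.Theory.
Import numFieldNormedType.Exports.
Local Open Scope classical_set_scope.
Local Open Scope ring_scope.
Local Open Scope complex_scope.

(* For f in Ran 1_(-oo,E](H) all iterates of H on f are defined and satisfy
   |H^n f| <= C E^n.  Conversely this growth, by log-convexity of n |-> |H^n f|,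
   gives <H f, f> <= E |f|^2, that is, sum_j |pi_j f|^2 <= E |f|^2 for the
   magnetic derivatives pi_j; and since [H, pi_1] = - 2 i B pi_2 and
   [H, pi_2] = 2 i B pi_1, the functions pi_j f have growth rate E + 2 B.  Hence
   the magnetic derivatives of f of order k satisfy
   sum |pi^gamma f| <= prod_(i < k) (2 (E + 2 B i))^(1/2) |f|.
   As i d_j (u conj v) = pi_j u conj v - u conj (pi_j v), the magnetic potential
   cancels in the derivatives of |f|^2, so these are sums of 2^m products of
   magnetic derivatives of total order m: this is the L^1 bound.  The L^oo bound
   follows with C_sob = 1 from
   |h(x)| <= int |h| + |d_1 h| + |d_2 h| + |d_1 d_2 h|.
   Smoothness: a test function phi is bounded by a multiple of |phi| + |H phi|,
   so that approximating sequences of f in the core converge uniformly; a uniform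
   limit whose derivatives converge in L^2 to a continuous function is
   differentiable, and this applies again to pi_j f. *)

(** The spectral measure gives H only through its domain and the diagonal values <H f, f>, so no
    functional calculus is at hand. That H preserves the range of a spectral projector is deduced
    from the additivity of mu_f for orthogonal supports, and H >= 0 confines band functions to the
    bounded set [0, E]. The obstacle in passing from f to pi_j f is that pi_j f must again lie in
    the domain of H, while the commutation relation is at first known only when tested against the
    core. Self-adjointness of the closure settles this; it is not derived from the differential
    expression but read off from the existence of the spectral measure. These arguments are carried
    out for an abstract closure of p1^2 + p2^2, over a form that may be degenerate because the
    elements of L^2 are functions and not classes. The constant splits as 2^(3m/2) = 2^m 2^(m/2):
    the factor 2^m counts the products in a derivative of |f|^2, and 2^(m/2) comes from (a + b)^2 <=
    2 (a^2 + b^2), used once per order. *)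

(* The real part of a complex inner product; definiteness is not required. *)
Record inner_product (R : realType) (W : lmodType R[i]) (d : W -> W -> R) : Prop :=
  InnerProduct {
    ip_addl : forall x y z, d (x + y) z = d x z + d y z ;
    ip_scalel : forall a x y, d (a%:C *: x) y = a * d x y ;
    ip_sym : forall x y, d x y = d y x ;
    ip_ge0 : forall x, 0 <= d x x ;
    ip_J : forall x y, d ('i%C *: x) y = - d x ('i%C *: y) }.

(** * Inner product spaces *)

Section PreHilbert.
Variables (R : realType) (W : lmodType R[i]) (d : W -> W -> R).
Hypothesis dP : inner_product d.
Implicit Types (x y z : W) (u v : nat -> W).

Lemma ip_addr x y z : d x (y + z) = d x y + d x z.
Proof. by rewrite !(ip_sym dP x) (ip_addl dP). Qed.

Lemma ip_scaler a x y : d x (a%:C *: y) = a * d x y.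
Proof. by rewrite !(ip_sym dP x) (ip_scalel dP). Qed.

Lemma ip_oppl x y : d (- x) y = - d x y.
Proof.
have := ip_scalel dP (- 1) x y; rewrite (_ : ((-1)%:C) = -1 :> R[i]) ?scaleN1r ?mulN1r //.
by apply/eqP; rewrite eq_complex /= oppr0 !eqxx.
Qed.

Lemma ip_oppr x y : d x (- y) = - d x y.
Proof. by rewrite !(ip_sym dP x) ip_oppl. Qed.

Lemma ip_0l y : d 0 y = 0.
Proof. by have := ip_addl dP 0 0 y; rewrite addr0 => /eqP; rewrite -subr_eq0 opprD addNKr oppr_eq0 => /eqP. Qed.

Lemma ip_0r y : d y 0 = 0.
Proof. by rewrite ip_sym // ip_0l. Qed.

Definition ipE := (ip_addl dP, ip_addr, ip_oppl, ip_oppr, ip_scalel dP, ip_scaler, ip_0l, ip_0r).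

(** Discriminant of the nonnegative quadratic a |-> |a y + x|^2, evaluated at its minimizer. Since
    the form may be degenerate, [d y y = 0] is treated apart: the polynomial is then affine, and a
    nonzero slope would make it take the value -1. *)
Lemma ip_CS2 x y : d x y ^+ 2 <= d x x * d y y.
Proof.
have h (a : R) : 0 <= d y y * (a * a) + 2 * d x y * a + d x x.
  have := ip_ge0 dP (a%:C *: y + x); rewrite !ipE (ip_sym dP y x); lra.
have [y0|yn0] := eqVneq (d y y) 0.
  have [->|xy0] := eqVneq (d x y) 0; first by rewrite expr0n /= y0 mulr0.
  have := h (- (d x x + 1) / (2 * d x y)); rewrite y0.
  have -> : 0 * (- (d x x + 1) / (2 * d x y) * (- (d x x + 1) / (2 * d x y))) +
    2 * d x y * (- (d x x + 1) / (2 * d x y)) + d x x = -1 by field.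
  by lra.
have y1 : 0 < d y y by rewrite lt_def yn0 ip_ge0.
have := h (- d x y / d y y).
have -> : d y y * (- d x y / d y y * (- d x y / d y y)) + 2 * d x y * (- d x y / d y y) + d x x
  = (d x x * d y y - d x y ^+ 2) / d y y by field.
by rewrite pmulr_lge0 ?invr_gt0 // subr_ge0.
Qed.

Definition nm x := Num.sqrt (d x x).
Lemma nm_ge0 x : 0 <= nm x. Proof. exact: sqrtr_ge0. Qed.

Lemma nm_sqr x : nm x ^+ 2 = d x x.
Proof. by rewrite sqr_sqrtr ?ip_ge0. Qed.

Lemma ip_CS x y : `|d x y| <= nm x * nm y.
Proof.
by rewrite -sqrtrM ?ip_ge0 // -sqrtr_sqr ler_wsqrtr // ip_CS2.
Qed.

Lemma nmD x y : nm (x + y) <= nm x + nm y.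
Proof.
rewrite -(@ler_pXn2r _ 2) ?nnegrE ?addr_ge0 ?nm_ge0 //.
rewrite nm_sqr !ipE sqrrD !nm_sqr (ip_sym dP y x).
have := ip_CS x y; have := ler_norm (d x y); lra.
Qed.

Lemma nmN x : nm (- x) = nm x.
Proof. by rewrite /nm !ipE opprK. Qed.

Lemma nmB x y : nm (x - y) = nm (y - x).
Proof. by rewrite -nmN opprB. Qed.

Lemma nmZ a x : nm (a%:C *: x) = `|a| * nm x.
Proof. by rewrite /nm !ipE mulrA sqrtrM -?expr2 ?sqr_ge0 // sqrtr_sqr. Qed.

Lemma ip_JJ x y : d ('i%C *: x) ('i%C *: y) = d x y.
Proof.
rewrite (ip_J dP) scalerA -expr2 sqr_i scaleN1r ipE opprK //.
Qed.

Lemma nmJ x : nm ('i%C *: x) = nm x.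
Proof. by rewrite /nm ip_JJ. Qed.

Lemma nm0 : nm 0 = 0. Proof. by rewrite /nm ip_0l sqrtr0. Qed.

(** Plays the role of almost everywhere equality for a form that may be degenerate. *)
Definition eqv x y := nm (x - y) = 0.
Lemma eqv_ip x y z : eqv x y -> d x z = d y z.
Proof.
move=> h; apply/eqP; rewrite -subr_eq0 -ip_oppl -(ip_addl dP).
by rewrite -normr_le0 (le_trans (ip_CS _ _)) // h mul0r.
Qed.

Lemma eqv_ipr x y z : eqv x y -> d z x = d z y.
Proof. by move=> h; rewrite !(ip_sym dP z); exact: eqv_ip. Qed.

(** Take z to be x - y. Identities between projections are obtained this way: tested against z, they
    follow from symmetry. *)
Lemma eqvP x y : (forall z, d x z = d y z) -> eqv x y.
Proof. by move=> h; rewrite /eqv /nm ip_addl // ip_oppl h subrr sqrtr0. Qed.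

Lemma eqv_sym x y : eqv x y -> eqv y x. Proof. by rewrite /eqv nmB. Qed.

Lemma eqv_trans y x z : eqv x y -> eqv y z -> eqv x z.
Proof. by move=> h k; apply: eqvP => w; rewrite (eqv_ip _ h) (eqv_ip _ k). Qed.

Lemma eqv_nm x y : eqv x y -> nm x = nm y.
Proof. by move=> h; rewrite /nm (eqv_ip _ h) (eqv_ipr _ h). Qed.

Definition lim u x := nm (u n - x) @[n --> \oo] --> (0 : R).

Lemma lim_of_le u x (e : nat -> R) : (forall n, nm (u n - x) <= e n) ->
  e n @[n --> \oo] --> (0 : R) -> lim u x.
Proof.
move=> h; apply: (@squeeze_cvgr _ _ _ _ (fun=> 0)); last exact: cvg_cst.
by apply: nearW => n; rewrite nm_ge0 h.
Qed.

Lemma lim_cst x : lim (fun=> x) x.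
Proof. rewrite /lim subrr nm0; exact: cvg_cst. Qed.

Lemma limD u v x y : lim u x -> lim v y -> lim (fun n => u n + v n) (x + y).
Proof.
move=> hu hv; apply: (@lim_of_le _ _ (fun n => nm (u n - x) + nm (v n - y))).
  by move=> n; rewrite opprD addrACA nmD.
by rewrite -[X in _ --> X]addr0; exact: cvgD.
Qed.

Lemma limZ a u x : lim u x -> lim (fun n => a%:C *: u n) (a%:C *: x).
Proof.
move=> hu; apply: (@lim_of_le _ _ (fun n => `|a| * nm (u n - x))).
  by move=> n; rewrite -scalerBr nmZ.
by rewrite -[X in _ --> X](mulr0 `|a|); apply: cvgM => //; exact: cvg_cst.
Qed.

Lemma limJ u x : lim u x -> lim (fun n => 'i%C *: u n) ('i%C *: x).
Proof.
by move=> hu; apply: (lim_of_le (fun n => _) hu) => n; rewrite -scalerBr nmJ.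
Qed.

Lemma lim_ip u v x y : lim u x -> lim v y -> d (u n) (v n) @[n --> \oo] --> d x y.
Proof.
move=> hu hv; apply/subr_cvg0; apply/norm_cvg0P.
pose e n := nm (u n - x) * nm (v n - y) + nm x * nm (v n - y) + nm (u n - x) * nm y.
apply: (@squeeze_cvgr _ _ _ _ (fun=> 0) e); [|exact: cvg_cst|].
  apply: nearW => n; rewrite normr_ge0 /=.
  have -> : d (u n) (v n) - d x y = d (u n - x) (v n - y) + d x (v n - y) + d (u n - x) y.
    by rewrite !ipE; ring.
  rewrite (le_trans (ler_normD _ _)) // lerD ?ip_CS //.
  by rewrite (le_trans (ler_normD _ _)) // lerD ?ip_CS.
rewrite /e -[X in _ --> X](_ : 0 * 0 + nm x * 0 + 0 * nm y = 0); last by ring.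
by apply: cvgD; [apply: cvgD|]; apply: cvgM => //; exact: cvg_cst.
Qed.

Lemma lim_ipl u x y : lim u x -> d (u n) y @[n --> \oo] --> d x y.
Proof. by move=> hu; apply: lim_ip => //; exact: lim_cst. Qed.

Definition cauchy_seq u := forall e : R, 0 < e -> exists N : nat, forall n m,
  (N <= n)%N -> (N <= m)%N -> nm (u n - u m) <= e.
Lemma lim_cauchy u x : lim u x -> cauchy_seq u.
Proof.
move=> /cvgrPdist_le hu e e0.
have e2 : 0 < e / 2 by rewrite divr_gt0.
have [N _ hN] := hu _ e2; exists N => n m nN mN.
rewrite (_ : u n - u m = (u n - x) - (u m - x)); last by rewrite opprB addrA subrK.
rewrite (le_trans (nmD _ _)) // nmN (splitr e) lerD //.
  by have := hN _ nN; rewrite /= sub0r normrN ger0_norm ?nm_ge0.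
by have := hN _ mN; rewrite /= sub0r normrN ger0_norm ?nm_ge0.
Qed.
End PreHilbert.

Lemma cvg_seq_unique (R : realType) (u v : nat -> R) (a b : R) : u =1 v ->
  u n @[n --> \oo] --> a -> v n @[n --> \oo] --> b -> a = b.
Proof. by move=> /funext -> /cvg_lim <- // /cvg_lim <-. Qed.

Lemma bernoulli_le (R : realDomainType) (h : R) n : 0 <= h -> 1 + n%:R * h <= (1 + h) ^+ n.
Proof.
move=> h0; elim: n => [|n IH]; first by rewrite mul0r addr0 expr0.
have h1 : 0 <= n%:R * h * h by rewrite !mulr_ge0.
rewrite exprS (le_trans _ (ler_wpM2l _ IH)) ?addr_ge0 // -natr1; lra.
Qed.

(* The ratios a_{n+1} / a_n are nondecreasing, so the first one is at most the
   exponential growth rate. *)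
Lemma logconvex_growth (R : realType) (a : nat -> R) C E : (forall n, 0 <= a n) ->
  (forall n, a n.+1 ^+ 2 <= a n * a n.+2) -> 0 <= E ->
  (forall n, a n <= C * E ^+ n) -> a 1%N <= E * a 0%N.
Proof.
move=> a0 acvx; rewrite le_eqVlt => /orP[/eqP <-|E0] aC.
  by have := aC 1%N; rewrite expr1 mulr0 mul0r.
rewrite leNgt; apply/negP => lt1.
have a00 : 0 < a 0%N.
  rewrite lt_def a0 andbT; apply/eqP => z; have := acvx 0%N.
  rewrite z mul0r; move: lt1; rewrite z mulr0 => lt1.
  by rewrite leNgt exprn_gt0.
have hE n : 0 < a n /\ a 1%N * a n <= a 0%N * a n.+1.
  elim: n => [|n [p h]]; first by rewrite mulrC.
  have p1 : 0 < a n.+1.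
    have : 0 < a 0%N * a n.+1.
      by rewrite (lt_le_trans _ h) // mulr_gt0 // (lt_trans _ lt1) // mulr_gt0.
    by rewrite pmulr_rgt0.
  split => //; rewrite -(ler_pM2l p).
  have := ler_wpM2l (ltW a00) (acvx n); have := ler_wpM2r (a0 n.+1) h; lra.
pose q := a 1%N / a 0%N.
have qE : E < q by rewrite ltr_pdivlMr.
have an n : q ^+ n * a 0%N <= a n.
  elim: n => [|n IH]; first by rewrite expr0 mul1r.
  have [_ h] := hE n.
  rewrite exprS -mulrA (le_trans (ler_wpM2l _ IH)) ?(ltW (lt_trans E0 qE)) //.
  by rewrite /q mulrAC ler_pdivrMr // [a n.+1 * _]mulrC.
(* By Bernoulli (q / E)^n >= 1 + n h, and the n chosen next makes n h exceed [C / a 0], against the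
   growth bound. *)
pose h := q / E - 1.
have h0 : 0 < h by rewrite subr_gt0 ltr_pdivlMr // mul1r.
pose n := (Num.trunc (C / a 0%N / h)).+1.
have : C / a 0%N / h < n%:R by rewrite truncnS_gt.
rewrite ltr_pdivrMr // ltNge => /negP; apply.
have := le_trans (an n) (aC n).
rewrite -ler_pdivlMr // mulrAC -ler_pdivrMr ?exprn_gt0 // -expr_div_n.
apply: le_trans; have := bernoulli_le n (ltW h0).
rewrite [X in _ <= X ^+ _](_ : _ = q / E); last by rewrite /h addrC subrK.
lra.
Qed.

(** * The closure of a sum of squares p1^2 + p2^2 with [p1, p2] = i B *)

Section Closure.
Variables (R : realType) (W : lmodType R[i]) (d : W -> W -> R).
Hypothesis dP : inner_product d.
Hypothesis complete : forall u, cauchy_seq d u -> exists x, lim d u x.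
Variables (D0 : lmodType R[i]) (iota : {linear D0 -> W}) (p1 p2 : {linear D0 -> D0}).
Variable B : R.
Hypothesis B0 : 0 <= B.
Hypothesis p1_sym : forall f g, d (iota (p1 f)) (iota g) = d (iota f) (iota (p1 g)).
Hypothesis p2_sym : forall f g, d (iota (p2 f)) (iota g) = d (iota f) (iota (p2 g)).
Hypothesis comm : forall f, p1 (p2 f) - p2 (p1 f) = B%:C *: ('i%C *: f).
Implicit Types (f g u v w : W) (phi psi : D0).

Local Notation nm := (nm d).
Local Notation lim := (lim d).
Local Notation eqv := (eqv d).

Definition kin phi := p1 (p1 phi) + p2 (p2 phi).

Lemma kinB phi psi : kin (phi - psi) = kin phi - kin psi.
Proof. by rewrite /kin !raddfB /= opprD addrACA. Qed.

Lemma kinD phi psi : kin (phi + psi) = kin phi + kin psi.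
Proof. by rewrite /kin !raddfD /= addrACA. Qed.

Lemma kinZ (a : R[i]) phi : kin (a *: phi) = a *: kin phi.
Proof. by rewrite /kin !linearZ /= scalerDr. Qed.

Lemma kin_sym phi psi : d (iota (kin phi)) (iota psi) = d (iota phi) (iota (kin psi)).
Proof. by rewrite /kin !raddfD /= !(ipE dP) !p1_sym !p2_sym. Qed.

Lemma kin_form phi : d (iota (kin phi)) (iota phi) =
  nm (iota (p1 phi)) ^+ 2 + nm (iota (p2 phi)) ^+ 2.
Proof. by rewrite /kin raddfD /= !(ipE dP) !nm_sqr // p1_sym p2_sym. Qed.

Lemma p12 phi : p1 (p2 phi) = p2 (p1 phi) + B%:C *: ('i%C *: phi).
Proof. by rewrite -comm addrC subrK. Qed.

Lemma p21 phi : p2 (p1 phi) = p1 (p2 phi) - B%:C *: ('i%C *: phi).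
Proof. by rewrite p12 addrK. Qed.

Lemma pZ (p : {linear D0 -> D0}) (a : R[i]) x : p (a *: x) = a *: p x.
Proof. by rewrite linearZ. Qed.

Lemma pB (p : {linear D0 -> D0}) x y : p (x - y) = p x - p y.
Proof. by rewrite raddfB. Qed.

Lemma iotaB x y : iota (x - y) = iota x - iota y.
Proof. by rewrite raddfB. Qed.

Lemma iotaZ (a : R[i]) x : iota (a *: x) = a *: iota x.
Proof. by rewrite linearZ. Qed.

Lemma pD (p : {linear D0 -> D0}) x y : p (x + y) = p x + p y.
Proof. by rewrite raddfD. Qed.

Lemma twoBE (x : D0) : (2 * B)%:C *: x = B%:C *: x + B%:C *: x.
Proof. by rewrite -scalerDl -rmorphD /= mulrDl mul1r. Qed.

Lemma kin_p1 phi : kin (p1 phi) = p1 (kin phi) - (2 * B)%:C *: ('i%C *: p2 phi).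
Proof.
rewrite /kin raddfD /= -addrA; congr +%R.
by rewrite (p21 phi) (pB p2) !(pZ p2) p21 twoBE opprD addrA.
Qed.

Lemma kin_p2 phi : kin (p2 phi) = p2 (kin phi) + (2 * B)%:C *: ('i%C *: p1 phi).
Proof.
rewrite /kin raddfD /= addrAC; congr (_ + _).
by rewrite (p12 phi) (pD p1) !(pZ p1) p12 twoBE addrA.
Qed.

Definition kin_closure f u := exists phi : nat -> D0,
  lim (iota \o phi) f /\ lim (iota \o kin \o phi) u.

Lemma cloD f g u v : kin_closure f u -> kin_closure g v -> kin_closure (f + g) (u + v).
Proof.
move=> [a [a1 a2]] [b [b1 b2]]; exists (fun n => a n + b n); split.
  by rewrite /= (_ : _ \o _ = fun n => iota (a n) + iota (b n));
    [exact: limD|apply/funext => n /=; rewrite raddfD].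
rewrite /= (_ : _ \o _ = fun n => iota (kin (a n)) + iota (kin (b n))).
  exact: (limD dP).
by apply/funext => n /=; rewrite kinD raddfD.
Qed.

Lemma cloZ (a : R) f u : kin_closure f u -> kin_closure (a%:C *: f) (a%:C *: u).
Proof.
move=> [b [b1 b2]]; exists (fun n => a%:C *: b n); split.
  rewrite /= (_ : _ \o _ = fun n => a%:C *: iota (b n)); first exact: (limZ dP).
  by apply/funext => n /=; rewrite linearZ.
rewrite /= (_ : _ \o _ = fun n => a%:C *: iota (kin (b n))); first exact: (limZ dP).
by apply/funext => n /=; rewrite kinZ linearZ.
Qed.

Lemma cloJ f u : kin_closure f u -> kin_closure ('i%C *: f) ('i%C *: u).
Proof.
move=> [b [b1 b2]]; exists (fun n => 'i%C *: b n); split.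
  rewrite /= (_ : _ \o _ = fun n => 'i%C *: iota (b n)); first exact: (limJ dP).
  by apply/funext => n /=; rewrite linearZ.
rewrite /= (_ : _ \o _ = fun n => 'i%C *: iota (kin (b n))); first exact: (limJ dP).
by apply/funext => n /=; rewrite kinZ linearZ.
Qed.

Lemma cloN f u : kin_closure f u -> kin_closure (- f) (- u).
Proof.
move=> h; have := cloZ (-1) h.
by rewrite (_ : ((-1)%:C) = -1 :> R[i]) ?scaleN1r // rmorphN1.
Qed.

Lemma clo_weak f u phi : kin_closure f u -> d u (iota phi) = d f (iota (kin phi)).
Proof.
move=> [b [b1 b2]].
apply: cvg_seq_unique (lim_ipl dP b2) (lim_ipl dP b1) => n.
exact: kin_sym.
Qed.

Lemma clo_sym f g u v : kin_closure f u -> kin_closure g v -> d u g = d f v.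
Proof.
move=> h [b [b1 b2]].
apply: cvg_seq_unique (lim_ip dP (lim_cst dP u) b1) (lim_ip dP (lim_cst dP f) b2).
by move=> n; exact: clo_weak.
Qed.

Lemma clo_ge0 f u : kin_closure f u -> 0 <= d u f.
Proof.
move=> [b [b1 b2]]; have h := lim_ip dP b2 b1.
rewrite -(cvg_lim _ h) //; apply: limr_ge; first by apply/cvg_ex; eexists; exact: h.
by apply: nearW => n /=; rewrite kin_form addr_ge0 // sqr_ge0.
Qed.

(** Diagonal choice: from the n-th approximating sequence take one element within 1 / (n + 1) of
    both [f n] and [u n]. *)
Lemma clo_closed (f u : nat -> W) g w : (forall n, kin_closure (f n) (u n)) ->
  lim f g -> lim u w -> kin_closure g w.
Proof.
move=> h fg uw.
have hk n : exists phi, nm (iota phi - f n) <= n.+1%:R^-1 /\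
    nm (iota (kin phi) - u n) <= n.+1%:R^-1.
  have [b [/cvgrPdist_le b1 /cvgrPdist_le b2]] := h n.
  have e0 : 0 < (n.+1%:R^-1 : R) by rewrite invr_gt0.
  have [N _ hN] := b1 _ e0; have [M _ hM] := b2 _ e0.
  exists (b (maxn N M)).
  have := hN (maxn N M) (leq_maxl _ _); have := hM (maxn N M) (leq_maxr _ _).
  by rewrite /= !sub0r !normrN !ger0_norm ?nm_ge0.
have /choice [phi hphi] := hk.
have aux (F : nat -> W) (G : nat -> W) x : (forall n, nm (F n - G n) <= n.+1%:R^-1) ->
    lim G x -> lim F x.
  move=> FG Gx; apply: (lim_of_le (e := fun n => n.+1%:R^-1 + nm (G n - x))).
    move=> n; rewrite -[X in nm (X - x)](subrK (G n)) -addrA.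
    by rewrite (le_trans (nmD dP _ _)) // lerD2r.
  by rewrite -[X in _ --> X]addr0; apply: cvgD => //; exact: cvg_harmonic.
exists phi; split.
  by apply: (aux _ f) => // n; have [] := hphi n.
by apply: (aux _ u) => // n; have [] := hphi n.
Qed.

(** Cauchy-Schwarz for the nonnegative form q(x, y) = <H x, y> at x = f and y = u = H f, where q(f,
    u) = |u|^2; nonnegativity is that of q on f + a u. *)
Lemma clo_form_CS f u v : kin_closure f u -> kin_closure u v -> nm u ^+ 4 <= d u f * d v u.
Proof.
move=> fu uv.
have h (a : R) : 0 <= d v u * (a * a) + 2 * d u u * a + d u f.
  have := clo_ge0 (cloD fu (cloZ a uv)).
  by rewrite !(ipE dP) (ip_sym dP v f) -(clo_sym fu uv); lra.
have q0 := clo_ge0 uv; have q1 := clo_ge0 fu.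
have -> : nm u ^+ 4 = d u u ^+ 2 by rewrite -nm_sqr // -exprM.
have [y0|yn0] := eqVneq (d v u) 0.
  have [->|xy0] := eqVneq (d u u) 0; first by rewrite expr0n /= y0 mulr0.
  have := h (- (d u f + 1) / (2 * d u u)); rewrite y0.
  have -> : 0 * (- (d u f + 1) / (2 * d u u) * (- (d u f + 1) / (2 * d u u))) +
    2 * d u u * (- (d u f + 1) / (2 * d u u)) + d u f = -1 by field.
  by lra.
have y1 : 0 < d v u by rewrite lt_def yn0.
have := h (- d u u / d v u).
have -> : d v u * (- d u u / d v u * (- d u u / d v u)) + 2 * d u u * (- d u u / d v u) + d u f
  = (d u f * d v u - d u u ^+ 2) / d v u by field.
by rewrite pmulr_lge0 ?invr_gt0 // subr_ge0.
Qed.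

(** A single sequence of the core realizes f, u = H f, v1 = p1 f and v2 = p2 f at once, so that
    identities on the core pass to the limit together. *)
Record core_seq f u v1 v2 (phi : nat -> D0) : Prop := CoreSeq {
  dom_f : lim (iota \o phi) f ;
  dom_u : lim (iota \o kin \o phi) u ;
  dom_1 : lim (iota \o p1 \o phi) v1 ;
  dom_2 : lim (iota \o p2 \o phi) v2 }.

Lemma nm_p_le phi : nm (iota (p1 phi)) ^+ 2 + nm (iota (p2 phi)) ^+ 2 <=
  nm (iota (kin phi)) * nm (iota phi).
Proof. by rewrite -kin_form (le_trans (ler_norm _)) // ip_CS. Qed.

(** By [nm_p_le] a sequence that is Cauchy together with its images under [kin] has Cauchy images
    under p1 and p2; completeness provides v1 and v2. *)
Lemma clo_dom f u : kin_closure f u -> exists v1 v2 (phi : nat -> D0), core_seq f u v1 v2 phi.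
Proof.
move=> [phi [h1 h2]].
have c1 := lim_cauchy dP h1; have c2 := lim_cauchy dP h2.
have key (p : {linear D0 -> D0}) : (forall phi, nm (iota (p phi)) ^+ 2 <=
    nm (iota (kin phi)) * nm (iota phi)) -> exists v, lim (iota \o p \o phi) v.
  move=> hp; apply: complete => e e0.
  have [N hN] := c1 _ e0; have [M hM] := c2 _ e0.
  exists (maxn N M) => n m; rewrite !geq_max => /andP[nN nM] /andP[mN mM].
  rewrite -(@ler_pXn2r _ 2) ?nnegrE ?nm_ge0 ?(ltW e0) //.
  rewrite /= -iotaB -pB (le_trans (hp _)) // expr2 ler_pM ?nm_ge0 //.
    by rewrite kinB iotaB; exact: hM.
  by rewrite iotaB; exact: hN.
have [v1 e1] : exists v, lim (iota \o p1 \o phi) v.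
  by apply: key => psi; rewrite (le_trans _ (nm_p_le _)) // lerDl sqr_ge0.
have [v2 e2] : exists v, lim (iota \o p2 \o phi) v.
  by apply: key => psi; rewrite (le_trans _ (nm_p_le _)) // lerDr sqr_ge0.
by exists v1, v2, phi.
Qed.

Lemma dom_clo f u v1 v2 (phi : nat -> D0) : core_seq f u v1 v2 phi -> kin_closure f u.
Proof. by case=> *; exists phi. Qed.

Lemma dom_form f u v1 v2 (phi : nat -> D0) : core_seq f u v1 v2 phi ->
  nm v1 ^+ 2 + nm v2 ^+ 2 = d u f.
Proof.
move=> [h1 h2 h3 h4].
rewrite !nm_sqr //.
apply: cvg_seq_unique (cvgD (lim_ip dP h3 h3) (lim_ip dP h4 h4)) (lim_ip dP h2 h1) => n.
by rewrite /= kin_form !nm_sqr.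
Qed.

Lemma dom_weak1 f u v1 v2 (phi : nat -> D0) psi : core_seq f u v1 v2 phi ->
  d v1 (iota psi) = d f (iota (p1 psi)).
Proof.
move=> [h1 _ h3 _].
apply: cvg_seq_unique (lim_ipl dP h3) (lim_ipl dP h1) => n.
exact: p1_sym.
Qed.

Lemma dom_weak2 f u v1 v2 (phi : nat -> D0) psi : core_seq f u v1 v2 phi ->
  d v2 (iota psi) = d f (iota (p2 psi)).
Proof.
move=> [h1 _ _ h3].
apply: cvg_seq_unique (lim_ipl dP h3) (lim_ipl dP h1) => n.
exact: p2_sym.
Qed.

(* Self-adjointness of [kin_closure], stated on the core. *)
Hypothesis SA : forall v w, (forall phi, d v (iota (kin phi)) = d w (iota phi)) -> kin_closure v w.

(** The elements p1 (phi n) approximate v1 = p1 f, but nothing is known on the convergence of kin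
    (p1 (phi n)). The relation H p1 f = p1 H f - 2 i B p2 f is therefore verified against the core
    only, by moving all operators to the test vector, and [SA] upgrades it. *)
Lemma dom_clo1 f u u' v1 v2 w1 w2 (phi psi : nat -> D0) : core_seq f u v1 v2 phi -> core_seq u u' w1 w2 psi ->
  kin_closure v1 (w1 - (2 * B)%:C *: ('i%C *: v2)).
Proof.
move=> hf hu; apply: SA => k.
rewrite (dom_weak1 _ hf) (_ : p1 (kin k) = kin (p1 k) + (2 * B)%:C *: ('i%C *: p2 k)); last first.
  by rewrite kin_p1 subrK.
rewrite raddfD /= !(ipE dP) -(clo_weak _ (dom_clo hf)) -(dom_weak1 _ hu).
rewrite !iotaZ ip_scaler //.
congr (_ + _); rewrite -mulrN; congr (_ * _).
by rewrite (ip_J dP) opprK -!iotaZ (dom_weak2 _ hf) (pZ p2).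
Qed.

Lemma dom_clo2 f u u' v1 v2 w1 w2 (phi psi : nat -> D0) : core_seq f u v1 v2 phi -> core_seq u u' w1 w2 psi ->
  kin_closure v2 (w2 + (2 * B)%:C *: ('i%C *: v1)).
Proof.
move=> hf hu; apply: SA => k.
rewrite (dom_weak2 _ hf) (_ : p2 (kin k) = kin (p2 k) - (2 * B)%:C *: ('i%C *: p1 k)); last first.
  by rewrite kin_p2 addrK.
rewrite raddfB /= !(ipE dP) -(clo_weak _ (dom_clo hf)) -(dom_weak2 _ hu).
rewrite !iotaZ ip_scaler //.
congr (_ + _); rewrite -mulrN; congr (_ * _).
by rewrite (ip_J dP) -!iotaZ (dom_weak1 _ hf) (pZ p1).
Qed.

(* Describes Ran 1_(-oo,E](H) without reference to the spectral measure, in a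
   form that is stable under p1 and p2 up to a change of E. *)
Definition bandlimited (E : R) f := exists C (u : nat -> W),
  [/\ u 0%N = f, forall n, kin_closure (u n) (u n.+1) & forall n, nm (u n) <= C * E ^+ n].

(** Symmetry gives |H^(n+1) f|^2 = <H^n f, H^(n+2) f>, which with Cauchy-Schwarz is the
    log-convexity needed for [logconvex_growth]. The image u is arbitrary because images are
    determined only up to [eqv]. *)
Lemma bandlimited_form E f : 0 <= E -> bandlimited E f -> forall u, kin_closure f u ->
  d u f <= E * nm f ^+ 2.
Proof.
move=> E0 [C [u [u0 hu hC]]] u' fu'.
have h1 : nm (u 1%N) <= E * nm (u 0%N).
  apply: (logconvex_growth (a := fun n => nm (u n)) _ _ E0 hC); first by move=> n; exact: nm_ge0.
  move=> n; rewrite nm_sqr // (clo_sym (hu n) (hu n.+1)) (le_trans (ler_norm _)) //.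
  exact: ip_CS.
have -> : d u' f = d (u 1%N) f.
  by have := hu 0%N; rewrite u0 => h; rewrite (clo_sym h fu') (ip_sym dP).
rewrite (le_trans (le_trans (ler_norm _) (ip_CS dP _ _))) // expr2 mulrA.
by rewrite ler_wpM2r ?nm_ge0 // -u0.
Qed.

Lemma bandlimited_dom E f : 0 <= E -> bandlimited E f ->
  exists u v1 v2 (phi : nat -> D0), [/\ core_seq f u v1 v2 phi,
    bandlimited (E + 2 * B) v1, bandlimited (E + 2 * B) v2 &
    nm v1 ^+ 2 + nm v2 ^+ 2 <= E * nm f ^+ 2].
Proof.
move=> E0 hf; have [C [u [u0 hu hC]]] := hf.
have C0 : 0 <= C by have := hC 0%N; rewrite expr0 mulr1; exact/le_trans/nm_ge0.
have hd n : exists vv : W * W, exists phi : nat -> D0, core_seq (u n) (u n.+1) vv.1 vv.2 phi.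
  by have [a [b [phi h]]] := clo_dom (hu n); exists (a, b), phi.
have [v hv] := choice hd; have [phi hphi] := choice hv.
(* [X k n] is the pair H^k p1 H^n f, H^k p2 H^n f, computed with H p1 = p1 H - 2 i B p2 and H p2 =
   p2 H + 2 i B p1. All n are carried along, since each commutation raises n in one term. *)
pose X := fix X k n : W * W := if k is k'.+1 then
  ((X k' n.+1).1 - (2 * B)%:C *: ('i%C *: (X k' n).2),
   (X k' n.+1).2 + (2 * B)%:C *: ('i%C *: (X k' n).1)) else v n.
have hX k : forall n, kin_closure (X k n).1 (X k.+1 n).1 /\ kin_closure (X k n).2 (X k.+1 n).2.
  elim: k => [|k IH] n.
    by split; [exact: dom_clo1 (hphi n) (hphi n.+1)|exact: dom_clo2 (hphi n) (hphi n.+1)].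
  have [a1 a2] := IH n; have [b1 b2] := IH n.+1.
  split; apply: cloD => //; first by apply: cloN; apply: cloZ; exact: cloJ.
  by apply: cloZ; exact: cloJ.
(* From |p1 H^n f|^2 + |p2 H^n f|^2 = <H^(n+1) f, H^n f> <= C^2 E^(2n+1). *)
pose K := C * Num.sqrt E.
have K0 : 0 <= K by rewrite mulr_ge0 ?sqrtr_ge0.
have hK k : forall n, nm (X k n).1 <= K * E ^+ n * (E + 2 * B) ^+ k /\
    nm (X k n).2 <= K * E ^+ n * (E + 2 * B) ^+ k.
  elim: k => [|k IH] n.
    rewrite expr0 mulr1 /=.
    have h2 : nm (v n).1 ^+ 2 + nm (v n).2 ^+ 2 <= (K * E ^+ n) ^+ 2.
      rewrite (dom_form (hphi n)) (le_trans (le_trans (ler_norm _) (ip_CS dP _ _))) //.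
      rewrite (le_trans (ler_pM (nm_ge0 _ _) (nm_ge0 _ _) (hC n.+1) (hC n))) //.
      by rewrite /K !exprMn sqr_sqrtr // exprS; lra.
    have KE : 0 <= K * E ^+ n by rewrite mulr_ge0 ?exprn_ge0.
    split; rewrite -(@ler_pXn2r _ 2) ?nnegrE ?nm_ge0 // (le_trans _ h2) //.
      by rewrite lerDl sqr_ge0.
    by rewrite lerDr sqr_ge0.
  have [a1 a2] := IH n; have [b1 b2] := IH n.+1.
  have B2 : 0 <= 2 * B by rewrite mulr_ge0.
  (* One factor E + 2 B per application of H: E from the term with n + 1, and 2 B from the
     commutator. *)
  have -> : K * E ^+ n * (E + 2 * B) ^+ k.+1 =
    K * E ^+ n.+1 * (E + 2 * B) ^+ k + 2 * B * (K * E ^+ n * (E + 2 * B) ^+ k).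
    by rewrite !exprS; ring.
  split; rewrite /= (le_trans (nmD dP _ _)) // lerD //.
    by rewrite (nmN dP) (nmZ dP) (nmJ dP) ger0_norm // ler_wpM2l.
  by rewrite (nmZ dP) (nmJ dP) ger0_norm // ler_wpM2l.
exists (u 1%N), (v 0%N).1, (v 0%N).2, (phi 0%N).
have d0 : core_seq f (u 1%N) (v 0%N).1 (v 0%N).2 (phi 0%N) by rewrite -u0; exact: hphi.
split => //.
- exists K, (fun k => (X k 0%N).1); split=> // k; first by have [] := hX k 0%N.
  by have [] := hK k 0%N; rewrite expr0 mulr1.
- exists K, (fun k => (X k 0%N).2); split=> // k; first by have [] := hX k 0%N.
  by have [] := hK k 0%N; rewrite expr0 mulr1.
- by rewrite (dom_form d0); apply: bandlimited_form => //; exact: dom_clo d0.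
Qed.
End Closure.

(** * Spectral measures *)

Section SecondMoment.
Variables (R : realType) (mu : {measure set R -> \bar R}).
Hypothesis mu_fin : (mu setT < +oo)%E.

Lemma measurable_sqr_EFin : measurable_fun [set: R] (EFin \o (fun t : R => t ^+ 2)).

Proof. by apply/measurable_EFinP; exact: measurable_funX. Qed.

Lemma integrable_id : (\int[mu]_t (t ^+ 2)%:E < +oo)%E ->
  mu.-integrable setT (fun t : R => t%:E).
Proof.
move=> t2; apply: (@le_integrable _ _ _ _ _ _ _ ((cst 1%:E) \+ (EFin \o (fun t : R => (t ^+ 2)%R)))%E) => //.
- exact/measurable_EFinP.
- move=> t _; rewrite -EFinD /= lee_fin [X in _ <= X]ger0_norm ?addr_ge0 ?sqr_ge0 //.
  have := sqr_ge0 (`|t| - 1); rewrite sqrrB real_normK ?num_real //.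
  have := normr_ge0 t; lra.
- apply: integrableD => //; apply/integrableP; split => //.
  + by under eq_integral do rewrite /= normr1; rewrite integral_cst // mul1e.
  + exact: measurable_sqr_EFin.
  + by under eq_integral do rewrite /= ger0_norm ?sqr_ge0 //.
Qed.

Lemma second_moment_supp (A : set R) (M : R) : measurable A -> mu (~` A) = 0%E ->
  (forall t, A t -> `|t| <= M) -> (\int[mu]_t (t ^+ 2)%:E < +oo)%E.
Proof.
move=> mA A0 AM; apply: (@le_lt_trans _ _ (\int[mu]_t (cst (M ^+ 2)%:E t))%E); last first.
  by rewrite integral_cst // lte_mul_pinfty ?lee_fin ?sqr_ge0.
apply: ae_ge0_le_integral => //.
- by move=> x _; rewrite lee_fin sqr_ge0.
- exact: measurable_sqr_EFin.
- by move=> x _; rewrite lee_fin sqr_ge0.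
exists (~` A); split => //; first exact: measurableC.
move=> t /= h /AM tM; apply: h => _.
by rewrite lee_fin -(real_normK (num_real t)) lerXn2r // nnegrE (le_trans _ tM).
Qed.

Lemma Rintegral_supp_le (A : set R) (E : R) : measurable A -> mu (~` A) = 0%E ->
  (\int[mu]_t (t ^+ 2)%:E < +oo)%E -> (forall t, A t -> t <= E) ->
  \int[mu]_t t <= E * fine (mu setT).
Proof.
move=> mA A0 t2 AE.
have it := integrable_id t2.
have ic : mu.-integrable setT (fun t : R => E%:E).
  apply/integrableP; split => //.
  by rewrite integral_cst // lte_mul_pinfty.
rewrite -Rintegral_cst // /Rintegral (negligible_integral (measurableC mA)) //.
rewrite [X in _ <= fine X](negligible_integral (measurableC mA)) //.
rewrite setTD setCK.
apply: le_Rintegral => //; first exact: integrableS it.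
  exact: integrableS ic.
Qed.
End SecondMoment.

Lemma cvg_sqrt0 (R : realType) (u : nat -> R) : u n @[n --> \oo] --> (0 : R) ->
  Num.sqrt (u n) @[n --> \oo] --> (0 : R).
Proof.
by move=> u0; rewrite -[X in _ --> X]sqrtr0; apply: continuous_cvg => //; exact: sqrt_continuous.
Qed.

(** * Domain, invariance and self-adjointness from a spectral measure *)

Section Spectral.
Variables (R : realType) (W : lmodType R[i]) (d : W -> W -> R).
Hypothesis dP : inner_product d.
Local Notation nm := (nm d).
Local Notation lim := (lim d).
Local Notation eqv := (eqv d).
Variable H : W -> W -> Prop.
Hypothesis HD : forall f g u v, H f u -> H g v -> H (f + g) (u + v).
Hypothesis H_closed : forall (f u : nat -> W) g w, (forall n, H (f n) (u n)) ->
  lim f g -> lim u w -> H g w.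
Hypothesis H_sym : forall f g u v, H f u -> H g v -> d u g = d f v.
Hypothesis H_ge0 : forall f u, H f u -> 0 <= d u f.
Hypothesis H_CS : forall f u v, H f u -> H u v -> nm u ^+ 4 <= d u f * d v u.
Variable P : set R -> W -> W.
Hypothesis P_sym : forall A f g, measurable A -> d (P A f) g = d f (P A g).
Hypothesis P_T : forall f, eqv (P setT f) f.
Hypothesis P_I : forall A A' f, measurable A -> measurable A' ->
  eqv (P (A `&` A') f) (P A (P A' f)).
Hypothesis P_mu : forall f, exists mu : {measure set R -> \bar R},
  [/\ forall A, measurable A -> mu A = (nm (P A f) ^+ 2)%:E,
      (exists u, H f u) <-> (\int[mu]_t (t ^+ 2)%:E < +oo)%E
    & forall u, H f u -> d u f = \int[mu]_t t].
Implicit Types (A S : set R) (f g h u v w : W).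

Lemma P_eqv A f g : measurable A -> eqv f g -> eqv (P A f) (P A g).
Proof. by move=> mA fg; apply: (eqvP dP) => z; rewrite !P_sym // (eqv_ip dP _ fg). Qed.

Lemma PD A f g : measurable A -> eqv (P A (f + g)) (P A f + P A g).
Proof. by move=> mA; apply: (eqvP dP) => z; rewrite (ip_addl dP) !P_sym // (ip_addl dP). Qed.

Lemma P_ip A f : measurable A -> nm (P A f) ^+ 2 = d (P A f) f.
Proof.
move=> mA; rewrite nm_sqr // P_sym // -(eqv_ipr dP _ (P_I f mA mA)) setIid.
by rewrite (ip_sym dP).
Qed.

(* f lies in the range of P A. *)
Definition supp f A := eqv f (P A f).
Lemma suppP f A (mu : {measure set R -> \bar R}) : measurable A ->
  (forall A, measurable A -> mu A = (nm (P A f) ^+ 2)%:E) -> supp f A <-> mu (~` A) = 0%E.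
Proof.
move=> mA hmu; have mT : measurable [set: R] by [].
have : mu setT = (mu A + mu (~` A))%E.
  by rewrite -measureU ?setUv ?setICr //; exact: measurableC.
rewrite !hmu //; last exact: measurableC.
rewrite -EFinD (eqv_nm dP (P_T f)) => -[e].
rewrite /supp /eqv; split => [h|[] /eqP].
  have k : nm (P A f) = nm f by rewrite (eqv_nm dP h).
  by move: e; rewrite k => e; congr EFin; lra.
rewrite sqrf_eq0 => /eqP h; move: e; rewrite h expr0n addr0 => e.
have : nm (f - P A f) ^+ 2 = 0.
  rewrite nm_sqr // !(ipE dP) -!nm_sqr // (ip_sym dP f) -P_ip // e; lra.
by move/eqP; rewrite sqrf_eq0 => /eqP.
Qed.

Lemma mu_T f (mu : {measure set R -> \bar R}) :
  (forall A, measurable A -> mu A = (nm (P A f) ^+ 2)%:E) -> mu setT = (nm f ^+ 2)%:E.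
Proof. by move=> h; rewrite h // (eqv_nm dP (P_T f)). Qed.

Lemma P_set0 f : nm (P set0 f) = 0.
Proof.
have [mu [h _ _]] := P_mu f; have := h set0 measurable0.
by rewrite measure0 => -[] /esym/eqP; rewrite sqrf_eq0 => /eqP.
Qed.

Lemma suppI f A A' : measurable A -> measurable A' -> supp f A -> supp f A' -> supp f (A `&` A').
Proof.
move=> mA mA' h h'; apply: (eqv_trans dP h); apply: (eqv_trans dP (P_eqv mA h')).
exact: (eqv_sym dP (P_I f mA mA')).
Qed.

Lemma supp_P f A S : measurable A -> measurable S -> supp f A -> supp (P S f) A.
Proof.
move=> mA mS h; apply: (eqv_trans dP (P_eqv mS h)).
apply: (eqv_trans dP (eqv_sym dP (P_I f mS mA))); rewrite setIC; exact: P_I.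
Qed.

Lemma supp_Pself f A : measurable A -> supp (P A f) A.
Proof. by move=> mA; rewrite /supp; have := P_I f mA mA; rewrite setIid. Qed.

Lemma supp_dom f A M : measurable A -> (forall t, A t -> `|t| <= M) -> supp f A ->
  exists u, H f u.
Proof.
move=> mA AM fA; have [mu [h [_ i] _]] := P_mu f; apply: i.
have fT : (mu setT < +oo)%E by rewrite (mu_T h) ltry.
by apply: (second_moment_supp fT mA _ AM); apply/(suppP mA h).
Qed.

Lemma supp_form_le f u A E : measurable A -> (forall t, A t -> t <= E) -> supp f A ->
  H f u -> d u f <= E * nm f ^+ 2.
Proof.
move=> mA AE fA fu; have [mu [h [i _] j]] := P_mu f; rewrite (j _ fu).
have fT : (mu setT < +oo)%E by rewrite (mu_T h) ltry.
have := @Rintegral_supp_le _ mu fT A E mA; rewrite (mu_T h) /=; apply => //.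
  by apply/(suppP mA h).
by apply: i; exists u.
Qed.

(** Boundedness of A puts f in the domain, and then 0 <= <H f, f> <= - e |f|^2. *)
Lemma supp_neg_eq0 f A M e : 0 < e -> measurable A -> (forall t, A t -> `|t| <= M) ->
  (forall t, A t -> t <= - e) -> supp f A -> nm f = 0.
Proof.
move=> e0 mA AM Ae fA; have [u fu] := supp_dom mA AM fA.
have := le_trans (H_ge0 fu) (supp_form_le mA Ae fA fu).
rewrite mulNr oppr_ge0 pmulr_rle0 // => h.
by apply/eqP; rewrite -sqrf_eq0 eq_le h sqr_ge0.
Qed.

(** The open negative half-line is a countable union of bounded intervals at positive distance from
    0, each of mass zero by [supp_neg_eq0]. *)
Lemma supp_ge0 f : supp f `[0, +oo[%classic.
Proof.
have [mu [h _ _]] := P_mu f.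
have mA : measurable `[(0:R), +oo[%classic by exact: measurable_itv.
apply/(suppP mA h).
pose F n : set R := `[- n.+1%:R, - n.+1%:R^-1]%classic.
have -> : ~` `[(0:R), +oo[%classic = \bigcup_n F n.
  apply/seteqP; split => x /=.
    rewrite in_itv /= andbT => /negP; rewrite -ltNge => x0.
    pose m := maxn (Num.trunc (- x)) (Num.trunc (- x)^-1).
    exists m => //; rewrite /F /= in_itv /=; apply/andP; split.
      rewrite lerNl (le_trans (ltW (truncnS_gt _))) // ler_nat ltnS leq_maxl //.
    rewrite lerNr -[leRHS]invrK lef_pV2 ?posrE ?invr_gt0 ?oppr_gt0 //.
    by rewrite (le_trans (ltW (truncnS_gt _))) // ler_nat ltnS leq_maxr.
  move=> [n _]; rewrite /F /= !in_itv /= andbT => /andP[_ xn]; apply/negP.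
  by rewrite -ltNge (le_lt_trans xn) // oppr_lt0.
have mF n : measurable (F n) by exact: measurable_itv.
apply/eqP; rewrite -measure_le0.
apply: (le_trans (measure_sigma_subadditive mu mF _ (subset_refl _))).
  by apply: bigcup_measurable => n _.
  exact: subset_refl.
rewrite eseries0 // => n _ _; rewrite h // (@supp_neg_eq0 _ (F n) n.+1%:R n.+1%:R^-1) ?expr0n //.
- move=> t; rewrite /F /= in_itv /= => /andP[t1 t2]; rewrite ler_norml t1 /=.
  by rewrite (le_trans t2) // (@le_trans _ _ 0) // oppr_le0.
- by move=> t; rewrite /F /= in_itv /= => /andP[].
- exact: supp_Pself.
Qed.

Definition low E : set R := `]-oo, E]%classic.
Lemma mlow E : measurable (low E). Proof. exact: measurable_itv. Qed.

Lemma low_supp f E : supp f (low E) -> supp f `[0, E]%classic.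
Proof.
move=> h; have -> : `[0, E]%classic = low E `&` `[0, +oo[%classic.
  by rewrite /low; apply/seteqP; split => x /=; rewrite !in_itv /= !andbT; [case/andP|move=> [-> ->]].
by apply: suppI => //; [exact: mlow|exact: supp_ge0].
Qed.

Lemma low_dom f E : supp f (low E) -> exists u, H f u.
Proof.
move=> /low_supp; apply: (@supp_dom _ _ E); first exact: measurable_itv.
by move=> t /=; rewrite in_itv /= => /andP[t0 tE]; rewrite ger0_norm.
Qed.

(** The cross terms <P S f, P S g> vanish for every S, so the measure of f + g is the sum of those
    of f and g. Integrating t gives <H (f + g), f + g> = <H f, f> + <H g, g>, and by symmetry the
    remaining cross term is 2 <H f, g>. This extracts off-diagonal information from a hypothesis on
    diagonal values. *)
Lemma supp_orth A f g u v : measurable A -> supp f A -> supp g (~` A) -> H f u -> H g v ->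
  d u g = 0.
Proof.
move=> mA fA gA fu gv; have mA' := measurableC mA.
have [mu [h1 [i1 _] j1]] := P_mu f; have [nu [h2 [i2 _] j2]] := P_mu g.
have [la [h3 _ j3]] := P_mu (f + g).
have add S : measurable S -> la S = measure_add mu nu S.
  move=> mS; rewrite measure_addE h1 // h2 // h3 // -EFinD; congr EFin.
  have z : d (P S f) (P S g) = 0.
    rewrite P_sym // -(eqv_ipr dP _ (P_I g mS mS)) setIid (eqv_ip dP _ fA) P_sym //.
    rewrite (eqv_ipr dP _ (P_eqv mA (P_eqv mS gA))).
    rewrite -(eqv_ipr dP _ (P_eqv mA (P_I g mS mA'))).
    rewrite -(eqv_ipr dP _ (P_I g mA (measurableI _ _ mS mA'))) setICA setICr setI0.
    apply/eqP; rewrite -normr_le0 (le_trans (ip_CS dP _ _)) // P_set0 mulr0 //.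
  rewrite (eqv_nm dP (PD f g mS)) !nm_sqr // !(ipE dP).
  by rewrite (ip_sym dP (P S g) (P S f)) z addr0 add0r.
have t1 : mu.-integrable setT (fun t : R => t%:E).
  by apply: integrable_id; [rewrite (mu_T h1) ltry|apply: i1; exists u].
have t2 : nu.-integrable setT (fun t : R => t%:E).
  by apply: integrable_id; [rewrite (mu_T h2) ltry|apply: i2; exists v].
have e : d (u + v) (f + g) = d u f + d v g.
  rewrite (j3 _ (HD fu gv)) (j1 _ fu) (j2 _ gv) /Rintegral.
  rewrite (eq_measure_integral (measure_add mu nu)); last by move=> S mS _; exact: add.
  rewrite integral_measure_add // fineD //; exact: integrable_fin_num.
move: e; rewrite !(ipE dP) (ip_sym dP v f) -(H_sym fu gv); lra.
Qed.

(** Continuity of mu_f from below, since |P (F n) f - f|^2 = |f|^2 - mu_f (F n). *)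
Lemma lim_P (F : nat -> set R) f : (forall n, measurable (F n)) ->
  (forall n m, (n <= m)%N -> F n `<=` F m) -> \bigcup_n F n = setT ->
  lim (fun n => P (F n) f) f.
Proof.
move=> mF ndF UF; have [mu [h _ _]] := P_mu f.
have hc : (mu \o F) n @[n --> \oo] --> (nm f ^+ 2)%:E.
  rewrite -(mu_T h) -UF; apply: nondecreasing_cvg_mu => //; first by rewrite UF.
  by move=> n m nm'; apply/subsetPset; exact: ndF.
have e n : nm (P (F n) f - f) = Num.sqrt (nm f ^+ 2 - fine ((mu \o F) n)).
  rewrite /nm /= h //= P_ip // nm_sqr // !(ipE dP) -nm_sqr // P_ip // (ip_sym dP f (P _ _)).
  by congr Num.sqrt; lra.
have k : nm f ^+ 2 - fine ((mu \o F) n) @[n --> \oo] --> nm f ^+ 2 - nm f ^+ 2.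
  by apply: cvgB; [exact: cvg_cst|exact: fine_cvg].
move: k; rewrite subrr => k; have := cvg_sqrt0 k; rewrite /lim.
by rewrite (_ : (fun n => nm (P (F n) f - f)) = fun n => Num.sqrt (nm f ^+ 2 - fine ((mu \o F) n))) //; apply/funext.
Qed.

Definition box n : set R := `[- n%:R, n%:R]%classic.
Lemma mbox n : measurable (box n). Proof. exact: measurable_itv. Qed.

Lemma lim_box f : lim (fun n => P (box n) f) f.
Proof.
apply: lim_P; first exact: mbox.
  move=> n m nm' x; rewrite /box /= !in_itv /= => /andP[a b].
  by rewrite (le_trans _ a) ?lerN2 ?ler_nat // (le_trans b) // ler_nat.
apply/seteqP; split => // x _; exists (Num.trunc `|x|).+1 => //.
by rewrite /box /= in_itv /= -ler_norml ltW //; exact: truncnS_gt.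
Qed.

Lemma lim_low f : lim (fun n => P (low n%:R) f) f.
Proof.
apply: lim_P => [n|n m nm' x|]; first exact: mlow.
  by rewrite /low /= !in_itv /= => /le_trans; apply; rewrite ler_nat.
apply/seteqP; split => // x _; exists (Num.trunc `|x|).+1 => //.
by rewrite /low /= in_itv /= (le_trans (ler_norm _)) // ltW //; exact: truncnS_gt.
Qed.

Lemma supp_H A f u : measurable A -> supp f A -> H f u -> supp u A.
Proof.
move=> mA fA fu; have mA' := measurableC mA.
have [mu [h _ _]] := P_mu u; apply/(suppP mA h); rewrite h //.
rewrite nm_sqr // P_sym //; congr EFin.
set g := P (~` A) u; set g' := P _ g.
apply: (cvg_seq_unique _ (lim_ip dP (lim_cst dP u) (lim_box g')) (cvg_cst 0)) => n /=.
have [v gv] : exists v, H (P (box n) g') v.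
  apply: (@supp_dom _ _ n%:R (mbox n) _ (supp_Pself _ (mbox n))).
  by move=> t; rewrite /box /= in_itv /= -ler_norml.
apply: (supp_orth mA fA _ fu gv); apply: supp_P => //; first exact: mbox.
exact: supp_Pself.
Qed.

(** By [H_CS], |H f|^4 <= <H f, f> <H^2 f, H f> <= E |f|^2 E |H f|^2; the second form bound applies
    because H f has the same support as f. *)
Lemma low_H_le f u E : 0 <= E -> supp f (low E) -> H f u -> nm u <= E * nm f.
Proof.
move=> E0 fE fu; have uE := supp_H (mlow E) fE fu.
have [v uv] := low_dom uE.
have lowE t : low E t -> t <= E by rewrite /low /= in_itv.
have h1 := supp_form_le (mlow E) lowE fE fu; have h2 := supp_form_le (mlow E) lowE uE uv.
have := le_trans (H_CS fu uv) (ler_pM (H_ge0 fu) (H_ge0 uv) h1 h2).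
rewrite (_ : _ * (_ * _) = (E * nm f) ^+ 2 * nm u ^+ 2); last by ring.
rewrite (_ : 4%N = (2 + 2)%N) // exprD => h.
have [->|u0] := eqVneq (nm u) 0; first by rewrite mulr_ge0 ?nm_ge0.
have u1 : 0 < nm u by rewrite lt_def u0 nm_ge0.
by move: h; rewrite ler_pM2r ?exprn_gt0 // ler_pXn2r // nnegrE ?mulr_ge0 ?nm_ge0.
Qed.

(** Self-adjointness: the adjoint of H is contained in H. The truncation [P (low n) v] lies in the
    domain, as its support is in [0, n]; testing against truncated vectors identifies its image with
    [P (low n) w]. Closedness then lets n tend to infinity. *)
Lemma weak_H v w : (forall g u, H g u -> d v u = d w g) -> H v w.
Proof.
move=> hvw; have mL n := mlow n%:R.
have /choice[u hu] n : exists u, H (P (low n%:R) v) u.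
  by apply: low_dom; exact: supp_Pself.
apply: (H_closed hu (lim_low v)).
apply: (@lim_of_le _ _ _ u w (fun n => nm (P (low n%:R) w - w))) => [n|]; last exact: lim_low.
have vL := supp_Pself v (mL n); have uL := supp_H (mL n) vL (hu n).
have e : eqv (u n) (P (low n%:R) w).
  apply: (eqvP dP) => h; have hL := supp_Pself h (mL n).
  have [k hk] := low_dom hL; have kL := supp_H (mL n) hL hk.
  rewrite (eqv_ip dP _ uL) !P_sym // (H_sym (hu n) hk) P_sym // -(eqv_ipr dP _ kL).
  exact: hvw.
rewrite -[X in nm (X - w)](subrK (P (low n%:R) w)) -addrA.
by rewrite (le_trans (nmD dP _ _)) // e add0r.
Qed.

Lemma low_iterates f E : 0 <= E -> supp f (low E) -> exists C (u : nat -> W),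
  [/\ u 0%N = f, forall n, H (u n) (u n.+1) & forall n, nm (u n) <= C * E ^+ n].
Proof.
move=> E0 fE.
(* G selects an image under H on the range of the projector. The value 0 elsewhere is a dummy: by
   [supp_H] the iterates never leave the range. *)
have /choice[G hG] (g : W) : exists u, supp g (low E) -> H g u.
  have [/low_dom[u gu]|n] := pselect (supp g (low E)); first by exists u.
  by exists 0.
exists (nm f), (fun n => iter n G f).
have hs n : supp (iter n G f) (low E).
  by elim: n => //= n IH; exact: supp_H (mlow E) IH (hG _ IH).
split => // n; first exact: hG.
elim: n => [|n IH]; first by rewrite expr0 mulr1.
rewrite /= (le_trans (low_H_le E0 (hs n) (hG _ (hs n)))) //.
by rewrite exprS mulrCA ler_wpM2l.
Qed.
End Spectral.

(** * The space L^2(R^2; C) *)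

Section L2Space.
Variable R : realType.
Local Notation plane := (measurableTypeR R * measurableTypeR R)%type.
Local Notation mu := (leb2 R).
Implicit Types (f g : R * R -> R[i]) (h k : R * R -> R).

Lemma absf_sqr f x : absf f x ^+ 2 = re f x ^+ 2 + im f x ^+ 2.
Proof.
rewrite /absf /re /im; case: (f x) => a b /=.
by rewrite sqr_sqrtr // addr_ge0 ?sqr_ge0.
Qed.

Lemma measurable_absf2 f : measurable_fun [set: plane] (re f) ->
  measurable_fun [set: plane] (im f) -> measurable_fun [set: plane] (fun x => absf f x ^+ 2).
Proof.
move=> mr mi; under eq_fun do rewrite absf_sqr.
by apply: measurable_funD; apply: measurable_funX.
Qed.

Lemma poweR2 (x : \bar R) : (0 <= x)%E -> (x `^ 2 = x ^+ 2)%E.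
Proof.
case: x => [r| _|]; last by [].
  by rewrite lee_fin => r0; rewrite poweR_EFin -EFin_expe powR_mulrn.
by rewrite poweRyr // expe2 mulyy.
Qed.

Lemma L2norm_sqr f : (L2norm f ^+ 2 = \int[mu]_x (absf f x ^+ 2)%:E)%E.
Proof.
rewrite /L2norm.
have n0 : (0 <= 'N[mu]_2%:E[EFin \o absf f])%E by exact: Lnorm_ge0.
rewrite -poweR2 // poweR_Lnorm //.
apply: eq_integral => x _ /=.
by rewrite powR_mulrn // real_normK // num_real.
Qed.

Lemma L2norm_ge0 f : (0 <= L2norm f)%E. Proof. exact: Lnorm_ge0. Qed.

Definition sqint (h : R * R -> R) := measurable_fun [set: plane] h /\
  (\int[mu]_x (h x ^+ 2)%:E < +oo)%E.

Lemma sqint_integrable_sqr h : sqint h -> mu.-integrable setT (fun x => (h x ^+ 2)%:E).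
Proof.
move=> [mh ih]; apply/integrableP; split.
  by apply/measurable_EFinP; exact: measurable_funX.
by under eq_integral do rewrite /= ger0_norm ?sqr_ge0 //.
Qed.

Lemma sqint_mul h k : sqint h -> sqint k -> mu.-integrable setT (fun x => (h x * k x)%:E).
Proof.
move=> hh kk; have [mh _] := hh; have [mk _] := kk.
apply: (@le_integrable _ _ _ _ _ _ _ ((EFin \o (fun x : plane => (h x ^+ 2)%R)) \+ (EFin \o (fun x : plane => (k x ^+ 2)%R)))%E) => //.
- by apply/measurable_EFinP; exact: measurable_funM.
- move=> x _; rewrite -EFinD /= lee_fin [X in _ <= X]ger0_norm ?addr_ge0 ?sqr_ge0 //.
  have := sqr_ge0 (`|h x| - `|k x|); rewrite sqrrB !real_normK ?num_real // normrM.
  have : 0 <= `|h x| * `|k x| by [].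
  lra.
- by apply: integrableD => //; exact: sqint_integrable_sqr.
Qed.

Lemma sqintD h k : sqint h -> sqint k -> sqint (fun x => h x + k x).
Proof.
move=> hh kk; have [mh _] := hh; have [mk _] := kk; split; first exact: measurable_funD.
have : mu.-integrable setT (((EFin \o (fun x : plane => (h x ^+ 2)%R)) \+ (EFin \o (fun x : plane => (h x * k x)%R)) \+
    ((EFin \o (fun x : plane => (h x * k x)%R)) \+ (EFin \o (fun x : plane => (k x ^+ 2)%R))))%E).
  apply: integrableD => //; apply: integrableD => //;
   by [exact: sqint_integrable_sqr|exact: sqint_mul].
move=> /integrableP[_]; apply: le_lt_trans; apply: ge0_le_integral => //.
- by move=> x _; rewrite lee_fin sqr_ge0.
- by apply/measurable_EFinP/measurable_funX; exact: measurable_funD.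
- apply/measurableT_comp => //; apply/measurable_EFinP.
  apply: measurable_funD; apply: measurable_funD.
  + exact: measurable_funX.
  + exact: measurable_funM.
  + exact: measurable_funM.
  + exact: measurable_funX.
- move=> x _; rewrite lee_fin (le_trans _ (ler_norm _)) //; lra.
Qed.

Lemma sqintZ a h : sqint h -> sqint (fun x => a * h x).
Proof.
move=> [mh ih]; split; first exact: measurable_funM.
under eq_integral do rewrite exprMn EFinM.
rewrite ge0_integralZl ?lee_fin ?sqr_ge0 //.
- by rewrite lte_mul_pinfty ?lee_fin ?sqr_ge0.
- by apply/measurable_EFinP/measurable_funX.
- by move=> x _; rewrite lee_fin sqr_ge0.
Qed.

Lemma sqint0 : sqint (fun=> 0).
Proof. by split => //; rewrite expr0n /= integral0. Qed.

Lemma sqintN h : sqint h -> sqint (fun x => - h x).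
Proof. by move=> /(sqintZ (-1)); under eq_fun do rewrite mulN1r. Qed.

Lemma L2P f : L2 f <-> sqint (re f) /\ sqint (im f).
Proof.
have e : measurable_fun [set: plane] (re f) -> measurable_fun [set: plane] (im f) ->
    (L2norm f ^+ 2 = \int[mu]_x (re f x ^+ 2)%:E + \int[mu]_x (im f x ^+ 2)%:E)%E.
  move=> mr mi; rewrite L2norm_sqr; under eq_integral do rewrite absf_sqr EFinD.
  rewrite ge0_integralD //.
  - by move=> x _; rewrite lee_fin sqr_ge0.
  - by apply/measurable_EFinP/measurable_funX.
  - by move=> x _; rewrite lee_fin sqr_ge0.
  - by apply/measurable_EFinP/measurable_funX.
have fin2 : (L2norm f < +oo)%E <-> (L2norm f ^+ 2 < +oo)%E.
  have := L2norm_ge0 f; case: (L2norm f) => [r||] //= _.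
  by rewrite -EFinM !ltry.
have i0 h : (0 <= \int[mu]_x (h x ^+ 2)%:E)%E.
  by apply: integral_ge0 => x _; rewrite lee_fin sqr_ge0.
split=> [[mr mi /fin2]|[[mr ir] [mi ii]]].
  rewrite e // => h; split; split => //; apply: le_lt_trans h; first by rewrite leeDl.
  by rewrite leeDr.
by split=> //; apply/fin2; rewrite e // lte_add_pinfty.
Qed.

Lemma reD f g : re (fun x => f x + g x) = fun x => re f x + re g x.
Proof. by apply/funext => x; rewrite /re; case: (f x); case: (g x). Qed.

Lemma imD f g : im (fun x => f x + g x) = fun x => im f x + im g x.
Proof. by apply/funext => x; rewrite /im; case: (f x); case: (g x). Qed.

Lemma reM f g : re (fun x => f x * g x) = fun x => re f x * re g x - im f x * im g x.
Proof. by apply/funext => x; rewrite /re /im; case: (f x); case: (g x). Qed.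

Lemma imM f g : im (fun x => f x * g x) = fun x => re f x * im g x + im f x * re g x.
Proof. by apply/funext => x; rewrite /re /im; case: (f x); case: (g x). Qed.

Lemma reZ (a : R) f x : re (fun x => a%:C%C * f x) x = a * re f x.
Proof. by rewrite /re; case: (f x) => b c /=; rewrite mul0r subr0. Qed.

Lemma imZ (a : R) f x : im (fun x => a%:C%C * f x) x = a * im f x.
Proof. by rewrite /im; case: (f x) => b c /=; rewrite mul0r addr0. Qed.

Lemma reJ f x : re (fun x => 'i%C * f x) x = - im f x.
Proof. by rewrite /re /im; case: (f x) => b c /=; rewrite mul0r mul1r sub0r. Qed.

Lemma imJ f x : im (fun x => 'i%C * f x) x = re f x.
Proof. by rewrite /re /im; case: (f x) => b c /=; rewrite mul0r mul1r add0r. Qed.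

(** The codomain [R[i]^o] makes functions a left module pointwise, and [L2T] inherits the structure
    as a submodule, without passing to a quotient. *)
Definition L2pred : {pred (R * R -> R[i]^o)} := fun f => `[< L2 f >].

Lemma L2_submod_closed : submod_closed L2pred.
Proof.
split=> [|a f g /asboolP/L2P[rf imf] /asboolP/L2P[rg ig]]; apply/asboolP/L2P.
  by split; exact: sqint0.
have -> : a *: f + g = fun x => (fun=> a) x * f x + g x by [].
rewrite reD imD reM imM; split; apply: sqintD => //; apply: sqintD.
- exact: (sqintZ (complex.Re a)).
- by apply: sqintN; exact: (sqintZ (complex.Im a)).
- exact: (sqintZ (complex.Re a)).
- exact: (sqintZ (complex.Im a)).
Qed.
HB.instance Definition _ := GRing.isSubmodClosed.Build _ _ L2pred L2_submod_closed.

Record L2T := MkL2T { L2val :> R * R -> R[i]^o ; L2valP : L2pred L2val }.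
HB.instance Definition _ := [isSub of L2T for L2val].
HB.instance Definition _ := [Choice of L2T by <:].
HB.instance Definition _ := [SubChoice_isSubLmodule of L2T by <:].

Lemma L2T_L2 (f : L2T) : L2 f. Proof. exact/asboolP/L2valP. Qed.

Definition toL2 (f : R * R -> R[i]) (hf : L2 f) : L2T := MkL2T (asboolT hf).

Definition dot (f g : L2T) : R := \int[mu]_x (re f x * re g x + im f x * im g x).

Lemma dot_integrable (f g : L2T) :
  mu.-integrable setT (fun x : plane => (re f x * re g x + im f x * im g x)%:E).
Proof.
have [/L2P[rf imf] /L2P[rg ig]] := (L2T_L2 f, L2T_L2 g).
by apply: (integrableD _ (sqint_mul rf rg) (sqint_mul imf ig)).
Qed.

Lemma dotP : inner_product dot.
Proof.
split.
- move=> f g h; rewrite /dot -RintegralD //; try exact: dot_integrable.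
  apply: eq_Rintegral => x _.
  have -> : re (f + g : L2T) x = re f x + re g x by have := reD f g; move/(congr1 (@^~ x)).
  have -> : im (f + g : L2T) x = im f x + im g x by have := imD f g; move/(congr1 (@^~ x)).
  by rewrite !mulrDl addrACA.
- move=> a f g; rewrite /dot -RintegralZl //; try exact: dot_integrable.
  apply: eq_Rintegral => x _.
  by rewrite (reZ a f x) (imZ a f x) mulrDr !mulrA.
- by move=> f g; apply: eq_Rintegral => x _; rewrite mulrC; congr (_ + _); rewrite mulrC.
- move=> f; apply: Rintegral_ge0 => x _; by rewrite addr_ge0 // -expr2 sqr_ge0.
- move=> f g; rewrite /dot -mulN1r -RintegralZl //; try exact: dot_integrable.
  apply: eq_Rintegral => x _.
  by rewrite (reJ f x) (imJ f x) (reJ g x) (imJ g x) mulN1r opprD mulrN opprK mulNr addrC.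
Qed.
End L2Space.

(** * The Riesz-Fischer theorem *)

Section L2Complete.
Context d (T : measurableType d) (R : realType) (mu : {measure set T -> \bar R}).

Lemma fatou_sqr (h : nat -> T -> R) (l : T -> R) (e : \bar R) (N : nat) :
  (forall n, measurable_fun setT (h n)) ->
  (forall x, h n x @[n --> \oo] --> l x) ->
  (forall n, (N <= n)%N -> (\int[mu]_x (h n x ^+ 2)%:E <= e)%E) ->
  (\int[mu]_x (l x ^+ 2)%:E <= e)%E.
Proof.
move=> mh hl he.
have hl2 x : (h n x ^+ 2)%:E @[n --> \oo] --> (l x ^+ 2)%:E.
  by apply: cvg_EFin; [exact: nearW|]; rewrite expr2; under eq_fun do rewrite /= expr2; exact: cvgM.
have -> : (\int[mu]_x (l x ^+ 2)%:E = \int[mu]_x limn_einf (fun n => (h n x ^+ 2)%:E))%E.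
  apply: eq_integral => x _; by have [-> _] := cvg_limn_einf_sup (hl2 x).
apply: (le_trans (@fatou _ _ _ mu setT measurableT (fun n x => (h n x ^+ 2)%:E) _ _)).
- by move=> n; apply/measurable_EFinP/measurable_funX.
- by move=> n x _; rewrite lee_fin sqr_ge0.
rewrite limn_einf_lim; apply: lime_le; first exact: is_cvg_einfs.
exists N => // n /= Nn; apply: (le_trans (y := \int[mu]_x (h n x ^+ 2)%:E)%E); last exact: he.
by apply: ereal_inf_lbound; exists n => /=.
Qed.

Lemma geo_sum_le (n : nat) : \sum_(0 <= k < n) (2^-1 : R) ^+ k <= 2.
Proof.
have -> : \sum_(0 <= k < n) (2^-1 : R) ^+ k = 2 - 2 * 2^-1 ^+ n.
  elim: n => [|n IH]; first by rewrite big_nil expr0; ring.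
  by rewrite big_nat_recr //= IH exprS; field.
by rewrite gerBl mulr_ge0 // exprn_ge0.
Qed.

(** Increments are at most sqrt c / 2^k, so the telescoping series converges absolutely. *)
Lemma sqr_summable_cvg (w : nat -> R) (c : R) :
  (forall k, 4 ^+ k * (w k.+1 - w k) ^+ 2 <= c) -> cvgn w.
Proof.
move=> hw.
have c0 : 0 <= c by apply: le_trans (hw 0%N); rewrite mulr_ge0 ?sqr_ge0 ?exprn_ge0.
have : cvgn (series (telescope w)).
  apply: normed_cvg.
  apply: (@series_le_cvg _ _ (geometric (Num.sqrt c) 2^-1)) => //.
  - by move=> n; exact: normr_ge0.
  - by move=> n; rewrite /= mulr_ge0 ?sqrtr_ge0 // exprn_ge0.
  - move=> n; rewrite /telescope /=.
    rewrite -(@ler_pXn2r _ 2) ?nnegrE ?mulr_ge0 ?sqrtr_ge0 ?exprn_ge0 //.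
    rewrite exprMn sqr_sqrtr // real_normK ?num_real // exprAC.
    by rewrite exprVn -natrX exprVn ler_pdivlMr ?exprn_gt0 // mulrC; exact: hw.
  - by apply: is_cvg_geometric_series; rewrite ger0_norm // invf_lt1 // ltr1n.
move=> hs; have -> : w = fun n => w 0%N + series (telescope w) n.
  by apply/funext => n; exact: eq_sum_telescope.
by apply: is_cvgD => //; exact: is_cvg_cst.
Qed.

(** A rapidly Cauchy subsequence converges almost everywhere; Fatou's lemma along it turns the
    Cauchy estimate for h n - h m into one for h n - l. *)
Lemma L2_complete (h : nat -> T -> R) :
  (forall n, measurable_fun setT (h n)) ->
  (forall e, 0 < e -> exists N : nat, forall n m, (N <= n)%N -> (N <= m)%N ->
     (\int[mu]_x ((h n x - h m x) ^+ 2)%:E <= e%:E)%E) ->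
  exists l : T -> R, measurable_fun setT l /\
    forall e, 0 < e -> exists N : nat, forall n, (N <= n)%N ->
     (\int[mu]_x ((h n x - l x) ^+ 2)%:E <= e%:E)%E.
Proof.
move=> mh hc.
(* The rate 8^-k leaves a summable 2^-k after multiplication by the weight 4^k that enters [D]. *)
have /choice[s hs] (k : nat) : exists N : nat, forall n m, (N <= n)%N -> (N <= m)%N ->
     (\int[mu]_x ((h n x - h m x) ^+ 2)%:E <= ((8^-1) ^+ k)%:E)%E.
  by apply: hc; rewrite exprn_gt0 // invr_gt0.
(* The partial sums make both [t k] and [t k.+1] at least [s k]; the added k makes [t k] at least
   k. *)
pose t k := (\sum_(i < k.+1) s i + k)%N.
have st k : (s k <= t k)%N by rewrite /t big_ord_recr /= -addnA addnCA leq_addr.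
have st1 k : (s k <= t k.+1)%N.
  by rewrite (leq_trans (st k)) // /t [X in (_ <= X + _)%N]big_ord_recr /= leq_add // leq_addr.
have tk k : (k <= t k)%N by rewrite leq_addl.
pose w k := h (t k).
have mw k : measurable_fun setT (w k) by exact: mh.
pose D k x := 4 ^+ k * (w k.+1 x - w k x) ^+ 2.
have D0 k x : 0 <= D k x by rewrite mulr_ge0 ?sqr_ge0 ?exprn_ge0.
have mD k : measurable_fun setT (EFin \o D k).
  apply/measurable_EFinP; apply: measurable_funM => //; apply: measurable_funX.
  exact: measurable_funB.
have iD k : (\int[mu]_x (D k x)%:E <= ((2^-1) ^+ k)%:E)%E.
  rewrite /D; under eq_integral do rewrite EFinM.
  rewrite ge0_integralZl ?lee_fin ?exprn_ge0 //; first last.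
  - by move=> x _; rewrite lee_fin sqr_ge0.
  - by apply/measurable_EFinP/measurable_funX; exact: measurable_funB.
  apply: (@le_trans _ _ ((4 ^+ k)%:E * ((8^-1) ^+ k)%:E)%E).
    by rewrite lee_pmul2l ?lte_fin ?exprn_gt0 //; exact: hs.
  by rewrite -EFinM lee_fin -exprMn (_ : 4 / 8 = 2^-1 :> R) //; field.
pose S (x : T) : \bar R := (\sum_(0 <= k <oo | k \in xpredT) (D k x)%:E)%E.
have mS : measurable_fun setT S.
  apply: (ge0_emeasurable_sum (P := xpredT)) => // [k x _ _|k _]; [by rewrite lee_fin|exact: mD].
have iS : (\int[mu]_x S x <= 2%:E)%E.
  rewrite integral_nneseries //; last by move=> n x _; rewrite lee_fin.
  apply: lime_le; first by apply: is_cvg_nneseries => n _ _; apply: integral_ge0 => x _; rewrite lee_fin.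
  apply: nearW => n; apply: (@le_trans _ _ (\sum_(0 <= k < n) ((2^-1) ^+ k)%:E)%E).
    by apply: lee_sum => k _.
  by rewrite sumEFin lee_fin geo_sum_le.
have S0 x : (0 <= S x)%E by apply: nneseries_ge0 => n _ _; rewrite lee_fin.
have intS : mu.-integrable setT S.
  apply/integrableP; split => //; apply: (le_lt_trans _ (ltry 2)).
  by under eq_integral do rewrite gee0_abs //.
have aeS := integrable_ae measurableT intS.
(* On the null set N the subsequence is replaced by 0, so that [v] converges at every point and its
   limit is measurable. *)
pose N := [set x | S x = +oo%E].
have mN : measurable N.
  rewrite (_ : N = S @^-1` [set +oo%E]); first by rewrite -[_ @^-1` _]setTI; exact: mS.
  by apply/seteqP; split.
have DS x k : S x != +oo%E -> D k x <= fine (S x).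
  move=> Sx; rewrite -lee_fin fineK; last by rewrite ge0_fin_numE // lt_neqAle Sx leey.
  apply: (le_trans _ (nneseries_lim_ge k.+1 _)); last by move=> n _ _; rewrite lee_fin.
  rewrite big_nat_recr //= leeDr // sumEFin lee_fin; exact: sumr_ge0.
pose v k x := if x \in N then 0 else w k x.
have vc x : cvgn (v ^~ x).
  have [xN|/negP xN] := boolP (x \in N).
    rewrite (_ : v ^~ x = fun=> 0); first exact: is_cvg_cst.
    by apply/funext => k; rewrite /v xN.
  rewrite (_ : v ^~ x = w ^~ x); last by apply/funext => k; rewrite /v ifF //; exact/negP.
  apply: (@sqr_summable_cvg _ (fine (S x))) => k; apply: DS.
  by apply/negP => /eqP xS; apply: xN; rewrite inE.
have mv k : measurable_fun setT (v k).
  apply: measurable_fun_ifT => //.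
  apply: (measurable_fun_bool true) => /=.
  rewrite setTI (_ : _ @^-1` _ = N) //; apply/seteqP; split => x /=; first by move/set_mem.
  exact: mem_set.
pose l x := limn (v ^~ x).
have ml : measurable_fun setT l by apply: (measurable_fun_cvg mv) => x _; exact: vc.
exists l; split => // e e0.
have [M hM] := hc _ e0; exists M => n Mn.
apply: (@fatou_sqr (fun k x => h n x - v k x) _ _ M).
- by move=> k; exact: measurable_funB.
- by move=> x; apply: cvgB; [exact: cvg_cst|exact: vc].
move=> k Mk; apply: (le_trans _ (hM n (t k) Mn (leq_trans Mk (tk k)))).
rewrite le_eqVlt; apply/orP; left; apply/eqP.
apply: ge0_ae_eq_integral => //.
- by apply/measurable_EFinP/measurable_funX; exact: measurable_funB.
- by apply/measurable_EFinP/measurable_funX; exact: measurable_funB.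
- by move=> x _; rewrite lee_fin sqr_ge0.
- by move=> x _; rewrite lee_fin sqr_ge0.
apply: filterS aeS => x Sx _ /=; rewrite /v.
case: ifPn => //; rewrite inE /N /= => xS; by have := Sx Logic.I; rewrite xS.
Qed.
End L2Complete.

(** * The seminorm of [L2T]: almost everywhere equality, convergence, completeness *)

Section L2Facts.
Variable R : realType.
Local Notation plane := (measurableTypeR R * measurableTypeR R)%type.
Local Notation mu := (leb2 R).
Implicit Types (f g : L2T R).
Local Notation nm := (nm (@dot R)).

Lemma dot_sqr f : (L2norm f ^+ 2 = (dot f f)%:E)%E.
Proof.
rewrite L2norm_sqr /dot /Rintegral fineK; last first.
  by apply: integrable_fin_num => //; exact: dot_integrable.
by apply: eq_integral => x _; rewrite absf_sqr.
Qed.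

Lemma L2norm_nm f : L2norm f = (nm f)%:E.
Proof.
have := L2norm_ge0 f; have := dot_sqr f.
case: (L2norm f) => [r| |]; [|by rewrite expe2 mulyy|by []].
rewrite -EFin_expe lee_fin => -[e] r0; rewrite -[nm f]/(Num.sqrt (dot f f)) -e sqrtr_sqr ger0_norm //.
Qed.

Lemma inner_dot f g : complex.Re (inner f g) = dot f g.
Proof.
rewrite /inner /dot /=; apply: eq_Rintegral => x _; rewrite /re /im.
by case: (f x) => a b; case: (g x) => c e /=; rewrite mulrN opprK.
Qed.

Lemma reB f g x : re (f - g : L2T R) x = re f x - re g x.
Proof. by rewrite -[LHS]/(complex.Re (f x - g x)) /re; case: (f x) => a b; case: (g x). Qed.

Lemma imB f g x : im (f - g : L2T R) x = im f x - im g x.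
Proof. by rewrite -[LHS]/(complex.Im (f x - g x)) /im; case: (f x) => a b; case: (g x). Qed.

Lemma eqv_ae f g : eqv (@dot R) f g <-> ae_eq mu setT f g.
Proof.
have mabs2 (k : L2T R) : measurable_fun [set: plane] (fun x => (absf k x ^+ 2)%:E).
  by have [mr mi _] := L2T_L2 k; apply/measurable_EFinP; exact: measurable_absf2.
rewrite /eqv; split => h.
  have i0 : (\int[mu]_x `|(absf (f - g : L2T R) x ^+ 2)%:E| = 0)%E.
    under eq_integral do rewrite gee0_abs ?lee_fin ?sqr_ge0 //.
    by rewrite -L2norm_sqr L2norm_nm h expe2 mule0.
  have /ae_eq_integral_abs := i0 => /(_ measurableT (mabs2 _)).
  apply: filterS => x /(_ Logic.I)[] /eqP; rewrite absf_sqr paddr_eq0 ?sqr_ge0 //.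
  rewrite !sqrf_eq0 reB imB !subr_eq0 => /andP[/eqP e1 /eqP e2] _.
  by move: e1 e2; rewrite /re /im; case: (val f x) => a b; case: (val g x) => c e /= -> ->.
have : (L2norm (f - g : L2T R)%R ^+ 2 = 0)%E.
  rewrite L2norm_sqr -(integral0 mu setT); apply: ge0_ae_eq_integral => //.
  - by move=> x _; rewrite lee_fin sqr_ge0.
  - by apply: filterS h => x /(_ Logic.I) h _; rewrite absf_sqr reB imB /re /im h !subrr !expr0n /= addr0.
by rewrite L2norm_nm -EFin_expe => -[] /eqP; rewrite sqrf_eq0 => /eqP.
Qed.

Lemma L2cvg_lim (u : nat -> L2T R) f : L2cvg u f <-> lim (@dot R) u f.
Proof.
rewrite /L2cvg -[lim _ u f]/(nm (u n - f) @[n --> \oo] --> (0 : R)).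
have e : (fun n => L2norm (u n \- f)) = EFin \o (fun n => nm (u n - f)).
  by apply/funext => n /=; rewrite -L2norm_nm.
split=> [h|h].
  by move: h; rewrite e => /fine_cvgP[].
by rewrite e; apply: cvg_EFin => //; exact: nearW.
Qed.

Lemma L2T_complete (u : nat -> L2T R) : cauchy_seq (@dot R) u -> exists f, lim (@dot R) u f.
Proof.
move=> cu.
have sq f : (\int[mu]_x (re f x ^+ 2)%:E <= (nm f ^+ 2)%:E)%E /\
    (\int[mu]_x (im f x ^+ 2)%:E <= (nm f ^+ 2)%:E)%E.
  have [mr mi _] := L2T_L2 f.
  rewrite EFin_expe -L2norm_nm L2norm_sqr; split; apply: ge0_le_integral => //.
  - by move=> x _; rewrite lee_fin sqr_ge0.
  - by apply/measurable_EFinP/measurable_funX.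
  - by apply/measurable_EFinP; exact: measurable_absf2.
  - by move=> x _; rewrite lee_fin absf_sqr lerDl sqr_ge0.
  - by move=> x _; rewrite lee_fin sqr_ge0.
  - by apply/measurable_EFinP/measurable_funX.
  - by apply/measurable_EFinP; exact: measurable_absf2.
  - by move=> x _; rewrite lee_fin absf_sqr lerDr sqr_ge0.
have cu2 e : 0 < e -> exists N : nat, forall n m, (N <= n)%N -> (N <= m)%N -> nm (u n - u m) ^+ 2 <= e.
  move=> e0; have se : 0 < Num.sqrt e by rewrite sqrtr_gt0.
  have [N hN] := cu _ se; exists N => n m nN mN.
  by rewrite -(sqr_sqrtr (ltW e0)) lerXn2r // ?nnegrE ?nm_ge0 ?sqrtr_ge0 //; exact: hN.
have key (p : (R * R -> R[i]) -> R * R -> R) : (forall n, sqint (p (u n))) ->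
    (forall f g x, p (f - g : L2T R) x = p f x - p g x) ->
    (forall f, (\int[mu]_x (p f x ^+ 2)%:E <= (nm f ^+ 2)%:E)%E) ->
    exists2 l, sqint l & forall e, 0 < e -> exists N : nat, forall n, (N <= n)%N ->
     (\int[mu]_x ((p (u n) x - l x) ^+ 2)%:E <= e%:E)%E.
  move=> sp pB hp.
  have mp n : measurable_fun [set: plane] (p (u n)) by have [] := sp n.
  have [e e0|l [ml hl]] := L2_complete (T := plane) (mu := mu) mp.
    have [N hN] := cu2 e e0; exists N => n m nN mN.
    under eq_integral do rewrite -pB.
    by apply: le_trans (hp _) _; rewrite lee_fin hN.
  exists l => //; have [N hN] := hl 1 ltr01.
  have : sqint (fun x => p (u N) x - (p (u N) x - l x)).
    apply: sqintD => //; apply: sqintN; split; first exact: measurable_funB.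
    exact: le_lt_trans (hN N (leqnn _)) (ltry _).
  by under eq_fun do rewrite subKr.
have [a sa ha] := key (@re R) (fun n => (proj1 (L2P (u n)) (L2T_L2 (u n))).1) reB (fun f => (sq f).1).
have [b sb hb] := key (@im R) (fun n => (proj1 (L2P (u n)) (L2T_L2 (u n))).2) imB (fun f => (sq f).2).
have L2f : L2 (fun x => a x +i* b x) by apply/L2P.
exists (toL2 L2f); apply/cvgrPdist_le => e e0.
have e2 : 0 < e ^+ 2 / 2 by rewrite divr_gt0 // exprn_gt0.
have [N hN] := ha _ e2; have [M hM] := hb _ e2.
exists (maxn N M) => // n /=; rewrite geq_max => /andP[nN nM].
rewrite sub0r normrN ger0_norm ?nm_ge0 // -(@ler_pXn2r _ 2) ?nnegrE ?nm_ge0 ?(ltW e0) //.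
rewrite -lee_fin EFin_expe -L2norm_nm L2norm_sqr.
have [mr mi _] := L2T_L2 (u n - toL2 L2f).
under eq_integral do rewrite absf_sqr EFinD.
rewrite ge0_integralD //; first last.
- by apply/measurable_EFinP/measurable_funX.
- by move=> x _; rewrite lee_fin sqr_ge0.
- by apply/measurable_EFinP/measurable_funX.
- by move=> x _; rewrite lee_fin sqr_ge0.
rewrite (splitr (e ^+ 2)) EFinD; apply: leeD.
  by under eq_integral do rewrite reB; exact: hN.
by under eq_integral do rewrite imB; exact: hM.
Qed.
End L2Facts.

(** * Calculus in the plane *)

Section Plane.
Variable R : realType.
Implicit Types (h k : R * R -> R) (j : 'I_2) (x : R * R).

Local Notation "''d_' j h" := (fun x => 'D_(dir R j) h x) (at level 10, j at level 8, h at level 9).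

Lemma partials_rcons a j h : partials (rcons a j) h = partials a ('d_j h).
Proof. by rewrite /partials foldr_rcons. Qed.

Lemma partials_cat a b h : partials (a ++ b) h = partials a (partials b h).
Proof. by rewrite /partials foldr_cat. Qed.

(** Coinduction: a class of continuous functions with partial derivatives in the same class consists
    of smooth functions. It is applied to inductively generated algebras, which avoids formulas for
    iterated derivatives. *)
Lemma smooth_coind (Q : (R * R -> R) -> Prop) :
  (forall h, Q h -> continuous h /\ forall j, (forall x, derivable h x (dir R j)) /\ Q ('d_j h)) ->
  forall h, Q h -> smooth h.
Proof.
move=> hQ h Qh a.
have Qa : Q (partials a h) by elim: a => //= j a /hQ[_ /(_ j)[]].
by have [c d] := hQ _ Qa; split => // j x; have [] := d j.
Qed.

Lemma smooth_cont h : smooth h -> continuous h.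
Proof. by move/(_ [::]) => []. Qed.

Lemma smooth_derivable h : smooth h -> forall j x, derivable h x (dir R j).
Proof. by move/(_ [::]) => []. Qed.

Lemma smooth_d h j : smooth h -> smooth ('d_j h).
Proof. by move=> sh a; rewrite -partials_rcons; exact: sh. Qed.

Lemma smooth_partials a h : smooth h -> smooth (partials a h).
Proof. by move=> sh b; rewrite -partials_cat; exact: sh. Qed.

Lemma dD h k j x : derivable h x (dir R j) -> derivable k x (dir R j) ->
  'D_(dir R j) (fun x => h x + k x) x = 'D_(dir R j) h x + 'D_(dir R j) k x.
Proof. exact: deriveD. Qed.

Lemma dM h k j x : derivable h x (dir R j) -> derivable k x (dir R j) ->
  'D_(dir R j) (fun x => h x * k x) x = h x * 'D_(dir R j) k x + k x * 'D_(dir R j) h x.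
Proof. exact: deriveM. Qed.

Lemma smooth_cst (c : R) : smooth (fun=> c : R).
Proof.
apply: (smooth_coind (Q := fun h => exists c, h = fun=> c)); last by exists c.
move=> _ [{}c ->]; split; first exact: cst_continuous.
move=> j; split => [x|]; first exact: derivable_cst.
by exists 0; apply/funext => x; exact: derive_cst.
Qed.

(** Stable under partial derivatives by the Leibniz rule, hence a class to which [smooth_coind]
    applies. *)
Inductive smooth_alg : (R * R -> R) -> Prop :=
| alg_base h of smooth h : smooth_alg h
| alg_add h k of smooth_alg h & smooth_alg k : smooth_alg (fun x => h x + k x)
| alg_mul h k of smooth_alg h & smooth_alg k : smooth_alg (fun x => h x * k x).

Lemma smooth_algP h : smooth_alg h -> smooth h.
Proof.
apply: smooth_coind => {}h; elim => {h}.
- move=> h sh; split; first exact: smooth_cont.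
  by move=> j; split; [exact: smooth_derivable|apply: alg_base; exact: smooth_d].
- move=> h k sh [ch IHh] sk [ck IHk]; split.
    by move=> x; apply: cvgD; [exact: ch|exact: ck].
  move=> j; have [dh ah] := IHh j; have [dk ak] := IHk j; split.
    by move=> x; exact: derivableD.
  rewrite (_ : 'd_j _ = fun x => 'd_j h x + 'd_j k x); first exact: alg_add.
  by apply/funext => x; exact: dD.
- move=> h k sh [ch IHh] sk [ck IHk]; split.
    by move=> x; apply: cvgM; [exact: ch|exact: ck].
  move=> j; have [dh ah] := IHh j; have [dk ak] := IHk j; split.
    by move=> x; exact: derivableM.
  rewrite (_ : 'd_j _ = fun x => (h x * 'd_j k x) + (k x * 'd_j h x)).
    by apply: alg_add; apply: alg_mul.
  by apply/funext => x; exact: dM.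
Qed.

Lemma smoothD h k : smooth h -> smooth k -> smooth (fun x => h x + k x).
Proof. by move=> sh sk; apply: smooth_algP; apply: alg_add; exact: alg_base. Qed.

Lemma smoothM h k : smooth h -> smooth k -> smooth (fun x => h x * k x).
Proof. by move=> sh sk; apply: smooth_algP; apply: alg_mul; exact: alg_base. Qed.

Lemma smoothN h : smooth h -> smooth (fun x => - h x).
Proof.
move=> sh; rewrite (_ : (fun x => - h x) = fun x => (fun=> -1) x * h x).
  exact: (smoothM (smooth_cst (-1)) sh).
by apply/funext => x; rewrite mulN1r.
Qed.

Lemma dN h j x : derivable h x (dir R j) ->
  'D_(dir R j) (fun x => - h x) x = - 'D_(dir R j) h x.
Proof. exact: deriveN. Qed.

Lemma dB h k j x : derivable h x (dir R j) -> derivable k x (dir R j) ->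
  'D_(dir R j) (fun x => h x - k x) x = 'D_(dir R j) h x - 'D_(dir R j) k x.
Proof. exact: deriveB. Qed.

Lemma dZ (a : R) h j x : derivable h x (dir R j) ->
  'D_(dir R j) (fun x => a * h x) x = a * 'D_(dir R j) h x.
Proof. by move=> dh; have := deriveZ a dh. Qed.

Lemma line_dir h (v a : R * R) t :
  (fun s => s^-1 *: ((h \o shift (t *: v + a)) (s *: v) - h (t *: v + a))) =
  (fun s => s^-1 *: (((fun r : R => h (r *: v + a)) \o shift t) (s *: (1 : R)) - (fun r : R => h (r *: v + a)) t)).
Proof. by apply/funext => s /=; rewrite /shift /= addrA -scalerDl /GRing.scale /= mulr1. Qed.

Lemma derivable_line h (v a : R * R) t :
  derivable h (t *: v + a) v <-> derivable (fun r : R => h (r *: v + a)) t 1.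
Proof. by rewrite /derivable line_dir. Qed.

Lemma derive_line h (v a : R * R) t :
  'D_v h (t *: v + a) = 'D_1 (fun r : R => h (r *: v + a)) t.
Proof. by rewrite /derive line_dir. Qed.

Lemma dir0E (t y : R) : (t, y) = t *: dir R ord0 + (0, y).
Proof.
rewrite [RHS]surjective_pairing; congr pair.
  by rewrite -[RHS]/(t * 1 + 0) mulr1 addr0.
by rewrite -[RHS]/(t * 0 + y) mulr0 add0r.
Qed.

Lemma dir1E (t y : R) : (t, y) = y *: dir R (lift ord0 ord0) + (t, 0).
Proof.
rewrite [RHS]surjective_pairing; congr pair.
  by rewrite -[RHS]/(y * 0 + t) mulr0 add0r.
by rewrite -[RHS]/(y * 1 + 0) mulr1 addr0.
Qed.
Let o1 : 'I_2 := lift ord0 ord0.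

Lemma derivable_fst h t y : derivable h (t, y) (dir R ord0) <-> derivable (fun s => h (s, y)) t 1.
Proof.
rewrite {1}dir0E derivable_line (_ : (fun r => h (_ + _)) = fun s => h (s, y)) //.
by apply/funext => r; rewrite -dir0E.
Qed.

Lemma derive_fst h t y : 'D_(dir R ord0) h (t, y) = derive1 (fun s => h (s, y)) t.
Proof.
rewrite {1}dir0E derive_line derive1E (_ : (fun r => h (_ + _)) = fun s => h (s, y)) //.
by apply/funext => r; rewrite -dir0E.
Qed.

Lemma derivable_snd h t y : derivable h (t, y) (dir R o1) <-> derivable (fun s => h (t, s)) y 1.
Proof.
rewrite {1}dir1E derivable_line (_ : (fun r => h (_ + _)) = fun s => h (t, s)) //.
by apply/funext => r; rewrite -dir1E.
Qed.

Lemma derive_snd h t y : 'D_(dir R o1) h (t, y) = derive1 (fun s => h (t, s)) y.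
Proof.
rewrite {1}dir1E derive_line derive1E (_ : (fun r => h (_ + _)) = fun s => h (t, s)) //.
by apply/funext => r; rewrite -dir1E.
Qed.

Lemma MVT_fst h (a b y : R) : a < b -> (forall x, derivable h x (dir R ord0)) ->
  exists2 c, c \in `]a, b[ & h (b, y) - h (a, y) = 'D_(dir R ord0) h (c, y) * (b - a).
Proof.
move=> ab dh; apply: (MVT (f := fun s => h (s, y)) (df := fun c => 'D_(dir R ord0) h (c, y)) ab).
  move=> t _; rewrite derive_fst derive1E; apply: DeriveDef => //.
  exact/derivable_fst.
apply: derivable_within_continuous => t _; exact/derivable_fst.
Qed.

Lemma MVT_snd h (a b t : R) : a < b -> (forall x, derivable h x (dir R o1)) ->
  exists2 c, c \in `]a, b[ & h (t, b) - h (t, a) = 'D_(dir R o1) h (t, c) * (b - a).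
Proof.
move=> ab dh; apply: (MVT (f := fun s => h (t, s)) (df := fun c => 'D_(dir R o1) h (t, c)) ab).
  move=> s _; rewrite derive_snd derive1E; apply: DeriveDef => //.
  exact/derivable_snd.
apply: derivable_within_continuous => s _; exact/derivable_snd.
Qed.

Lemma cvg_pt_corner (x y : R) (s t : nat -> R) :
  (forall n, s n \in `]x, x + n.+1%:R^-1[) -> (forall n, t n \in `]y, y + n.+1%:R^-1[) ->
  (s n, t n) @[n --> \oo] --> (x, y).
Proof.
have key (a : R) (u : nat -> R) : (forall n, u n \in `]a, a + n.+1%:R^-1[) -> u n @[n --> \oo] --> a.
  move=> hu; apply: (@squeeze_cvgr _ _ _ _ (fun=> a) (fun n => a + n.+1%:R^-1)).
  - by apply: nearW => n; have := hu n; rewrite in_itv /= => /andP[/ltW -> /ltW ->].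
  - exact: cvg_cst.
  - by rewrite -[X in _ --> X]addr0; apply: cvgD; [exact: cvg_cst|exact: cvg_harmonic].
by move=> hs ht; have := cvg_pair (key _ _ hs) (key _ _ ht); exact.
Qed.

Lemma cvg_seq_cont h (p : nat -> R * R) x : continuous h -> p n @[n --> \oo] --> x ->
  h (p n) @[n --> \oo] --> h x.
Proof. by move=> ch px; apply: continuous_cvg => //; exact: ch. Qed.

(** The second difference of h over a square of side 1 / (n + 1) with corner (x, y) equals, by the
    mean value theorem used in either order, the side squared times either mixed derivative at some
    point of the square. These points tend to the corner, where both mixed derivatives are
    continuous. *)
Lemma schwarz h : smooth h -> forall x, 'D_(dir R ord0) ('d_o1 h) x = 'D_(dir R o1) ('d_ord0 h) x.
Proof.
move=> sh [x y].
have d0 := @smooth_derivable _ sh ord0; have d1 := @smooth_derivable _ sh o1.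
have d01 := @smooth_derivable _ (smooth_d o1 sh) ord0.
have d10 := @smooth_derivable _ (smooth_d ord0 sh) o1.
have hn n : exists p : R * R * (R * R), [/\ p.1.1 \in `]x, x + n.+1%:R^-1[, p.1.2 \in `]y, y + n.+1%:R^-1[,
    p.2.1 \in `]x, x + n.+1%:R^-1[, p.2.2 \in `]y, y + n.+1%:R^-1[ &
    'D_(dir R ord0) ('d_o1 h) p.1 = 'D_(dir R o1) ('d_ord0 h) p.2].
  pose e : R := n.+1%:R^-1; have e0 : 0 < e by rewrite invr_gt0.
  have xe : x < x + e by rewrite ltrDl.
  have ye : y < y + e by rewrite ltrDl.
  (* The second difference is the increment of [k] along the first axis, and also that of [k'] along
     the second. *)
  pose k (p : R * R) := h (p.1, y + e) - h (p.1, y).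
  pose k' (p : R * R) := h (x + e, p.2) - h (x, p.2).
  have dk p : derivable k p (dir R ord0).
    case: p => a b; apply/derivable_fst; apply: derivableB; exact/derivable_fst.
  have dk' p : derivable k' p (dir R o1).
    case: p => a b; apply/derivable_snd; apply: derivableB; exact/derivable_snd.
  have [c hc] := MVT_fst y xe dk; rewrite derive_fst derive1E deriveB; last 2 first.
  - exact/derivable_fst.
  - exact/derivable_fst.
  rewrite -!derive1E -!derive_fst; have [c2 hc2 ->] := MVT_snd c ye d10; rewrite /k /= => eq1.
  have [b hb] := MVT_snd x ye dk'; rewrite derive_snd derive1E deriveB; last 2 first.
  - exact/derivable_snd.
  - exact/derivable_snd.
  rewrite -!derive1E -!derive_snd; have [b2 hb2 ->] := MVT_fst b xe d01; rewrite /k' /= => eq2.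
  exists ((b2, b), (c, c2)); split; [exact: hb2|exact: hb|exact: hc|exact: hc2|].
  have e1 : x + e - x = e by rewrite addrC addKr.
  have e2 : y + e - y = e by rewrite addrC addKr.
  have ne : e != 0 by rewrite gt_eqF.
  apply: (mulIf ne); apply: (mulIf ne).
  move: eq1 eq2; rewrite e1 e2.
  rewrite -[(b2, b, (c, c2)).1]/(b2, b) -[(b2, b, (c, c2)).2]/(c, c2).
  move: ('D_(dir R o1) _ (c, c2)) => D1; move: ('D_(dir R ord0) _ (b2, b)) => D2 <- <-.
  by move: (h (x + e, y + e)) (h (x + e, y)) (h (x, y + e)) (h (x, y)) => a1 a2 a3 a4; ring.
have [p hp] := choice hn.
have c1 : (p n).1 @[n --> \oo] --> (x, y).
  rewrite (_ : (fun n => (p n).1) = fun n => ((p n).1.1, (p n).1.2)); last by apply/funext => n; case: (p n).1.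
  by apply: cvg_pt_corner => n; have [] := hp n.
have c2 : (p n).2 @[n --> \oo] --> (x, y).
  rewrite (_ : (fun n => (p n).2) = fun n => ((p n).2.1, (p n).2.2)); last by apply/funext => n; case: (p n).2.
  by apply: cvg_pt_corner => n; have [] := hp n.
apply: (cvg_seq_unique (u := fun n => 'D_(dir R ord0) ('d_o1 h) (p n).1)
                       (v := fun n => 'D_(dir R o1) ('d_ord0 h) (p n).2)).
- by move=> n; have [] := hp n.
- exact: (cvg_seq_cont (smooth_cont (smooth_d ord0 (smooth_d o1 sh))) c1).
- exact: (cvg_seq_cont (smooth_cont (smooth_d o1 (smooth_d ord0 sh))) c2).
Qed.
End Plane.

Arguments smooth_derivable {R h} sh j x.

(** * Measurability, compact supports and integration by parts in the plane *)

Section PlaneMeasure.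
Variable R : realType.
Local Notation plane := (measurableTypeR R * measurableTypeR R)%type.
Local Notation mu := (leb2 R).
Implicit Types (h k : R * R -> R) (j : 'I_2) (x : R * R).

(** An open set is the union of the countably many rational rectangles it contains; this links the
    product topology to the product sigma-algebra. *)
Lemma open_measurable_plane (U : set (R * R)) : open U -> measurable (U : set plane).
Proof.
move=> oU.
pose square (q : rat * rat * (rat * rat)) : set (R * R) :=
  `]ratr q.1.1, ratr q.1.2[%classic `*` `]ratr q.2.1, ratr q.2.2[%classic.
have -> : U = \bigcup_q (if `[< square q `<=` U >] then square q else set0).
  apply/seteqP; split => [[a b] Uab|x [q _]]; last by case: asboolP => // qU; exact: qU.
  have /nbhs_ballP[e /= e0 eU] := open_nbhs_nbhs (conj oU Uab).
  have [q1 h1] := @rat_in_itvoo R (a - e) a ltac:(by rewrite gtrBl).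
  have [q2 h2] := @rat_in_itvoo R a (a + e) ltac:(by rewrite ltrDl).
  have [q3 h3] := @rat_in_itvoo R (b - e) b ltac:(by rewrite gtrBl).
  have [q4 h4] := @rat_in_itvoo R b (b + e) ltac:(by rewrite ltrDl).
  move: h1 h2 h3 h4; rewrite !in_itv /= => /andP[h1 h1'] /andP[h2 h2'] /andP[h3 h3'] /andP[h4 h4'].
  exists ((q1, q2), (q3, q4)) => //; case: asboolP => [_|[]].
    by split; rewrite /= in_itv /=; apply/andP; split.
  move=> [c d] [] /=; rewrite !in_itv /= => /andP[c1 c2] /andP[d1 d2]; apply: eU; split.
    by rewrite /ball /= ltr_distlC; apply/andP; split; [exact: lt_trans c1|exact: lt_trans h2'].
  by rewrite /ball /= ltr_distlC; apply/andP; split; [exact: lt_trans d1|exact: lt_trans h4'].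
apply: countable_bigcupT_measurable => // q; case: asboolP => // _.
by apply: measurableX; exact: measurable_itv.
Qed.

Lemma continuous_measurable_plane h : continuous h -> measurable_fun [set: plane] h.
Proof.
move=> /continuousP ch; apply: (measurability _ (RGenOpens.measurableE R)).
move=> _ [_ [a [b ->] <-]]; rewrite setTI; apply: open_measurable_plane.
exact/ch/interval_open.
Qed.

Definition compact_supp h := compact (closure [set x | h x != 0]).

Lemma cpt_sub h k : (forall x, k x != 0 -> h x != 0) -> compact_supp h -> compact_supp k.
Proof.
move=> hk ch; apply: (subclosed_compact _ ch); first exact: closed_closure.
exact: closure_subset.
Qed.

Lemma cpt_box h : compact_supp h -> exists2 M : R, 0 < M & forall x, h x != 0 -> `|x| <= M.
Proof.
move=> /compact_bounded[M [_ hM]]; exists (`|M| + 1); first by rewrite ltr_wpDl.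
move=> x hx; apply: hM; last exact: subset_closure.
by rewrite (le_lt_trans (ler_norm _)) // ltrDl.
Qed.

Lemma cpt_bounded h : continuous h -> compact_supp h -> exists C : R, forall x, `|h x| <= C.
Proof.
move=> ch kh.
have /compact_bounded[M [_ hM]] : compact (h @` closure [set x | h x != 0]).
  by apply: continuous_compact => //; exact: continuous_subspaceT.
exists (`|M| + 1) => x; have [->|hx] := eqVneq (h x) 0; first by rewrite normr0 addr_ge0.
apply: hM; first by rewrite (le_lt_trans (ler_norm _)) // ltrDl.
by exists x => //; exact: subset_closure.
Qed.

Definition square (M : R) : set (R * R) := `[- M, M]%classic `*` `[- M, M]%classic.
Lemma squareP M x : square M x <-> `|x| <= M.
Proof.
rewrite /square /= !in_itv /= -!ler_norml prod_normE /= ge_max; split; first by move=> [-> ->].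
by move=> /andP[].
Qed.

Lemma measurable_square M : measurable (square M : set plane).
Proof. by apply: measurableX; exact: measurable_itv. Qed.

Lemma leb2_square M : (mu (square M) < +oo)%E.
Proof.
rewrite (_ : mu (square M) = (lebesgue_measure `[(- M)%R, M]%classic * lebesgue_measure `[(- M)%R, M]%classic)%E); last first.
  by apply: product_measure1E; exact: measurable_itv.
by rewrite !lebesgue_measure_itv /=; case: ifP => // _; rewrite ?mule0 ?ltry // -!EFinD -EFinM ltry.
Qed.

Lemma cpt_integrable h : continuous h -> compact_supp h -> mu.-integrable setT (fun x : plane => (h x)%:E).
Proof.
move=> ch kh; have [C hC] := cpt_bounded ch kh; have [M M0 hM] := cpt_box kh.
have C0 : 0 <= C by apply: le_trans (hC 0).
apply/integrableP; split; first by apply/measurable_EFinP; exact: continuous_measurable_plane.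
apply: (@le_lt_trans _ _ (\int[mu]_x (C%:E * (\1_(square M) x)%:E))%E).
  apply: ge0_le_integral => //.
  - apply: measurableT_comp => //; apply/measurable_EFinP; exact: continuous_measurable_plane.
  - apply: emeasurable_funM => //; apply/measurable_EFinP; apply: measurable_indic; exact: measurable_square.
  - move=> x _; have [->|hx] := eqVneq (h x) 0; first by rewrite abse0 mule_ge0 ?lee_fin.
    rewrite indicE mem_set ?mule1 ?lee_fin //; first exact/squareP/hM.
rewrite ge0_integralZl ?lee_fin //.
- rewrite integral_indic ?setIT //; last exact: measurable_square.
  rewrite lte_mul_pinfty ?lee_fin //; exact: leb2_square.
- by apply/measurable_EFinP; apply: measurable_indic; exact: measurable_square.
Qed.

(** Off the closed support, h vanishes in a neighbourhood and so does its derivative. *)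
Lemma cpt_d h j : compact_supp h -> compact_supp (fun x => 'D_(dir R j) h x).
Proof.
move=> kh; apply: (subclosed_compact _ kh); first exact: closed_closure.
rewrite [X in _ `<=` X](closure_id _).1; last exact: closed_closure.
apply: closure_subset => x /eqP Dhx; apply: contrapT => hx; apply: Dhx.
rewrite -[RHS](derive_cst (0 : R) x (dir R j)); apply: near_eq_derive.
have := open_nbhs_nbhs (conj (closed_openC (@closed_closure _ [set x | h x != 0])) hx).
apply: filterS => y hy; apply/eqP; apply: contrapT => /negP hy0; apply: hy.
exact: subset_closure.
Qed.

Lemma continuous_fst h y : continuous h -> continuous (fun t : R => h (t, y)).
Proof.
move=> ch t; apply: (@continuous_comp _ _ _ (fun t => (t, y)) h); last exact: ch.
have c1 : (fun s : R => s) s @[s --> t] --> t by exact: cvg_id.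
have c2 : (fun=> y) s @[s --> t] --> y by exact: cvg_cst.
by have := cvg_pair c1 c2; exact.
Qed.

Lemma continuous_snd h y : continuous h -> continuous (fun t : R => h (y, t)).
Proof.
move=> ch t; apply: (@continuous_comp _ _ _ (fun t => (y, t)) h); last exact: ch.
have c1 : (fun s : R => s) s @[s --> t] --> t by exact: cvg_id.
have c2 : (fun=> y) s @[s --> t] --> y by exact: cvg_cst.
by have := cvg_pair c2 c1; exact.
Qed.

Lemma integral_derive0 (G : R -> R) (M : R) : 0 < M -> (forall t, derivable G t 1) ->
  continuous (derive1 G) -> (forall t, M < `|t| -> G t = 0) -> (forall t, M < `|t| -> derive1 G t = 0) ->
  (\int[lebesgue_measure]_t (derive1 G t)%:E = 0)%E.
Proof.
move=> M0 dG cG G0 dG0.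
(* G is known to vanish only for M < |t|, so the margin 1 places both endpoints where the boundary
   terms are zero. *)
have -> : (\int[lebesgue_measure]_t (derive1 G t)%:E =
    \int[lebesgue_measure]_(t in `[(- (M + 1))%R, (M + 1)%R]) (derive1 G t)%:E)%E.
  rewrite [RHS]integral_mkcond; apply: eq_integral => t _; rewrite /patch.
  case: ifPn => // /negP tM; rewrite dG0 // ltNge; apply/negP => tM'; apply: tM.
  by rewrite inE /= in_itv /= -ler_norml (le_trans tM') // lerDl.
have ab : - (M + 1) < M + 1 by rewrite gtrN // ltr_wpDl // ltW.
have cG0 : continuous G by move=> t; apply: differentiable_continuous; exact/derivable1_diffP.
have dGab : derivable_oo_LRcontinuous G (- (M + 1)) (M + 1).
  split; first by move=> t _; exact: dG.
  - exact/cvg_at_right_filter/cG0.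
  - exact/cvg_at_left_filter/cG0.
have eG : {in `](- (M + 1)), (M + 1)[, derive1 G =1 derive1 G} by move=> t _.
rewrite (continuous_FTC2 ab (continuous_subspaceT cG) dGab eG).
have M1 : M < `|M + 1| by rewrite ger0_norm ?ltrDl // addr_ge0 // ltW.
by rewrite !G0 ?subee // normrN.
Qed.

(** Fubini with the j-th variable integrated first, then the fundamental theorem of calculus. This
    is the integration by parts behind the symmetry of the magnetic derivatives. *)
Lemma compact_supp_div h j : smooth h -> compact_supp h -> \int[mu]_x 'D_(dir R j) h x = 0.
Proof.
move=> sh kh; have kd := @cpt_d h j kh.
have cd := smooth_cont (smooth_d j sh).
have id := cpt_integrable cd kd.
have [M1 M10 hM1] := cpt_box kh; have [M2 M20 hM2] := cpt_box kd.
pose M := Num.max M1 M2.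
have h0 x : M < `|x| -> h x = 0.
  move=> Mx; apply/eqP; apply: contrapT => /negP /hM1; rewrite leNgt (le_lt_trans _ Mx) //.
  by rewrite le_max lexx.
have d0 x : M < `|x| -> 'D_(dir R j) h x = 0.
  move=> Mx; apply/eqP; apply: contrapT => /negP /hM2; rewrite leNgt (le_lt_trans _ Mx) //.
  by rewrite le_max lexx orbT.
have M0 : 0 < M by rewrite lt_max M10.
rewrite /Rintegral; suff -> : (\int[mu]_x ('D_(dir R j) h x)%:E = 0)%E by [].
have [j0|j1] : j = ord0 \/ j = lift ord0 ord0.
  by case: j {kd cd id hM2 d0} => -[|[|//]] p; [left|right]; apply: val_inj.
  rewrite -(fubini2 id) /fubini_G -[RHS](integral0 lebesgue_measure setT).
  apply: eq_integral => y _; rewrite j0.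
  under eq_integral do rewrite derive_fst.
  apply: (integral_derive0 M0) => [t||t tM|t tM].
  - apply/derivable_fst; exact: smooth_derivable.
  - rewrite (_ : derive1 _ = fun t => 'D_(dir R ord0) h (t, y)); last by apply/funext => s; rewrite derive_fst.
    by rewrite -j0; exact: (continuous_fst (h := fun x => 'D_(dir R j) h x) cd).
  - by apply: h0; rewrite prod_normE /= lt_max tM.
  - by rewrite -derive_fst -j0; apply: d0; rewrite prod_normE /= lt_max tM.
rewrite -(fubini1 id) /fubini_F -[RHS](integral0 lebesgue_measure setT).
apply: eq_integral => y _; rewrite j1.
under eq_integral do rewrite derive_snd.
apply: (integral_derive0 M0) => [t||t tM|t tM].
- apply/derivable_snd; exact: smooth_derivable.
- rewrite (_ : derive1 _ = fun t => 'D_(dir R (lift ord0 ord0)) h (y, t)); last by apply/funext => s; rewrite derive_snd.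
  by rewrite -j1; exact: (continuous_snd (h := fun x => 'D_(dir R j) h x) cd).
- by apply: h0; rewrite prod_normE /= lt_max tM orbT.
- by rewrite -derive_snd -j1; apply: d0; rewrite prod_normE /= lt_max tM orbT.
Qed.
End PlaneMeasure.

Arguments cpt_d {R h j} kh.

(** * The Landau operator on test functions *)

Lemma sum_ord2 (V : nmodType) (F : 'I_2 -> V) : \sum_(j < 2) F j = F ord0 + F (lift ord0 ord0).
Proof. by rewrite big_ord_recl big_ord1. Qed.

Section TestFunctions.
Variables (R : realType) (B : R).
Local Notation plane := (measurableTypeR R * measurableTypeR R)%type.
Local Notation mu := (leb2 R).
Implicit Types (h k : R * R -> R) (j : 'I_2) (x : R * R) (f g : R * R -> R[i]).
Local Notation "''d_' j h" := (fun x => 'D_(dir R j) h x) (at level 10, j at level 8, h at level 9).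
Let o1 : 'I_2 := lift ord0 ord0.

Lemma ord2_cases (j : 'I_2) : {j = ord0} + {j = o1}.
Proof. by case: j => -[|[|//]] p; [left|right]; apply: val_inj. Qed.

Lemma d_coord (j : 'I_2) x :
  [/\ derivable (fun x : R * R => x.1) x (dir R j),
      derivable (fun x : R * R => x.2) x (dir R j),
      'D_(dir R j) (fun x : R * R => x.1) x = (j == ord0)%:R &
      'D_(dir R j) (fun x : R * R => x.2) x = (j == o1)%:R].
Proof.
case: x => s t; case: (ord2_cases j) => ->.
  split; rewrite ?derive_fst ?derive1E ?derive_id ?derive_cst //; apply/derivable_fst.
    exact: derivable_id.
  exact: derivable_cst.
split; rewrite ?derive_snd ?derive1E ?derive_id ?derive_cst //; apply/derivable_snd.
  exact: derivable_cst.
exact: derivable_id.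
Qed.

Lemma smooth_coord : smooth (fun x : R * R => x.1) /\ smooth (fun x : R * R => x.2).
Proof.
pose Q (h : R * R -> R) := smooth h \/ h = (fun x : R * R => x.1) \/ h = (fun x : R * R => x.2).
have hQ h : Q h -> smooth h; last by split; apply: hQ; right; [left|right].
apply: smooth_coind => {}h [sh|[]->].
- split; first exact: smooth_cont.
  by move=> j; split; [exact: smooth_derivable|left; exact: smooth_d].
- split; first by move=> x; exact: cvg_fst.
  move=> j; split => [x|]; first by have [] := d_coord j x.
  left; rewrite (_ : 'd_j _ = (fun=> (j == ord0)%:R : R)); first exact: smooth_cst.
  by apply/funext => x; have [] := d_coord j x.
- split; first by move=> x; exact: cvg_snd.
  move=> j; split => [x|]; first by have [] := d_coord j x.
  left; rewrite (_ : 'd_j _ = (fun=> (j == o1)%:R : R)); first exact: smooth_cst.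
  by apply/funext => x; have [] := d_coord j x.
Qed.

(** The vector potential in the symmetric gauge: [magnetic B j] is i d_j + [pot j]. *)
Definition pot j x : R := if j == ord0 then - (B / 2 * x.2) else B / 2 * x.1.

Lemma smooth_pot j : smooth (pot j).
Proof.
have [s1 s2] := smooth_coord.
case: (ord2_cases j) => ->; rewrite /pot /=.
  by apply: smoothN; apply: (smoothM (smooth_cst (B / 2)) s2).
exact: (smoothM (smooth_cst (B / 2)) s1).
Qed.

Lemma d_pot0 x : 'D_(dir R o1) (pot ord0) x = - (B / 2).
Proof.
rewrite /pot eqxx dN; last first.
  by apply: (smooth_derivable (smoothM (smooth_cst (B / 2)) (proj2 smooth_coord))).
rewrite dZ; last exact: (smooth_derivable (proj2 smooth_coord)).
by have [_ _ _ ->] := d_coord o1 x; rewrite eqxx mulr1.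
Qed.

Lemma d_pot1 x : 'D_(dir R ord0) (pot o1) x = B / 2.
Proof.
rewrite /pot /= dZ; last exact: (smooth_derivable (proj1 smooth_coord)).
by have [_ _ -> _] := d_coord ord0 x; rewrite eqxx mulr1.
Qed.

Lemma re_magnetic j f : re (magnetic B j f) =
  fun x => - 'D_(dir R j) (im f) x + pot j x * re f x.
Proof.
apply/funext => x; rewrite /magnetic /pot /cpartial {1}/re.
case: eqP => _; move: ('D_(dir R j) (re f) x) ('D_(dir R j) (im f) x) => a b; rewrite /re;
  case: (f x) => c e /=; ring.
Qed.

Lemma im_magnetic j f : im (magnetic B j f) =
  fun x => 'D_(dir R j) (re f) x + pot j x * im f x.
Proof.
apply/funext => x; rewrite /magnetic /pot /cpartial {1}/im.
case: eqP => _; move: ('D_(dir R j) (re f) x) ('D_(dir R j) (im f) x) => a b; rewrite /im;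
  case: (f x) => c e /=; ring.
Qed.

Lemma csmooth_magnetic j f : csmooth f -> csmooth (magnetic B j f).
Proof.
move=> [sr si]; rewrite /csmooth re_magnetic im_magnetic; split; apply: smoothD.
- exact: smoothN (smooth_d j si).
- exact: smoothM (smooth_pot j) sr.
- exact: smooth_d.
- exact: smoothM (smooth_pot j) si.
Qed.

Lemma complex_eqP (z w : R[i]) : complex.Re z = complex.Re w -> complex.Im z = complex.Im w -> z = w.
Proof. by case: z w => a b [c e] /= -> ->. Qed.

Lemma cfun_eqP f g : re f =1 re g -> im f =1 im g -> f = g.
Proof. by move=> h1 h2; apply/funext => x; apply: complex_eqP; [exact: h1|exact: h2]. Qed.

(** Second derivatives cancel by [schwarz]; what remains is i (d_1 A_2 - d_2 A_1) f for the
    potential A = [pot], and the curl of A is B / 2 + B / 2. *)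
Lemma magnetic_comm f : csmooth f -> forall x,
  magnetic B ord0 (magnetic B o1 f) x - magnetic B o1 (magnetic B ord0 f) x = B%:C%C * ('i%C * f x).
Proof.
move=> [sr si] x.
have sp := smooth_pot.
have e (j k : 'I_2) : re (magnetic B j (magnetic B k f)) x =
   - ('D_(dir R j) ('d_k (re f)) x + (pot k x * 'D_(dir R j) (im f) x + im f x * 'D_(dir R j) (pot k) x))
   + pot j x * (- 'D_(dir R k) (im f) x + pot k x * re f x).
  rewrite re_magnetic im_magnetic re_magnetic; congr (- _ + _).
  rewrite dD; last 2 first.
  - exact: (smooth_derivable (smooth_d k _)).
  - exact: (smooth_derivable (smoothM (sp k) si)).
  by rewrite (dM (smooth_derivable (sp k) j x) (smooth_derivable si j x)).
have e' (j k : 'I_2) : im (magnetic B j (magnetic B k f)) x =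
   (- 'D_(dir R j) ('d_k (im f)) x + (pot k x * 'D_(dir R j) (re f) x + re f x * 'D_(dir R j) (pot k) x))
   + pot j x * ('D_(dir R k) (re f) x + pot k x * im f x).
  rewrite im_magnetic re_magnetic im_magnetic; congr (_ + _).
  rewrite dD; last 2 first.
  - exact: (smooth_derivable (smoothN (smooth_d k _))).
  - exact: (smooth_derivable (smoothM (sp k) sr)).
  rewrite dN; last exact: (smooth_derivable (smooth_d k _)).
  by rewrite (dM (smooth_derivable (sp k) j x) (smooth_derivable sr j x)).
have {e} := (e ord0 o1, e o1 ord0); have {e'} := (e' ord0 o1, e' o1 ord0).
rewrite (schwarz sr x) (schwarz si x) d_pot0 d_pot1 /re /im /=.
move: ('D_(dir R o1) ('d_ord0 (re f)) x) ('D_(dir R o1) ('d_ord0 (im f)) x) => u v.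
rewrite -/(re f) -/(im f).
move: ('D_(dir R o1) (re f) x) ('D_(dir R o1) (im f) x) => a1 b1.
move: ('D_(dir R ord0) (re f) x) ('D_(dir R ord0) (im f) x) => a0 b0.
move: (magnetic B ord0 (magnetic B o1 f) x) (magnetic B o1 (magnetic B ord0 f) x) => z w.
move: (pot o1 x) (pot ord0 x) => q1 q0.
rewrite /re /im; case: (f x) => p q; case: z => z1 z2; case: w => w1 w2 /= [-> ->] [-> ->].
by apply: complex_eqP => /=; field.
Qed.

Lemma csmooth_lin (a : R[i]) f g : csmooth f -> csmooth g -> csmooth (fun x => a * f x + g x).
Proof.
move=> [fr fi] [gr gi]; rewrite /csmooth reD imD reM imM.
have s1 := smooth_cst (complex.Re a); have s2 := smooth_cst (complex.Im a).
split; first exact: (smoothD (smoothD (smoothM s1 fr) (smoothN (smoothM s2 fi))) gr).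
exact: (smoothD (smoothD (smoothM s1 fi) (smoothM s2 fr)) gi).
Qed.

Lemma test_sub (K : set (R * R)) g : csmooth g -> compact K -> (forall x, ~ K x -> g x = 0) ->
  test_function g.
Proof.
move=> sg kK gK; split => //; apply: (subclosed_compact _ kK); first exact: closed_closure.
have cK : closed K by apply: compact_closed => //; exact: norm_hausdorff.
rewrite [X in _ `<=` X](closure_id _).1 //; apply: closure_subset => x /= /eqP gx.
by apply: contrapT => Kx; apply: gx; exact: gK.
Qed.

Lemma test_out f x : ~ closure [set y | f y != 0] x -> f x = 0.
Proof. by move=> h; apply/eqP; apply: contrapT => /negP fx; apply: h; exact: subset_closure. Qed.

Lemma test_magnetic j f : test_function f -> test_function (magnetic B j f).
Proof.
move=> [sf kf]; apply: (test_sub (csmooth_magnetic j sf) kf) => x Kx.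
have near0 : \near x, f x = 0.
  have := open_nbhs_nbhs (conj (closed_openC (@closed_closure _ [set x | f x != 0])) Kx).
  by apply: filterS => y; exact: test_out.
have dr : 'D_(dir R j) (re f) x = 0.
  rewrite -[RHS](derive_cst (0 : R) x (dir R j)); apply: near_eq_derive.
  by apply: filterS near0 => y; rewrite /re => ->.
have di : 'D_(dir R j) (im f) x = 0.
  rewrite -[RHS](derive_cst (0 : R) x (dir R j)); apply: near_eq_derive.
  by apply: filterS near0 => y; rewrite /im => ->.
have fx := test_out Kx.
apply: complex_eqP.
  by rewrite -[LHS]/(re (magnetic B j f) x) re_magnetic di oppr0 add0r /re fx mulr0.
by rewrite -[LHS]/(im (magnetic B j f) x) im_magnetic dr add0r /im fx mulr0.
Qed.

Lemma test_cpt f : test_function f -> compact_supp (re f) /\ compact_supp (im f).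
Proof.
move=> [_ kf]; have c : closed (closure [set x | f x != 0]) by exact: closed_closure.
split; apply: (subclosed_compact _ kf); try exact: closed_closure;
  apply: closure_subset => x /=; apply: contra_neq; rewrite /re /im => -> //.
Qed.

Lemma cpt_sqint h : continuous h -> compact_supp h -> sqint h.
Proof.
move=> ch kh; split; first exact: continuous_measurable_plane.
have : mu.-integrable setT (fun x : plane => (h x ^+ 2)%:E).
  apply: cpt_integrable; last by apply: cpt_sub kh => x; rewrite sqrf_eq0.
  have -> : (fun x : plane => h x ^+ 2) = (fun x => h x * h x) by apply/funext.
  by move=> x; apply: cvgM; exact: ch.
by move=> /integrableP[_]; under eq_integral do rewrite gee0_abs ?lee_fin ?sqr_ge0 //.
Qed.

Lemma test_L2 f : test_function f -> L2 f.
Proof.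
move=> tf; have [[sr si] _] := tf; have [kr ki] := test_cpt tf.
by apply/L2P; split; apply: cpt_sqint => //; exact: smooth_cont.
Qed.

Definition test_pred : {pred (R * R -> R[i]^o)} := fun f => `[< test_function f >].
Lemma test_submod_closed : submod_closed test_pred.
Proof.
have cs0 : csmooth (fun=> 0 : R[i]) by split; exact: smooth_cst.
split=> [|a f g /asboolP[sf kf] /asboolP[sg kg]]; apply/asboolP.
  by apply: (test_sub (K := set0)) => //; exact: compact0.
apply: (test_sub (K := closure [set x | f x != 0] `|` closure [set x | g x != 0])).
- exact: csmooth_lin.
- exact: compactU.
- move=> x /not_orP[fx gx]; rewrite -[LHS]/(a * f x + g x) (test_out fx) (test_out gx).
  by rewrite mulr0 addr0.
Qed.
HB.instance Definition _ := GRing.isSubmodClosed.Build _ _ test_pred test_submod_closed.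

Record testT := MkTest { testval :> R * R -> R[i]^o ; testvalP : test_pred testval }.
HB.instance Definition _ := [isSub of testT for testval].
HB.instance Definition _ := [Choice of testT by <:].
HB.instance Definition _ := [SubChoice_isSubLmodule of testT by <:].

Lemma testT_test (f : testT) : test_function f. Proof. exact/asboolP/testvalP. Qed.

Definition toTest f (hf : test_function f) : testT := MkTest (asboolT hf).

Lemma magnetic_lin (a : R[i]) j f g : csmooth f -> csmooth g ->
  magnetic B j (fun x => a * f x + g x) = fun x => a * magnetic B j f x + magnetic B j g x.
Proof.
move=> [fr fi] [gr gi].
have d1 h x : smooth h -> derivable h x (dir R j) by move=> sh; exact: smooth_derivable.
have d2 (c : R) h x : smooth h -> derivable (fun x => c * h x) x (dir R j).
  by move=> sh; exact: (smooth_derivable (smoothM (smooth_cst c) sh)).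
apply: cfun_eqP => x.
  rewrite reD reM !re_magnetic !im_magnetic reD imD reM imM.
  rewrite dD; [|exact: (smooth_derivable (smoothD (smoothM (smooth_cst _) fi) (smoothM (smooth_cst _) fr)))|exact: d1].
  rewrite dD; [|exact: d2|exact: d2].
  rewrite (dZ (complex.Re a) (d1 _ x fi)) (dZ (complex.Im a) (d1 _ x fr)) /re /im /=.
  rewrite -/(re _) -/(im _).
  move: ('D_(dir R j) (re f) x) ('D_(dir R j) (im f) x) ('D_(dir R j) (im g) x) => u1 u2 u3.
  by move: (pot j x) (complex.Re a) (complex.Im a) => p a1 a2; ring.
rewrite imD imM !re_magnetic !im_magnetic reD imD reM imM.
rewrite dD; [|exact: (smooth_derivable (smoothD (smoothM (smooth_cst _) fr) (smoothN (smoothM (smooth_cst _) fi))))|exact: d1].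
rewrite dB; [|exact: d2|exact: d2].
rewrite (dZ (complex.Re a) (d1 _ x fr)) (dZ (complex.Im a) (d1 _ x fi)) /re /im /=.
rewrite -/(re _) -/(im _).
move: ('D_(dir R j) (re f) x) ('D_(dir R j) (im f) x) ('D_(dir R j) (re g) x) => u1 u2 u3.
by move: (pot j x) (complex.Re a) (complex.Im a) => p a1 a2; ring.
Qed.

Definition ptest j (f : testT) : testT := toTest (test_magnetic j (testT_test f)).
Lemma ptest_linear j : linear (ptest j).
Proof.
move=> a f g; apply: val_inj; have [sf _] := testT_test f; have [sg _] := testT_test g.
exact: (magnetic_lin a j sf sg).
Qed.
HB.instance Definition _ j := GRing.isLinear.Build _ _ _ _ (ptest j) (ptest_linear j).

Definition iota (f : testT) : L2T R := toL2 (test_L2 (testT_test f)).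
Lemma iota_linear : linear iota.
Proof. by move=> a f g; apply: val_inj. Qed.
HB.instance Definition _ := GRing.isLinear.Build _ _ _ _ iota iota_linear.

Lemma ptest_comm (f : testT) : ptest ord0 (ptest o1 f) - ptest o1 (ptest ord0 f) = B%:C%C *: ('i%C *: f).
Proof.
apply: val_inj; apply/funext => x; have [sf _] := testT_test f.
exact: (magnetic_comm sf).
Qed.

(** The two integrands differ by d_j of the imaginary part of conj f * g, which has compact support;
    the potential is real and cancels. *)
Lemma ptest_sym j (f g : testT) : dot (iota (ptest j f)) (iota g) = dot (iota f) (iota (ptest j g)).
Proof.
have [[fr fi] _] := testT_test f; have [[gr gi] _] := testT_test g.
have [kfr kfi] := test_cpt (testT_test f); have [kgr kgi] := test_cpt (testT_test g).
apply/eqP; rewrite -subr_eq0 /dot -RintegralB //; try exact: dot_integrable.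
pose h x := re f x * im g x - im f x * re g x.
have sh : smooth h by apply: smoothD; [exact: smoothM|apply: smoothN; exact: smoothM].
have kh : compact_supp h.
  apply: (subclosed_compact _ (compactU kfr kfi)); first exact: closed_closure.
  rewrite -closureU; apply: closure_subset => x /=; rewrite /h => hx.
  have [f0|] := eqVneq (re f x) 0; last by left.
  by right; apply: contra_neq hx => f1; rewrite f0 f1 !mul0r subr0.
rewrite -(compact_supp_div j sh kh); apply/eqP; apply: eq_Rintegral => x _.
have -> : re (iota (ptest j f)) x = re (magnetic B j f) x by [].
have -> : im (iota (ptest j f)) x = im (magnetic B j f) x by [].
have -> : re (iota (ptest j g)) x = re (magnetic B j g) x by [].
have -> : im (iota (ptest j g)) x = im (magnetic B j g) x by [].
rewrite !re_magnetic !im_magnetic /h dB; last 2 first.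
- exact: (smooth_derivable (smoothM fr gi)).
- exact: (smooth_derivable (smoothM fi gr)).
rewrite (dM (smooth_derivable fr j x) (smooth_derivable gi j x)).
rewrite (dM (smooth_derivable fi j x) (smooth_derivable gr j x)).
rewrite -[re (iota f) x]/(re f x) -[im (iota f) x]/(im f x) -[re (iota g) x]/(re g x) -[im (iota g) x]/(im g x).
move: ('D_(dir R j) (re f) x) ('D_(dir R j) (im f) x) ('D_(dir R j) (re g) x) ('D_(dir R j) (im g) x) => u1 u2 u3 u4.
by move: (re f x) (im f x) (re g x) (im g x) (pot j x) => a1 a2 a3 a4 p; ring.
Qed.

Lemma kin_landau (f : testT) : testval (kin (ptest ord0) (ptest o1) f) = landau_expr B f.
Proof. exact: (esym (sum_ord2 (fun j => magnetic B j (magnetic B j f)))). Qed.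
End TestFunctions.

(** * The Landau operator as an instance of the abstract setting *)

Section LandauSpectral.
Variables (R : realType) (B : R).
Hypothesis B0 : 0 <= B.
Let o1 : 'I_2 := lift ord0 ord0.
Local Notation H := (kin_closure (@dot R) (@iota R) (ptest B ord0) (ptest B o1)).
Local Notation p0 := (ptest B ord0).
Local Notation p1 := (ptest B o1).

Lemma landau_clo (f u : L2T R) : landau B f u <-> H f u.
Proof.
split=> [[_ _ [phi [tphi h1 h2]]]|[phi [h1 h2]]].
  exists (fun n => toTest (tphi n)); split; first exact/L2cvg_lim.
  apply/L2cvg_lim; move: h2; congr (L2cvg _ _); apply/funext => n.
  by rewrite -(kin_landau B (toTest (tphi n))).
split; [exact: L2T_L2|exact: L2T_L2|exists (fun n => phi n : R * R -> R[i])].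
split=> [n||]; [exact: testT_test|by move/L2cvg_lim: h1|].
move/L2cvg_lim: h2; congr (L2cvg _ _); apply/funext => n.
exact: kin_landau.
Qed.

Variable P : set R -> (R * R -> R[i]) -> (R * R -> R[i]).
Hypothesis hP : spectral_measure (landau B) P.

(** The default 0 of [insubd] makes the map total on [L2T]; it does not occur for measurable A,
    where [P A f] is in L^2. *)
Definition spectral_proj (A : set R) (f : L2T R) : L2T R := insubd 0 (P A f : R * R -> R[i]^o).

Lemma spectral_projE A (f : L2T R) : measurable A -> spectral_proj A f = P A f :> (R * R -> R[i]).
Proof.
case: hP => hp _ _ _ mA; have [h _ _] := hp A mA.
by rewrite -[LHS]/(val (spectral_proj A f)) val_insubd ifT //; apply/asboolT/h/L2T_L2.
Qed.

Lemma spectral_proj_sym A (f g : L2T R) : measurable A -> dot (spectral_proj A f) g = dot f (spectral_proj A g).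
Proof.
case: hP => hp _ _ _ mA; have [_ h _] := hp A mA.
by rewrite -!inner_dot !spectral_projE // h //; exact: L2T_L2.
Qed.

Lemma spectral_projT (f : L2T R) : eqv (@dot R) (spectral_proj setT f) f.
Proof.
by case: hP => _ h _ _; apply/eqv_ae; rewrite spectral_projE //; apply: h; exact: L2T_L2.
Qed.

Lemma spectral_projI A A' (f : L2T R) : measurable A -> measurable A' ->
  eqv (@dot R) (spectral_proj (A `&` A') f) (spectral_proj A (spectral_proj A' f)).
Proof.
case: hP => _ _ h _ mA mA'; apply/eqv_ae; rewrite !spectral_projE //; last exact: measurableI.
by apply: h => //; exact: L2T_L2.
Qed.

Lemma spectral_proj_mu (f : L2T R) : exists nu : {measure set R -> \bar R},
  [/\ forall A, measurable A -> nu A = (nm (@dot R) (spectral_proj A f) ^+ 2)%:E,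
      (exists u, H f u) <-> (\int[nu]_t (t ^+ 2)%:E < +oo)%E
    & forall u, H f u -> dot u f = \int[nu]_t t].
Proof.
case: hP => _ _ _ h; have [nu [h1 h2 h3]] := h _ (L2T_L2 f); exists nu; split.
- by move=> A mA; rewrite h1 // -spectral_projE // L2norm_nm -EFin_expe.
- rewrite -h2; split=> -[u fu]; first by exists u; exact/landau_clo.
  by have [_ Lu _] := fu; exists (toL2 Lu); apply/landau_clo.
- by move=> u /landau_clo fu; rewrite -inner_dot h3.
Qed.

Let dotP' := dotP R.

(** The relation assumed on the core extends to the whole domain of the closure along approximating
    sequences; then [weak_H] applies. Self-adjointness of the closure thus comes from the spectral
    measure. *)
Lemma landau_SA (v w : L2T R) :
  (forall phi, dot v (iota (kin p0 p1 phi)) = dot w (iota phi)) -> H v w.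
Proof.
move=> h.
apply: (@weak_H R _ _ dotP' H _ _ _ _ spectral_proj spectral_proj_sym spectral_projT spectral_projI spectral_proj_mu).
- by move=> *; exact: cloD.
- by move=> f u g k hf; exact: (clo_closed dotP').
- by move=> *; apply: (clo_sym dotP' (ptest_sym B ord0) (ptest_sym B o1)); eassumption.
- by move=> *; apply: (clo_ge0 dotP' (ptest_sym B ord0) (ptest_sym B o1)); eassumption.
move=> g u [phi [h1 h2]].
exact: (cvg_seq_unique (fun n => h (phi n)) (lim_ip dotP' (lim_cst dotP' v) h2) (lim_ip dotP' (lim_cst dotP' w) h1)).
Qed.

Lemma range_bandlimited E (f : L2T R) : 0 <= E -> L2range (P `]-oo, E]%classic) f ->
  bandlimited (@dot R) (@iota R) p0 p1 E f.
Proof.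
move=> E0 [_ [g Lg fg]].
have mE : measurable `]-oo, E]%classic by exact: measurable_itv.
apply: (@low_iterates R _ _ dotP' H _ _ _ _ spectral_proj spectral_proj_sym spectral_projT spectral_projI spectral_proj_mu _ _ E0).
- by move=> *; exact: cloD.
- by move=> *; apply: (clo_sym dotP' (ptest_sym B ord0) (ptest_sym B o1)); eassumption.
- by move=> *; apply: (clo_ge0 dotP' (ptest_sym B ord0) (ptest_sym B o1)); eassumption.
- by move=> *; apply: (clo_form_CS dotP' (ptest_sym B ord0) (ptest_sym B o1)); eassumption.
have e : eqv (@dot R) f (spectral_proj `]-oo, E]%classic (toL2 Lg)) by apply/eqv_ae; rewrite spectral_projE.
apply: (eqv_trans dotP' e); apply: (eqv_trans dotP' (supp_Pself spectral_projI _ mE)).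
exact: (P_eqv dotP' spectral_proj_sym mE (eqv_sym dotP' e)).
Qed.
End LandauSpectral.

(** * Sobolev inequality and uniform limits *)

Section Lines.
Variable R : realType.
Local Notation plane := (measurableTypeR R * measurableTypeR R)%type.
Local Notation mu := (leb2 R).
Local Notation leb := (@lebesgue_measure R).
Implicit Types (h k : R * R -> R) (j : 'I_2) (x : R * R).

Lemma FTC_dist (G : R -> R) (a b : R) : a < b -> (forall t, derivable G t 1) ->
  continuous (derive1 G) ->
  (`|G b - G a|%:E <= \int[leb]_(t in `[a, b]) `|derive1 G t|%:E)%E.
Proof.
move=> ab dG cG.
have cG0 : continuous G by move=> t; apply: differentiable_continuous; exact/derivable1_diffP.
have dGab : derivable_oo_LRcontinuous G a b.
  split; first by move=> t _; exact: dG.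
  - exact/cvg_at_right_filter/cG0.
  - exact/cvg_at_left_filter/cG0.
have eG : {in `]a, b[, derive1 G =1 derive1 G} by move=> t _.
have := continuous_FTC2 ab (continuous_subspaceT cG) dGab eG.
rewrite -EFinB => /(congr1 abse) /= <-.
apply: le_abse_integral => //; apply/measurable_EFinP.
exact: (measurable_funS measurableT _ (continuous_measurable_fun cG)).
Qed.

Lemma integral_cst_itv (c a b : R) : a < b ->
  (\int[leb]_(t in `[a, b]) c%:E = (c * (b - a))%:E)%E.
Proof.
move=> ab; have e : leb `[a, b]%classic = (b - a)%:E.
  by rewrite lebesgue_measure_itv /= lte_fin ab.
rewrite EFinM -e; exact: integral_cst.
Qed.

(** Integrate the derivative of G - c t and use |q| <= eps + q^2 / (4 eps): the constants contribute
    2 eps (b - a), and the bound on the integral of q^2 one more eps (b - a). *)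
Lemma FTC_dist_cst (G : R -> R) (a b c eps : R) (q : R -> R) : a < b -> 0 < eps ->
  (forall t, derivable G t 1) -> continuous (derive1 G) -> continuous q ->
  (forall t, a <= t <= b -> `|derive1 G t - c| <= eps + `|q t|) ->
  (\int[leb]_t (q t ^+ 2)%:E <= (4 * eps ^+ 2 * (b - a))%:E)%E ->
  `|G b - G a - c * (b - a)| <= 3 * eps * (b - a).
Proof.
move=> ab e0 dG cG cq hq iq.
pose G1 t := G t - c * t.
have hG1 t : is_derive t (1 : R) G1 (derive1 G t - c).
  apply: is_deriveB; first by rewrite derive1E; apply: DeriveDef.
  have := @is_deriveZ R R R id c t 1 1 (is_derive_id t 1).
  by rewrite /GRing.scale /= mulr1; exact.
have dG1 t : derivable G1 t 1 by case: (hG1 t).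
have eG1 t : derive1 G1 t = derive1 G t - c by rewrite derive1E; case: (hG1 t).
have cG1 : continuous (derive1 G1).
  rewrite (_ : derive1 G1 = fun t => derive1 G t - c); last by apply/funext.
  by move=> t; apply: cvgB; [exact: cG|exact: cvg_cst].
have := FTC_dist ab dG1 cG1.
have -> : G1 b - G1 a = G b - G a - c * (b - a) by rewrite /G1; ring.
move=> h; rewrite -lee_fin (le_trans h) //.
have mq : measurable_fun setT (fun t => q t ^+ 2).
  by apply: measurable_funX; exact: continuous_measurable_fun.
apply: (@le_trans _ _ (\int[leb]_(t in `[a, b]) ((2 * eps)%:E + ((4 * eps)^-1 * q t ^+ 2)%:E))%E).
  apply: ge0_le_integral => //.
  - apply/measurable_EFinP; apply: (measurable_funS measurableT) => //.
    by apply: measurableT_comp => //; exact: continuous_measurable_fun.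
  - apply: emeasurable_funD => //; apply/measurable_EFinP; apply: (measurable_funS measurableT) => //.
    by apply: measurable_funM.
  - move=> t /=; rewrite in_itv /= => tab; rewrite -EFinD lee_fin eG1 (le_trans (hq _ tab)) //.
    have : 0 <= (4 * eps)^-1 * (`|q t| - 2 * eps) ^+ 2 by rewrite mulr_ge0 ?sqr_ge0 // invr_ge0 mulr_ge0 // ltW.
    have -> : (4 * eps)^-1 * (`|q t| - 2 * eps) ^+ 2 = (4 * eps)^-1 * `|q t| ^+ 2 - `|q t| + eps.
      by field; rewrite gt_eqF.
    rewrite real_normK ?num_real //; lra.
rewrite ge0_integralD //; first last.
- by apply/measurable_EFinP; apply: (measurable_funS measurableT) => //; exact: measurable_funM.
- by move=> t _; rewrite lee_fin mulr_ge0 ?sqr_ge0 // invr_ge0 mulr_ge0 // ltW.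
- by move=> t _; rewrite lee_fin mulr_ge0 // ltW.
rewrite integral_cst_itv //.
have -> : 3 * eps * (b - a) = 2 * eps * (b - a) + (4 * eps)^-1 * (4 * eps ^+ 2 * (b - a)).
  by field; rewrite gt_eqF.
rewrite EFinD leeD2l // EFinM.
under eq_integral do rewrite EFinM.
rewrite ge0_integralZl ?lee_fin ?invr_ge0 ?mulr_ge0 ?(ltW e0) //; first last.
- by move=> t _; rewrite lee_fin sqr_ge0.
- by apply/measurable_EFinP; apply: (measurable_funS measurableT).
rewrite lee_pmul2l ?lte_fin ?invr_gt0 ?mulr_gt0 //.
rewrite (le_trans _ iq) //; apply: ge0_subset_integral => //.
- by apply/measurable_EFinP.
- by move=> t _; rewrite lee_fin sqr_ge0.
Qed.

(** Average |G t| <= |G s| + int |G'| over s in [t, t + 1], an interval of length 1. *)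
Lemma sobolev_line (G : R -> R) (t : R) : (forall t, derivable G t 1) ->
  continuous (derive1 G) -> (`|G t|%:E <= \int[leb]_s (`|G s| + `|derive1 G s|)%:E)%E.
Proof.
move=> dG cG.
have cG0 : continuous G by move=> s; apply: differentiable_continuous; exact/derivable1_diffP.
have mG : measurable_fun setT (fun s => `|G s|%:E).
  by apply/measurable_EFinP/measurableT_comp => //; exact: continuous_measurable_fun.
have mdG : measurable_fun setT (fun s => `|derive1 G s|%:E).
  by apply/measurable_EFinP/measurableT_comp => //; exact: continuous_measurable_fun.
under eq_integral do rewrite EFinD.
rewrite ge0_integralD //.
set I1 := (\int[leb]_s `|derive1 G s|%:E)%E.
have key s : (`|G t|%:E <= `|G s|%:E + I1)%E.
  have [ts|ts|<-] := ltgtP t s; last by rewrite leeDl // integral_ge0.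
    have h : (`|G s - G t|%:E <= I1)%E.
      by apply: (le_trans (FTC_dist ts dG cG)); apply: ge0_subset_integral.
    rewrite (le_trans _ (leeD2l _ h)) // -EFinD lee_fin -{1}(subKr (G s) (G t)).
    by rewrite (le_trans (ler_normB _ _)).
  have h : (`|G t - G s|%:E <= I1)%E.
    by apply: (le_trans (FTC_dist ts dG cG)); apply: ge0_subset_integral.
  rewrite (le_trans _ (leeD2l _ h)) // -EFinD lee_fin -{1}(subrK (G s) (G t)) addrC.
  by rewrite (le_trans (ler_normD _ _)).
have I10 : (0 <= I1)%E by exact: integral_ge0.
have tt1 : t < t + 1 by rewrite ltrDl.
have leb1 : leb `[t, t + 1]%classic = 1%E.
  by rewrite lebesgue_measure_itv /= lte_fin tt1 -EFinB addrC addKr.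
apply: (@le_trans _ _ (\int[leb]_(s in `[t, (t + 1)%R]) (`|G s|%:E + I1))%E).
  rewrite -[leLHS]mule1 -leb1 -integral_cst //; apply: ge0_le_integral => //.
  - by move=> s _; rewrite /= lee_fin.
  - by apply: emeasurable_funD => //; exact: (measurable_funS measurableT).
rewrite ge0_integralD //; last exact: (measurable_funS measurableT).
have -> : (\int[leb]_(s in `[t, (t + 1)%R]) I1 = I1)%E.
  by rewrite -[RHS]mule1 -leb1; exact: integral_cst.
rewrite leeD2r //.
by apply: ge0_subset_integral.
Qed.

(* Puts the j-th coordinate first. *)
Definition swap (j : 'I_2) (p : R * R) : R * R := if j == ord0 then p else (p.2, p.1).

Lemma swapK j : involutive (swap j).
Proof. by rewrite /swap; case: eqP => _ [s t]. Qed.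

Lemma derivable_sw h j s t : derivable h (swap j (s, t)) (dir R j) <-> derivable (fun s => h (swap j (s, t))) s 1.
Proof. by case: (ord2_cases j) => ->; [exact: derivable_fst|exact: derivable_snd]. Qed.

Lemma derive_sw h j s t : 'D_(dir R j) h (swap j (s, t)) = derive1 (fun s => h (swap j (s, t))) s.
Proof. by case: (ord2_cases j) => ->; [exact: derive_fst|exact: derive_snd]. Qed.

Lemma continuous_sw h j t : continuous h -> continuous (fun s => h (swap j (s, t))).
Proof. by case: (ord2_cases j) => -> ch; [exact: continuous_fst|exact: continuous_snd]. Qed.

Lemma tonelli_sw (f : R * R -> \bar R) j : measurable_fun [set: plane] f -> (forall x, 0 <= f x)%E ->
  (\int[mu]_x f x = \int[leb]_t \int[leb]_s f (swap j (s, t)))%E /\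
  measurable_fun [set: measurableTypeR R] (fun t => \int[leb]_s f (swap j (s, t)))%E.
Proof.
move=> mf f0; case: (ord2_cases j) => ->.
  split; last exact: measurable_fun_fubini_tonelli_G.
  rewrite -[RHS]/(\int[leb]_t fubini_G leb f t)%E -fubini_tonelli // -fubini_tonelli1 //.
split; last exact: measurable_fun_fubini_tonelli_F.
exact: fubini_tonelli1.
Qed.

(** [sobolev_line] in the first variable, then under the integral in the second variable for h and
    for its first partial derivative; the only second derivative that arises is the mixed one. *)
Lemma sobolev_plane h x : smooth h -> (`|h x|%:E <=
  (\int[mu]_y `|h y|%:E + \int[mu]_y `|'D_(dir R (lift ord0 ord0)) h y|%:E) +
  (\int[mu]_y `|'D_(dir R ord0) h y|%:E +
   \int[mu]_y `|'D_(dir R (lift ord0 ord0)) (fun y => 'D_(dir R ord0) h y) y|%:E))%E.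
Proof.
set o1 := lift ord0 ord0 => sh.
have c0 := smooth_cont sh; have s0 := smooth_d ord0 sh; have c1 := smooth_cont s0.
have c2 := smooth_cont (smooth_d o1 sh); have c3 := smooth_cont (smooth_d o1 s0).
pose F (k : R * R -> R) (s : measurableTypeR R) : \bar R := (\int[leb]_t `|k (s, t)|%:E)%E.
have F0 k s : (0 <= F k s)%E by apply: integral_ge0 => t _; rewrite lee_fin.
have hF k : continuous k -> (\int[mu]_y `|k y|%:E = \int[leb]_s F k s)%E /\
    measurable_fun [set: measurableTypeR R] (F k).
  move=> ck; apply: (tonelli_sw (f := fun y => `|k y|%:E) o1) => [|y]; last by rewrite lee_fin.
  by apply/measurable_EFinP/measurableT_comp => //; exact: continuous_measurable_plane.
have [e0 m0] := hF _ c0; have [e1 m1] := hF _ c1; have [e2 m2] := hF _ c2; have [e3 m3] := hF _ c3.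
have addF k1 k2 k3 k4 : measurable_fun setT (F k1) -> measurable_fun setT (F k2) ->
    measurable_fun setT (F k3) -> measurable_fun setT (F k4) ->
    (\int[leb]_s ((F k1 s + F k2 s) + (F k3 s + F k4 s)) = (\int[leb]_s F k1 s + \int[leb]_s F k2 s) +
     (\int[leb]_s F k3 s + \int[leb]_s F k4 s))%E.
  move=> mk1 mk2 mk3 mk4; rewrite ge0_integralD //; first last.
  - exact: emeasurable_funD.
  - by move=> s _; rewrite adde_ge0.
  - exact: emeasurable_funD.
  - by move=> s _; rewrite adde_ge0.
  by rewrite (ge0_integralD _ _ _ mk1 _ mk2) // (ge0_integralD _ _ _ mk3 _ mk4).
rewrite e0 e1 e2 e3 -(addF _ _ _ _ m0 m2 m1 m3).
have line k s t : smooth k -> (`|k (s, t)|%:E <= F k s + F (fun y => 'D_(dir R o1) k y) s)%E.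
  move=> sk.
  have dk r : derivable (fun r => k (s, r)) r 1 by apply/derivable_snd; exact: (smooth_derivable sk).
  have eD : derive1 (fun r => k (s, r)) = fun r => 'D_(dir R o1) k (s, r).
    by apply/funext => r; rewrite derive_snd.
  have cD : continuous (derive1 (fun r => k (s, r))).
    by rewrite eD; exact: (continuous_snd (smooth_cont (smooth_d o1 sk))).
  have := sobolev_line t dk cD; rewrite eD => h1; apply: (le_trans h1).
  under eq_integral do rewrite EFinD.
  rewrite ge0_integralD //.
    by apply/measurable_EFinP/measurableT_comp => //; apply: continuous_measurable_fun;
      exact: (continuous_snd (smooth_cont sk)).
  by apply/measurable_EFinP/measurableT_comp => //; apply: continuous_measurable_fun;
      exact: (continuous_snd (smooth_cont (smooth_d o1 sk))).
case: x => x1 x2.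
have dh r : derivable (fun r => h (r, x2)) r 1 by apply/derivable_fst; exact: (smooth_derivable sh).
have eD : derive1 (fun r => h (r, x2)) = fun r => 'D_(dir R ord0) h (r, x2).
  by apply/funext => r; rewrite derive_fst.
have cD : continuous (derive1 (fun r => h (r, x2))).
  by rewrite eD; exact: (continuous_fst c1).
have := sobolev_line x1 dh cD; rewrite eD => h1; apply: (le_trans h1).
apply: ge0_le_integral => //.
- apply/measurable_EFinP; apply: measurable_funD; apply: measurableT_comp => //; apply: continuous_measurable_fun.
    exact: (continuous_fst c0).
  exact: (continuous_fst c1).
- exact: (emeasurable_funD (emeasurable_funD m0 m2) (emeasurable_funD m1 m3)).
- by move=> s _; rewrite EFinD; apply: leeD; [exact: (line _ s x2 sh)|exact: (line _ s x2 s0)].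
Qed.

(* Mean value argument: some line close to x_(1-j) = y carries little L^2 mass. *)
Lemma slice_sqint_small (k : R * R -> R) (j : 'I_2) (y e th : R) : continuous k ->
  0 < e -> 0 < th -> (\int[mu]_x (k x ^+ 2)%:E < (th * e)%:E)%E ->
  exists2 t, y <= t <= y + e & (\int[leb]_s (k (swap j (s, t)) ^+ 2)%:E <= th%:E)%E.
Proof.
move=> ck e0 th0 ik; apply: contrapT => hn.
have big t : y <= t <= y + e -> (th%:E <= \int[leb]_s (k (swap j (s, t)) ^+ 2)%:E)%E.
  by move=> yt; rewrite leNgt; apply/negP => h; apply: hn; exists t => //; exact: ltW.
have k0 x : (0 <= (k x ^+ 2)%:E :> \bar R)%E by rewrite lee_fin sqr_ge0.
have mk : measurable_fun [set: plane] (fun x => (k x ^+ 2)%:E).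
  by apply/measurable_EFinP/measurable_funX; exact: continuous_measurable_plane.
have [e1 m1] := tonelli_sw j mk k0.
move: ik; rewrite e1 ltNge => /negP; apply.
have ye : y < y + e by rewrite ltrDl.
have -> : th * e = th * (y + e - y) by rewrite [y + e]addrC addrK.
rewrite -(integral_cst_itv th ye).
set F := fun t => (\int[leb]_s (k (swap j (s, t)) ^+ 2)%:E)%E.
have F0 t : (0 <= F t)%E by exact: integral_ge0.
apply: (@le_trans _ _ (\int[leb]_(t in `[y, (y + e)%R]) F t)%E).
  apply: ge0_le_integral => //.
  - by move=> t _; rewrite lee_fin ltW.
  - exact: (measurable_funS measurableT).

by apply: ge0_subset_integral.
Qed.
End Lines.

(** * Differentiability of uniform limits *)

Section UniformLimits.
Variable R : realType.
Local Notation mu := (leb2 R).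
Implicit Types (h k w c : R * R -> R) (j : 'I_2) (x : R * R).

Definition unif_cvg (u : nat -> R * R -> R) h := forall e : R, 0 < e ->
  exists N : nat, forall n, (N <= n)%N -> forall x, `|u n x - h x| <= e.

Lemma continuous_dist h x (e : R) : continuous h -> 0 < e ->
  exists2 r : R, 0 < r & forall y, `|y - x| < r -> `|h y - h x| <= e.
Proof.
move=> ch e0; have /cvgrPdist_le/(_ _ e0) := ch x.
move=> /nbhs_ballP[r /= r0 hr]; exists r => // y yx.
rewrite distrC; apply: hr; rewrite -ball_normE /ball_ /= distrC //.
Qed.

Lemma unif_cvg_continuous u h : (forall n, continuous (u n)) -> unif_cvg u h -> continuous h.
Proof.
move=> cu uh x; apply/cvgrPdist_le => e e0.
have e3 : 0 < e / 3 by rewrite divr_gt0.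
have [N hN] := uh _ e3; have [r r0 hr] := @continuous_dist _ x _ (cu N) e3.
apply: filterS (nbhsx_ballx x r r0) => y; rewrite -ball_normE /ball_ /= distrC => /hr h1.
have h2 := hN N (leqnn _) x; have h3 := hN N (leqnn _) y.
have -> : h x - h y = (u N y - h y) - (u N x - h x) - (u N y - u N x) by ring.
rewrite (le_trans (ler_normB _ _)) // (le_trans (lerD (ler_normB _ _) (lexx _))) //.
by move: h1 h2 h3; move: (u N y - u N x) (u N x - h x) (u N y - h y) => a1 a2 a3; lra.
Qed.

Lemma unif_cauchy_cvg (u : nat -> R * R -> R) :
  (forall e, 0 < e -> exists N : nat, forall n m, (N <= n)%N -> (N <= m)%N ->
     forall x, `|u n x - u m x| <= e) -> exists h, unif_cvg u h.
Proof.
move=> cu.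
have cvgu x : cvgn (fun n => u n x).
  apply/cauchy_cvgP/cauchy_ballP => e e0; have e2 : 0 < e / 2 by rewrite divr_gt0.
  have [N hN] := cu _ e2.
  have hF : ((fun n => u n x) @ \oo) [set k | exists2 n, (N <= n)%N & u n x = k].
    by exists N => // n /= Nn; exists n.
  exists ([set k | exists2 n, (N <= n)%N & u n x = k], [set k | exists2 n, (N <= n)%N & u n x = k]).
    by split.
  move=> [_ _] /= [[n Nn <-] [m Nm <-]].
  rewrite -ball_normE /ball_ /= (@le_lt_trans _ _ (e / 2)) ?gtr_pMr ?invf_lt1 ?ltr1n //.
  exact: hN.
exists (fun x => limn (fun n => u n x)) => e e0.
have [N hN] := cu _ e0; exists N => n nN x.
have hc : u n x - u m x @[m --> \oo] --> u n x - limn (fun n => u n x).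
  by apply: cvgB; [exact: cvg_cst|exact: cvgu].
have hc' : `|u n x - u m x| @[m --> \oo] --> `|u n x - limn (fun n => u n x)| by exact: cvg_norm.
rewrite -(cvg_lim _ hc') //; apply: limr_le.
  by apply/cvg_ex; eexists; exact: hc'.
by exists N => // m /= Nm; exact: hN.
Qed.

Lemma dist_sw j (a y s t r : R) : `|s - a| < r -> `|t - y| < r -> `|swap j (s, t) - swap j (a, y)| < r.
Proof.
by move=> h1 h2; rewrite /swap; case: ifP => _; rewrite prod_normE /= gt_max; apply/andP; split.
Qed.

(** L^2 control of [q n] says nothing about one given line. The increment of h along a line is
    therefore compared with that of [u n] along a nearby parallel line on which [q n] has little
    mass, found by [slice_sqint_small]; continuity of h and uniform convergence allow the return.
    The term c * d n is small near x, where c is bounded. *)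
Lemma derive_limit j h w c (u d q : nat -> R * R -> R) :
  continuous h -> continuous w -> continuous c ->
  (forall n, smooth (u n)) -> (forall n, continuous (q n)) ->
  unif_cvg u h -> unif_cvg d (fun=> 0) ->
  (forall n x, 'D_(dir R j) (u n) x = w x + q n x + c x * d n x) ->
  (forall e, 0 < e -> exists N : nat, forall n, (N <= n)%N -> (\int[mu]_x (q n x ^+ 2)%:E <= e%:E)%E) ->
  forall x, derivable h x (dir R j) /\ 'D_(dir R j) h x = w x.
Proof.
move=> ch cw cc su cq uh d0 Du iq x0.
rewrite -(swapK j x0); case: (swap j x0) => a y {x0}; set x := swap j (a, y).
have key (e : R) : 0 < e -> exists2 r : R, 0 < r & forall p p', p < p' -> `|p - a| < r -> `|p' - a| < r ->
    `|h (swap j (p', y)) - h (swap j (p, y)) - w x * (p' - p)| <= 3 * e * (p' - p).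
  move=> e0; have e2 : 0 < e / 2 by rewrite divr_gt0.
  have [r1 r10 hr1] := @continuous_dist w x _ cw e2.
  have [r2 r20 hr2] := @continuous_dist c x _ cc ltr01.
  (* Bounds c near x; with |d n| <= e / (2 C) the product is at most e / 2, and the variation of w
     takes the other e / 2. *)
  pose C := `|c x| + 1; have C0 : 0 < C by rewrite ltr_wpDl.
  exists (Num.min r1 r2); first by rewrite lt_min r10.
  (* The auxiliary error k is spent in four quarters: replacing [u n] by h at the two endpoints, and
     moving the two endpoints back to the original line. *)
  move=> p p' pp' pa p'a; apply/ler_addgt0Pr => k k0.
  have k4 : 0 < k / 4 by rewrite divr_gt0.
  have [s1 s10 hs1] := @continuous_dist h (swap j (p, y)) _ ch k4.
  have [s2 s20 hs2] := @continuous_dist h (swap j (p', y)) _ ch k4.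
  (* Halving makes every point of the strip of width dl satisfy the four radius conditions
     strictly. *)
  pose dl := Num.min (Num.min r1 r2) (Num.min s1 s2) / 2.
  have dl0 : 0 < dl by rewrite divr_gt0 // !lt_min r10 r20 s10 s20.
  have dlm : dl < Num.min (Num.min r1 r2) (Num.min s1 s2).
    by rewrite gtr_pMr ?invf_lt1 ?ltr1n // !lt_min r10 r20 s10 s20.
  pose th := 4 * e ^+ 2 * (p' - p).
  have th0 : 0 < th by rewrite mulr_gt0 ?subr_gt0 // mulr_gt0 // exprn_gt0.
  have td0 : 0 < th * dl / 2 by rewrite divr_gt0 // mulr_gt0.
  have eC : 0 < e / (2 * C) by rewrite divr_gt0 // mulr_gt0.
  have [N1 hN1] := uh _ k4; have [N2 hN2] := d0 _ eC; have [N3 hN3] := iq _ td0.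
  pose n := maxn N1 (maxn N2 N3).
  have n1 : (N1 <= n)%N by rewrite leq_maxl.
  have n2 : (N2 <= n)%N by rewrite /n maxnCA leq_maxl.
  have n3 : (N3 <= n)%N by rewrite /n maxnA leq_maxr.
  have iqn : (\int[mu]_x (q n x ^+ 2)%:E < (th * dl)%:E)%E.
    apply: (le_lt_trans (hN3 _ n3)); rewrite lte_fin.
    by have := mulr_gt0 th0 dl0; move: (th * dl) => z; lra.
  have [t /andP[yt td] it] := slice_sqint_small j y (cq n) dl0 th0 iqn.
  have ty : `|t - y| < Num.min (Num.min r1 r2) (Num.min s1 s2).
    by apply: le_lt_trans dlm; rewrite ger0_norm ?subr_ge0 // lerBlDl.
  move: ty; rewrite !lt_min => /andP[/andP[ty1 ty2] /andP[ty3 ty4]].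
  move: pa p'a; rewrite !lt_min => /andP[pa1 pa2] /andP[pb1 pb2].
  pose G s := u n (swap j (s, t)).
  have dG s : derivable G s 1 by apply/derivable_sw; exact: (smooth_derivable (su n)).
  have eG : derive1 G = fun s => 'D_(dir R j) (u n) (swap j (s, t)).
    by apply/funext => s; rewrite derive_sw.
  have cG : continuous (derive1 G).
    by rewrite eG; exact: (@continuous_sw _ _ j t (smooth_cont (smooth_d j (su n)))).
  have cqt : continuous (fun s => q n (swap j (s, t))) by exact: continuous_sw.
  have bnd s : p <= s <= p' -> `|derive1 G s - w x| <= e + `|q n (swap j (s, t))|.
    move=> /andP[ps sp']; rewrite eG Du.
    have sa r : `|p - a| < r -> `|p' - a| < r -> `|s - a| < r.
      move: ps sp'; clear; rewrite !ltr_norml => ? ? /andP[? ?] /andP[? ?].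
      by apply/andP; split; lra.
    have w1 := hr1 _ (dist_sw j (sa _ pa1 pb1) ty1).
    have c1 := hr2 _ (dist_sw j (sa _ pa2 pb2) ty2).
    have d1 := hN2 _ n2 (swap j (s, t)); rewrite subr0 in d1.
    have c2 : `|c (swap j (s, t))| <= C.
      rewrite /C -(subrK (c x) (c (swap j (s, t)))) (le_trans (ler_normD _ _)) // addrC lerD2l //.
    have cd : `|c (swap j (s, t)) * d n (swap j (s, t))| <= e / 2.
      rewrite normrM (le_trans (ler_pM _ _ c2 d1)) //.
      by rewrite le_eqVlt; apply/orP; left; apply/eqP; field; rewrite gt_eqF.
    have -> : w (swap j (s, t)) + q n (swap j (s, t)) + c (swap j (s, t)) * d n (swap j (s, t)) - w x =
      (w (swap j (s, t)) - w x) + q n (swap j (s, t)) + c (swap j (s, t)) * d n (swap j (s, t)) by ring.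
    rewrite (le_trans (ler_normD _ _)) // (le_trans (lerD (ler_normD _ _) (lexx _))) //.
    move: w1 cd; rewrite -/x.
    by move: (`|_ - _|) (`|_ * _|) (`|q _ _|) => a1 a2 a3; clear; lra.
  have := FTC_dist_cst pp' e0 dG cG cqt bnd it; rewrite /G => big.
  have b1 := hN1 _ n1 (swap j (p, t)); have b2 := hN1 _ n1 (swap j (p', t)).
  have b3 : `|h (swap j (p, t)) - h (swap j (p, y))| <= k / 4.
    by apply: hs1; apply: dist_sw; rewrite ?subrr ?normr0.
  have b4 : `|h (swap j (p', t)) - h (swap j (p', y))| <= k / 4.
    by apply: hs2; apply: dist_sw; rewrite ?subrr ?normr0.
  move: big b1 b2 b3 b4.
  move: (h (swap j (p', y))) (h (swap j (p, y))) (h (swap j (p', t))) (h (swap j (p, t))) => A1 A2 A3 A4.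
  move: (u n (swap j (p', t))) (u n (swap j (p, t))) (w x * (p' - p)) (3 * e * (p' - p)) => U1 U2 V1 V2.
  clear; rewrite !ler_norml => /andP[? ?] /andP[? ?] /andP[? ?] /andP[? ?] /andP[? ?].
  by apply/andP; split; lra.
pose f s := h (swap j (s, y)).
have cvgf : r^-1 *: ((f \o shift a) (r *: (1 : R)) - f a) @[r --> 0^'] --> w x.
  apply/cvgrPdist_le => e e0; have e3 : 0 < e / 3 by rewrite divr_gt0.
  have [r r0 hr] := key _ e3.
  apply/nbhs_ballP; exists r => //= s; rewrite -ball_normE /ball_ /= sub0r normrN => sr s0.
  rewrite /shift /= /GRing.scale /= mulr1.
  have e33 : 3 * (e / 3) = e by field.
  have aa : `|a - a| < r by rewrite subrr normr0.
  have asr : `|s + a - a| < r by rewrite addrK.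
  have sn : 0 < `|s| by rewrite normr_gt0.
  have -> : w x - s^-1 * (f (s + a) - f a) = - (s^-1 * (f (s + a) - f a - w x * s)) by field.
  rewrite normrN normrM normfV ler_pdivrMl // /f.
  have [sp|sp|s00] := ltgtP 0 s; last by rewrite -s00 eqxx in s0.
    have := hr a (s + a); rewrite e33 ltrDr addrK => /(_ sp aa sr).
    by rewrite (gtr0_norm sp) [s * e]mulrC.
  have := hr (s + a) a; rewrite e33 gtrDr => /(_ sp asr aa).
  rewrite (ltr0_norm sp) opprD addrCA subrr addr0 => h1.
  have -> : f (s + a) - f a - w x * s = - (f a - f (s + a) - w x * - s) by ring.
  by rewrite normrN [- s * e]mulrC; apply: h1.
have df : derivable f a 1 by apply/cvg_ex; exists (w x).
split; first exact/derivable_sw.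
by rewrite derive_sw derive1E; exact: (cvg_lim _ cvgf).
Qed.
End UniformLimits.

(** * Regularity of band functions *)

Section SecondOrder.
Variables (R : realType) (W : lmodType R[i]) (d : W -> W -> R).
Hypothesis dP : inner_product d.
Variables (D0 : lmodType R[i]) (iota : {linear D0 -> W}) (p1 p2 : {linear D0 -> D0}).
Variable B : R.
Hypothesis B0 : 0 <= B.
Hypothesis p1_sym : forall f g, d (iota (p1 f)) (iota g) = d (iota f) (iota (p1 g)).
Hypothesis p2_sym : forall f g, d (iota (p2 f)) (iota g) = d (iota f) (iota (p2 g)).
Hypothesis comm : forall f, p1 (p2 f) - p2 (p1 f) = B%:C *: ('i%C *: f).
Local Notation nm := (nm d).

(** Adding <kin p_j phi, p_j phi> over j gives the sum of all |p_i p_j phi|^2. Commuting [kin] past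
    p_j turns it into |kin phi|^2 + 4 B <i p1 phi, p2 phi>, and the last term is at most 2 B (|p1
    phi|^2 + |p2 phi|^2). The single order p2 p1 kept here is the one met in [sobolev_plane]. *)
Lemma nm_pp_le (phi : D0) : nm (iota (p2 (p1 phi))) ^+ 2 <=
  nm (iota (kin p1 p2 phi)) ^+ 2 + 2 * B * (nm (iota (kin p1 p2 phi)) * nm (iota phi)).
Proof.
have e1 := kin_form dP p1_sym p2_sym (p1 phi).
have e2 := kin_form dP p1_sym p2_sym (p2 phi).
have e3 := kin_form dP p1_sym p2_sym phi.
have h1 := nm_p_le dP p1_sym p2_sym phi.
rewrite (kin_p1 comm) raddfB /= !(iotaZ iota) !(ipE dP) p1_sym in e1.
rewrite (kin_p2 comm) raddfD /= !(iotaZ iota) !(ipE dP) p2_sym in e2.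
have e4 : d (iota (kin p1 p2 phi)) (iota (p1 (p1 phi))) + d (iota (kin p1 p2 phi)) (iota (p2 (p2 phi))) =
    nm (iota (kin p1 p2 phi)) ^+ 2.
  by rewrite nm_sqr // -(ip_addr dP) -raddfD.
have e5 : d ('i%C *: iota (p2 phi)) (iota (p1 phi)) = - d ('i%C *: iota (p1 phi)) (iota (p2 phi)).
  by rewrite (ip_J dP) (ip_sym dP).
rewrite e5 in e1.
have h2 := ip_CS dP ('i%C *: iota (p1 phi)) (iota (p2 phi)).
rewrite (nmJ dP) in h2.
have h3 := le_trans (ler_norm _) h2.
have h4 := sqr_ge0 (nm (iota (p1 phi)) - nm (iota (p2 phi))).
have h5 : 4 * B * d ('i%C *: iota (p1 phi)) (iota (p2 phi)) <=
   2 * B * (nm (iota (kin p1 p2 phi)) * nm (iota phi)).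
  have -> : 4 * B * d ('i%C *: iota (p1 phi)) (iota (p2 phi)) =
    2 * B * (2 * d ('i%C *: iota (p1 phi)) (iota (p2 phi))) by ring.
  apply: ler_wpM2l; first by rewrite mulr_ge0.
  by rewrite sqrrB in h4; lra.
have q1 := sqr_ge0 (nm (iota (p1 (p1 phi)))); have q2 := sqr_ge0 (nm (iota (p2 (p2 phi)))).
have q3 := sqr_ge0 (nm (iota (p1 (p2 phi)))).
by move: e1 e2 e4 h5 q1 q2 q3; clear => e1 e2 e4 h5 q1 q2 q3; lra.
Qed.
End SecondOrder.

(** * Derivatives and L^1 norms of products of two functions *)

Section Bilinear.
Variables (R : realType) (B : R).
Local Notation plane := (measurableTypeR R * measurableTypeR R)%type.
Local Notation mu := (leb2 R).
Implicit Types (h k : R * R -> R) (j : 'I_2) (x : R * R) (u v f g : R * R -> R[i]).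
Local Notation mag := (magnetic B).

(* The real (b = true) and imaginary (b = false) part of conj u * v. *)
Definition bil (b : bool) u v x : R := if b then re u x * re v x + im u x * im v x
  else re u x * im v x - im u x * re v x.

Definition cderivable u := forall j x, derivable (re u) x (dir R j) /\ derivable (im u) x (dir R j).

Lemma cderivable_smooth u : csmooth u -> cderivable u.
Proof. by move=> [sr si] j x; split; exact: smooth_derivable. Qed.

(** The factor i relating d_j to the magnetic derivative exchanges real and imaginary parts, whence
    [~~ b] and the sign. *)
Lemma derive_bil b j u v x : cderivable u -> cderivable v ->
  derivable (bil b u v) x (dir R j) /\
  'D_(dir R j) (bil b u v) x = (-1) ^+ (~~ b) * (bil (~~ b) u (mag j v) x - bil (~~ b) (mag j u) v x).
Proof.
move=> du dv; have [ur ui] := du j x; have [vr vi] := dv j x.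
have er w : re (mag j w) x = - 'D_(dir R j) (im w) x + pot B j x * re w x by rewrite re_magnetic.
have ei w : im (mag j w) x = 'D_(dir R j) (re w) x + pot B j x * im w x by rewrite im_magnetic.
have DM h k : derivable h x (dir R j) -> derivable k x (dir R j) ->
  derivable (fun x => h x * k x) x (dir R j).
  exact: derivableM.
rewrite /bil; case: b => /=; rewrite !er !ei.
  split; first exact: derivableD (DM _ _ ur vr) (DM _ _ ui vi).
  rewrite (dD (DM _ _ ur vr) (DM _ _ ui vi)) (dM ur vr) (dM ui vi).
  move: ('D_(dir R j) (re u) x) ('D_(dir R j) (im u) x) ('D_(dir R j) (re v) x) ('D_(dir R j) (im v) x) => a1 a2 a3 a4.
  by move: (re u x) (im u x) (re v x) (im v x) (pot B j x) => b1 b2 b3 b4 p; clear; ring.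
split; first exact: derivableB (DM _ _ ur vi) (DM _ _ ui vr).
rewrite (dB (DM _ _ ur vi) (DM _ _ ui vr)) (dM ur vi) (dM ui vr).
move: ('D_(dir R j) (re u) x) ('D_(dir R j) (im u) x) ('D_(dir R j) (re v) x) ('D_(dir R j) (im v) x) => a1 a2 a3 a4.
by move: (re u x) (im u x) (re v x) (im v x) (pot B j x) => b1 b2 b3 b4 p; clear; ring.
Qed.

Lemma smooth_bil b u v : csmooth u -> csmooth v -> smooth (bil b u v).
Proof.
move=> [ur ui] [vr vi]; rewrite /bil; case: b.
  exact: smoothD (smoothM ur vr) (smoothM ui vi).
exact: smoothD (smoothM ur vi) (smoothN (smoothM ui vr)).
Qed.

Lemma absf_ge0 u x : 0 <= absf u x.
Proof. by rewrite /absf; case: (u x) => a b; exact: sqrtr_ge0. Qed.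

Lemma bil_le b u v x : `|bil b u v x| <= absf u x * absf v x.
Proof.
rewrite -(@ler_pXn2r _ 2) ?nnegrE ?mulr_ge0 ?absf_ge0 // exprMn !absf_sqr.
rewrite real_normK ?num_real // /bil; move: (re u x) (im u x) (re v x) (im v x) => a b' c e; clear.
by case: b; [have := sqr_ge0 (a * e - b' * c)|have := sqr_ge0 (a * c + b' * e)]; rewrite !expr2; lra.
Qed.

Lemma sqint_absf u : L2 u -> sqint (absf u).
Proof.
move=> Lu; have [mr mi fin] := Lu; split.
  have -> : absf u = Num.sqrt \o (fun x => absf u x ^+ 2).
    by apply/funext => x /=; rewrite sqrtr_sqr ger0_norm // absf_ge0.
  apply: measurableT_comp; last exact: measurable_absf2.
  by apply: continuous_measurable_fun; exact: sqrt_continuous.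
have := L2norm_nm (toL2 Lu); rewrite /= => e.
by rewrite -L2norm_sqr e -EFin_expe ltry.
Qed.

Definition L1norm h : \bar R := (\int[mu]_x `|h x|%:E)%E.

Lemma bil_L1 b (f g : L2T R) : (L1norm (bil b f g) <= (nm (@dot R) f * nm (@dot R) g)%:E)%E.
Proof.
(* The moduli are themselves elements of [L2T] with the same norms, so Cauchy-Schwarz for [dot]
   bounds the integral of |f| |g|. *)
have Labs (k : L2T R) : L2 (fun x => (absf k x)%:C).
  by apply/L2P; split; [exact: (sqint_absf (L2T_L2 k))|exact: sqint0].
have nabs (k : L2T R) : nm (@dot R) (toL2 (Labs k)) = nm (@dot R) k.
  rewrite /nm /dot; congr Num.sqrt; apply: eq_Rintegral => x _.
  by rewrite /re /im /= mul0r addr0 -expr2 absf_sqr -!expr2.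
rewrite -(nabs f) -(nabs g).
apply: (@le_trans _ _ (dot (toL2 (Labs f)) (toL2 (Labs g)))%:E); last first.
  by rewrite lee_fin (le_trans (ler_norm _)) // ip_CS //; exact: dotP.
have mL (k : L2T R) : measurable_fun [set: plane] (absf k) by case: (sqint_absf (L2T_L2 k)).
have mb : measurable_fun [set: plane] (bil b f g).
  have [[fr fi _] [gr gi _]] := (L2T_L2 f, L2T_L2 g).
  rewrite /bil; case: b; first by apply: measurable_funD; exact: measurable_funM.
  by apply: measurable_funB; exact: measurable_funM.
have id := dot_integrable (toL2 (Labs f)) (toL2 (Labs g)).
rewrite /dot /Rintegral fineK; last exact: integrable_fin_num.
apply: ge0_le_integral => //.
- by apply/measurable_EFinP/measurableT_comp.
- by case/integrableP: id.
- move=> x _; rewrite lee_fin (le_trans (bil_le _ _ _ _)) //.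
  by rewrite /re /im /= mul0r addr0.
Qed.

Lemma L1normB h k : continuous h -> continuous k -> (L1norm (fun x => (h x - k x)%R) <= L1norm h + L1norm k)%E.
Proof.
move=> ch ck; have mh := continuous_measurable_plane ch; have mk := continuous_measurable_plane ck.
rewrite /L1norm -ge0_integralD //; last 2 first.
- by apply/measurable_EFinP/measurableT_comp.
- by apply/measurable_EFinP/measurableT_comp.
apply: ge0_le_integral => //.
- by apply/measurable_EFinP/measurableT_comp => //; exact: measurable_funB.
- by apply: emeasurable_funD; apply/measurable_EFinP/measurableT_comp.
- by move=> x _; rewrite -EFinD lee_fin ler_normB.
Qed.

Lemma L1norm_ge0 h : (0 <= L1norm h)%E. Proof. exact: integral_ge0. Qed.
End Bilinear.

(** * Uniform convergence of core sequences *)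

Section Regularity.
Variables (R : realType) (B : R).
Hypothesis B0 : 0 <= B.
Local Notation plane := (measurableTypeR R * measurableTypeR R)%type.
Local Notation mu := (leb2 R).
Implicit Types (h k : R * R -> R) (j : 'I_2) (x : R * R) (g : R * R -> R[i]).
Local Notation o1 := (lift ord0 ord0 : 'I_2).
Local Notation p0 := (ptest B ord0).
Local Notation p1 := (ptest B o1).
Local Notation nm := (nm (@dot R)).
Local Notation kin := (kin p0 p1).
Let dP := dotP R.
Let s0 := ptest_sym B ord0.
Let s1 := ptest_sym B o1.
Let cm := ptest_comm B.

Definition graph_nm (phi : testT R) : R := nm (iota phi) + nm (iota (kin phi)).

(** [sobolev_plane] for |phi|^2, with derivatives expressed by magnetic ones: norms of order at most
    one are bounded by N, that of p1 p0 phi by (1 + B) N. The terms add up to 1 + 2 + 2 + (4 + 2 B)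
    = 9 + 2 B times N^2; squaring this factor, which is at least 1, makes the bound a perfect
    square. *)
Lemma sup_test (phi : testT R) x : bil true phi phi x <= ((9 + 2 * B) * graph_nm phi) ^+ 2.
Proof.
have [sphi _] := testT_test phi.
have sm0 := csmooth_magnetic B ord0 sphi; have sm1 := csmooth_magnetic B o1 sphi.
have sm10 := csmooth_magnetic B o1 sm0.
have cd := cderivable_smooth sphi; have cd0 := cderivable_smooth sm0.
have [N [N0 n1 n2 NE]] : exists N, [/\ 0 <= N, nm (iota phi) <= N, nm (iota (kin phi)) <= N &
    N = graph_nm phi].
  exists (graph_nm phi); split => //; first by rewrite addr_ge0 ?nm_ge0.
    by rewrite lerDl nm_ge0.
  by rewrite lerDr nm_ge0.
have nk := ler_pM (nm_ge0 _ _) (nm_ge0 _ _) n2 n1.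
have hp := nm_p_le dP s0 s1 phi.
have n3 : nm (iota (p0 phi)) <= N.
  rewrite -(@ler_pXn2r _ 2) ?nnegrE ?nm_ge0 // [N ^+ 2]expr2; apply: (le_trans (le_trans _ hp) nk).
  by rewrite lerDl sqr_ge0.
have n4 : nm (iota (p1 phi)) <= N.
  rewrite -(@ler_pXn2r _ 2) ?nnegrE ?nm_ge0 // [N ^+ 2]expr2; apply: (le_trans (le_trans _ hp) nk).
  by rewrite lerDr sqr_ge0.
have n5 : nm (iota (p1 (p0 phi))) <= (1 + B) * N.
  rewrite -(@ler_pXn2r _ 2) ?nnegrE ?nm_ge0 ?mulr_ge0 ?addr_ge0 //.
  apply: (le_trans (nm_pp_le dP B0 s0 s1 cm phi)).
  have k1 : nm (iota (kin phi)) ^+ 2 <= N ^+ 2 by rewrite lerXn2r // nnegrE nm_ge0.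
  have k2 : 2 * B * (nm (iota (kin phi)) * nm (iota phi)) <= 2 * B * (N * N).
    by apply: ler_wpM2l => //; rewrite mulr_ge0.
  apply: (le_trans (lerD k1 k2)).
  have -> : ((1 + B) * N) ^+ 2 = N ^+ 2 + 2 * B * (N * N) + B ^+ 2 * N ^+ 2 by ring.
  by rewrite lerDl mulr_ge0 ?sqr_ge0.
pose h := bil true phi phi.
have sh : smooth h by exact: smooth_bil.
have D j : (fun y => 'D_(dir R j) h y) =
    (fun y => bil false phi (ptest B j phi) y - bil false (ptest B j phi) phi y).
  by apply/funext => y; have [_ ->] := derive_bil B true j y cd cd; rewrite expr0 mul1r.
have cb b (f g : testT R) : continuous (bil b f g).
  have [[sf _] [sg _]] := (testT_test f, testT_test g).
  exact: (smooth_cont (smooth_bil b sf sg)).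
have hL b (f g : testT R) (a1 a2 : R) : nm (iota f) <= a1 -> nm (iota g) <= a2 ->
    (L1norm (bil b f g) <= (a1 * a2)%:E)%E.
  move=> h1 h2; apply: (le_trans (bil_L1 b (iota f) (iota g))).
  by rewrite lee_fin ler_pM ?nm_ge0.
have hL2 b (f g f' g' : testT R) (a1 a2 a1' a2' : R) : nm (iota f) <= a1 -> nm (iota g) <= a2 ->
    nm (iota f') <= a1' -> nm (iota g') <= a2' ->
    (L1norm (fun x => (bil b f g x - bil b f' g' x)%R) <= (a1 * a2 + a1' * a2')%:E)%E.
  move=> h1 h2 h3 h4; apply: (le_trans (L1normB (cb b f g) (cb b f' g'))).
  by rewrite EFinD; apply: leeD; exact: hL.
have i0 : (L1norm h <= (N * N)%:E)%E by exact: hL.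
have i1 : (L1norm (fun y => 'D_(dir R ord0) h y) <= (N * N + N * N)%:E)%E by rewrite D; exact: hL2.
have i2 : (L1norm (fun y => 'D_(dir R o1) h y) <= (N * N + N * N)%:E)%E by rewrite D; exact: hL2.
have i3 : (L1norm (fun y => 'D_(dir R o1) (fun y => 'D_(dir R ord0) h y) y) <=
    (((N * N + N * ((1 + B) * N)) + ((1 + B) * N * N + N * N)))%:E)%E.
  rewrite D.
  rewrite (_ : (fun y => 'D_(dir R o1) _ y) = fun y =>
      (bil true (p1 phi) (p0 phi) y - bil true phi (p1 (p0 phi)) y) -
      (bil true (p1 (p0 phi)) phi y - bil true (p0 phi) (p1 phi) y)).
    apply: (le_trans (L1normB _ _)).
    - move=> y; apply: cvgB; exact: cb.
    - move=> y; apply: cvgB; exact: cb.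
    by rewrite EFinD; apply: leeD; exact: hL2.
  apply/funext => y.
  have [a1 a2] := derive_bil B false o1 y cd cd0; have [b1 b2] := derive_bil B false o1 y cd0 cd.
  by rewrite (dB a1 b1) a2 b2; congr (_ - _); rewrite expr1 mulN1r opprB.
have := sobolev_plane x sh; rewrite -!/(L1norm _) => hs.
have := le_trans hs (leeD (leeD i0 i2) (leeD i1 i3)); rewrite -!EFinD lee_fin => hh.
apply: (le_trans (ler_norm _)); apply: (le_trans hh); rewrite -NE.
have -> : N * N + (N * N + N * N) + (N * N + N * N + (N * N + N * ((1 + B) * N) + ((1 + B) * N * N + N * N))) =
   (9 + 2 * B) * N ^+ 2 by ring.
have c0 : 0 <= 9 + 2 * B by rewrite addr_ge0 ?mulr_ge0.
have c1 : 1 <= 9 + 2 * B by rewrite -[leLHS]addr0 lerD ?mulr_ge0 ?ler1n.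
by rewrite exprMn ler_wpM2r ?sqr_ge0 // expr2 ler_peMr.
Qed.

Lemma sup_test_re_im (phi : testT R) x :
  `|re phi x| <= (9 + 2 * B) * graph_nm phi /\ `|im phi x| <= (9 + 2 * B) * graph_nm phi.
Proof.
have := sup_test phi x; rewrite /bil -!expr2 => h.
have g0 : 0 <= (9 + 2 * B) * graph_nm phi.
  by rewrite mulr_ge0 ?addr_ge0 ?mulr_ge0 ?nm_ge0.
split; rewrite -(@ler_pXn2r _ 2) ?nnegrE // real_normK ?num_real // (le_trans _ h) //.
  by rewrite lerDl sqr_ge0.
by rewrite lerDr sqr_ge0.
Qed.

Lemma ae_eq_complex (f g : R * R -> R[i]) : ae_eq mu setT (re f) (re g) ->
  ae_eq mu setT (im f) (im g) -> ae_eq mu setT f g.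
Proof. by apply: filterS2 => x + + Dx => /(_ Dx) h1 /(_ Dx) h2; exact: complex_eqP. Qed.

Local Notation landau_seq := (core_seq (@dot R) (@iota R) p0 p1).

(** [sup_test] on differences makes the sequence uniformly Cauchy, and Fatou's lemma identifies its
    limit with f almost everywhere. Convergence of the given sequence itself is recorded, since its
    magnetic derivatives are compared with those of the limit later. *)
Lemma core_regularity (f u v0 v1 : L2T R) (phi : nat -> testT R) : landau_seq f u v0 v1 phi ->
  exists g, [/\ continuous (re g), continuous (im g), ae_eq mu setT f g,
    unif_cvg (fun n => re (phi n)) (re g) & unif_cvg (fun n => im (phi n)) (im g)].
Proof.
move=> [h1 h2 _ _].
pose C := 9 + 2 * B; have C0 : 0 < C by rewrite ltr_wpDr ?mulr_ge0.
have cauchy e : 0 < e -> exists N : nat, forall n m, (N <= n)%N -> (N <= m)%N ->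
    C * graph_nm (phi n - phi m) <= e.
  move=> e0; have e2 : 0 < e / (2 * C) by rewrite divr_gt0 // mulr_gt0.
  have [N hN] := lim_cauchy dP h1 e2; have [M hM] := lim_cauchy dP h2 e2.
  exists (maxn N M) => n m; rewrite !geq_max => /andP[nN nM] /andP[mN mM].
  rewrite -ler_pdivlMl // /graph_nm kinB !raddfB /=.
  have -> : C^-1 * e = e / (2 * C) + e / (2 * C) by field; rewrite gt_eqF.
  by apply: lerD; [exact: hN|exact: hM].
have key (p : (R * R -> R[i]) -> R * R -> R) :
    (forall (f g : testT R) x, p (f - g : testT R) x = p f x - p g x) ->
    (forall (f : testT R) x, `|p f x| <= C * graph_nm f) ->
    exists k, unif_cvg (fun n => p (phi n)) k.
  move=> pB hp; apply: unif_cauchy_cvg => e e0; have [N hN] := cauchy _ e0.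
  exists N => n m nN mN x; rewrite -pB (le_trans (hp _ _)) //; exact: hN.
have [a ha] : exists k, unif_cvg (fun n => re (phi n)) k.
  apply: key; last by move=> k x; have [] := sup_test_re_im k x.
  by move=> k1 k2 x; rewrite -[LHS]/(complex.Re (k1 x - k2 x)) /re; case: (k1 x) => ? ?; case: (k2 x).
have [b hb] : exists k, unif_cvg (fun n => im (phi n)) k.
  apply: key; last by move=> k x; have [] := sup_test_re_im k x.
  by move=> k1 k2 x; rewrite -[LHS]/(complex.Im (k1 x - k2 x)) /im; case: (k1 x) => ? ?; case: (k2 x).
have ca : continuous a.
  apply: (unif_cvg_continuous _ ha) => n.
  by have [[sr si] _] := testT_test (phi n); exact: smooth_cont.
have cb : continuous b.
  apply: (unif_cvg_continuous _ hb) => n.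
  by have [[sr si] _] := testT_test (phi n); exact: smooth_cont.
exists (fun x => a x +i* b x); split => //.
have pt (p : (R * R -> R[i]) -> R * R -> R) (k : R * R -> R) : continuous k ->
   unif_cvg (fun n => p (phi n)) k ->
   (forall n, continuous (p (phi n))) -> measurable_fun [set: plane] (p f) ->
   (forall n, (\int[mu]_x ((p f x - p (phi n) x) ^+ 2)%:E <= (nm (iota (phi n) - f) ^+ 2)%:E)%E) ->
   ae_eq mu setT (p f) k.
  move=> ck hk cp mp ip.
  have z : (\int[mu]_x ((p f x - k x) ^+ 2)%:E <= 0)%E.
    apply/lee_addgt0Pr => e e0; rewrite add0e.
    have se : 0 < Num.sqrt e by rewrite sqrtr_gt0.
    have /cvgrPdist_le/(_ _ se)[N _ hN] := h1.
    apply: (@fatou_sqr _ plane R mu (fun n x => p f x - p (phi n) x) (fun x => p f x - k x) e%:E N).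
    - by move=> n; apply: measurable_funB => //; exact: continuous_measurable_plane.
    - move=> x; apply: cvgB; first exact: cvg_cst.
      apply/cvgrPdist_le => r r0; have [M hM] := hk _ r0; exists M => // n /= nM.
      by rewrite distrC; exact: hM.
    - move=> n nN; apply: (le_trans (ip n)); rewrite lee_fin -(sqr_sqrtr (ltW e0)).
      rewrite lerXn2r // ?nnegrE ?nm_ge0 ?sqrtr_ge0 //.
      by have := hN n nN; rewrite /= sub0r normrN ger0_norm ?nm_ge0.
  have z0 : (\int[mu]_x `|((p f x - k x) ^+ 2)%:E| = 0)%E.
    under eq_integral do rewrite gee0_abs ?lee_fin ?sqr_ge0 //.
    apply/eqP; rewrite eq_le z /=; apply: integral_ge0 => x _; by rewrite lee_fin sqr_ge0.
  have mz : measurable_fun [set: plane] (fun x => ((p f x - k x) ^+ 2)%:E).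
    apply/measurable_EFinP/measurable_funX; apply: measurable_funB => //.
    exact: continuous_measurable_plane.
  have /ae_eq_integral_abs := z0 => /(_ measurableT mz).
  by apply: filterS => x /(_ Logic.I)[] /eqP; rewrite sqrf_eq0 subr_eq0 => /eqP ? _.
have [mr mi _] := L2T_L2 f.
have int2 n : (\int[mu]_x (re (f - iota (phi n) : L2T R) x ^+ 2)%:E <= (nm (iota (phi n) - f) ^+ 2)%:E)%E /\
    (\int[mu]_x (im (f - iota (phi n) : L2T R) x ^+ 2)%:E <= (nm (iota (phi n) - f) ^+ 2)%:E)%E.
  rewrite (nmB dP) EFin_expe -L2norm_nm L2norm_sqr.
  have [mr' mi' _] := L2T_L2 (f - iota (phi n)).
  split; apply: ge0_le_integral => //.
  - by move=> x _; rewrite lee_fin sqr_ge0.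
  - by apply/measurable_EFinP/measurable_funX.
  - by apply/measurable_EFinP; exact: measurable_absf2.
  - by move=> x _; rewrite lee_fin absf_sqr lerDl sqr_ge0.
  - by move=> x _; rewrite lee_fin sqr_ge0.
  - by apply/measurable_EFinP/measurable_funX.
  - by apply/measurable_EFinP; exact: measurable_absf2.
  - by move=> x _; rewrite lee_fin absf_sqr lerDr sqr_ge0.
have e1 : ae_eq mu setT (re f) a.
  apply: pt => // n; first by have [[sr si] _] := testT_test (phi n); exact: smooth_cont.
  by have [i1 _] := int2 n; under eq_integral do rewrite -[re (phi n) _]/(re (iota (phi n)) _) -reB.
have e2 : ae_eq mu setT (im f) b.
  apply: pt => // n; first by have [[sr si] _] := testT_test (phi n); exact: smooth_cont.
  by have [_ i1] := int2 n; under eq_integral do rewrite -[im (phi n) _]/(im (iota (phi n)) _) -imB.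
exact: ae_eq_complex.
Qed.
End Regularity.

(** * Smoothness of band functions *)

Section BandFunctions.
Variables (R : realType) (B : R).
Hypothesis B0 : 0 <= B.
Local Notation plane := (measurableTypeR R * measurableTypeR R)%type.
Local Notation mu := (leb2 R).
Implicit Types (h k : R * R -> R) (j : 'I_2) (x : R * R) (g : R * R -> R[i]).
Local Notation mag := (magnetic B).
Local Notation o1 := (lift ord0 ord0 : 'I_2).
Local Notation p0 := (ptest B ord0).
Local Notation p1 := (ptest B o1).
Local Notation nm := (nm (@dot R)).
Local Notation kin := (kin p0 p1).
Local Notation H := (kin_closure (@dot R) (@iota R) p0 p1).
Local Notation BL := (bandlimited (@dot R) (@iota R) p0 p1).
Hypothesis SA : forall v w : L2T R,
  (forall phi, dot v (iota (kin phi)) = dot w (iota phi)) -> H v w.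
Let dP := dotP R.
Let s0 := ptest_sym B ord0.
Let s1 := ptest_sym B o1.
Let cm := ptest_comm B.

(** If h - k is nonzero at x, it is nonzero on a square with corner x, which has positive
    measure. *)
Lemma continuous_ae_eq h k : continuous h -> continuous k -> ae_eq mu setT h k -> h = k.
Proof.
move=> ch ck [N [mN N0 hN]]; apply/funext => x; apply/eqP; rewrite -subr_eq0; apply: contrapT => /negP hk.
pose l y := h y - k y.
have cl : continuous l by move=> y; apply: cvgB; [exact: ch|exact: ck].
have e0 : 0 < `|l x| / 2 by rewrite divr_gt0 // normr_gt0.
have [r r0 hr] := @continuous_dist _ l x _ cl e0.
pose Q : set (R * R) := `[x.1, x.1 + r / 2]%classic `*` `[x.2, x.2 + r / 2]%classic.
have r2 : 0 < r / 2 by rewrite divr_gt0.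
have mQ : measurable (Q : set plane) by apply: measurableX; exact: measurable_itv.
have QN : Q `<=` N.
  move=> y [] /=; rewrite !in_itv /= => /andP[a1 a2] /andP[b1 b2]; apply: hN => /= /(_ Logic.I) hy.
  have : `|y - x| < r.
    rewrite prod_normE /= gt_max; apply/andP; split.
      by rewrite ger0_norm ?subr_ge0 // ltrBlDl (le_lt_trans a2) // ltrD2l gtr_pMr ?invf_lt1 ?ltr1n.
    by rewrite ger0_norm ?subr_ge0 // ltrBlDl (le_lt_trans b2) // ltrD2l gtr_pMr ?invf_lt1 ?ltr1n.
  move=> /hr; rewrite {1}/l hy subrr sub0r normrN leNgt => /negP; apply.
  by rewrite gtr_pMr ?normr_gt0 // invf_lt1 // ltr1n.
have : (mu Q <= 0)%E by rewrite -N0; apply: le_measure; rewrite ?inE.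
have -> : mu Q = (lebesgue_measure `[x.1, (x.1 + r / 2)%R]%classic * lebesgue_measure `[x.2, (x.2 + r / 2)%R]%classic)%E.
  by apply: product_measure1E; exact: measurable_itv.
rewrite !lebesgue_measure_itv /= !lte_fin !ltrDl r2 -!EFinB -EFinM lee_fin leNgt => /negP; apply.
by rewrite ![_ + r / 2 - _]addrC !addKr mulr_gt0.
Qed.

Lemma L2norm_ae (f : L2T R) g : measurable_fun [set: plane] (re g) -> measurable_fun [set: plane] (im g) ->
  ae_eq mu setT f g -> L2norm g = (nm f)%:E.
Proof.
move=> mr mi fg; rewrite -L2norm_nm.
have [mr' mi' _] := L2T_L2 f.
have e : (L2norm g ^+ 2 = L2norm f ^+ 2)%E.
  rewrite !L2norm_sqr; apply: ge0_ae_eq_integral => //.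
  - by apply/measurable_EFinP; exact: measurable_absf2.
  - by apply/measurable_EFinP; exact: measurable_absf2.
  - by move=> x _; rewrite lee_fin sqr_ge0.
  - by move=> x _; rewrite lee_fin sqr_ge0.
  - by move: fg; apply: filterS => x /[apply] e; rewrite /absf e.
move: e; rewrite L2norm_nm; have := L2norm_ge0 g.
case: (L2norm g) => [r| |]; [|by rewrite expe2 mulyy -EFin_expe|by []].
rewrite lee_fin -!EFin_expe => r0 [] /eqP; rewrite eqrXn2 ?nm_ge0 // => /eqP -> //.
Qed.

(* The continuous representatives of the elements of Ran 1_(-oo,E](H). *)
Definition band (E : R) g := [/\ continuous (re g), continuous (im g) &
  exists2 f : L2T R, BL E f & ae_eq mu setT f g].

Lemma band_exists E (f : L2T R) : BL E f -> exists2 g, band E g & ae_eq mu setT f g.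
Proof.
move=> fE; have [C [u [u0 hu _]]] := fE.
have := hu 0%N; rewrite u0 => /(clo_dom dP (@L2T_complete R) s0 s1)[v0 [v1 [phi hd]]].
have [g [c1 c2 fg _ _]] := core_regularity B0 hd.
by exists g => //; split => //; exists f.
Qed.

Lemma int_sqr_diff (f1 f2 : L2T R) :
  (\int[mu]_x ((re f1 x - re f2 x) ^+ 2)%:E <= (nm (f1 - f2) ^+ 2)%:E)%E /\
  (\int[mu]_x ((im f1 x - im f2 x) ^+ 2)%:E <= (nm (f1 - f2) ^+ 2)%:E)%E.
Proof.
have [mr mi _] := L2T_L2 (f1 - f2).
rewrite EFin_expe -L2norm_nm L2norm_sqr; split.
  under eq_integral do rewrite -reB; apply: ge0_le_integral => //.
  - by move=> x _; rewrite lee_fin sqr_ge0.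
  - by apply/measurable_EFinP/measurable_funX.
  - by apply/measurable_EFinP; exact: measurable_absf2.
  - by move=> x _; rewrite lee_fin absf_sqr lerDl sqr_ge0.
under eq_integral do rewrite -imB; apply: ge0_le_integral => //.
- by move=> x _; rewrite lee_fin sqr_ge0.
- by apply/measurable_EFinP/measurable_funX.
- by apply/measurable_EFinP; exact: measurable_absf2.
- by move=> x _; rewrite lee_fin absf_sqr lerDr sqr_ge0.
Qed.

(** An ordinary derivative of [phi n] is a magnetic one, converging in L^2, minus the potential
    times [phi n], converging uniformly. The potential is unbounded, so this second error is only
    locally small; it is the term c * d n of [derive_limit]. *)
Lemma band_derivative j (phi : nat -> testT R) (v : L2T R) g gj :
  continuous (re g) -> continuous (im g) -> continuous (re gj) -> continuous (im gj) ->
  unif_cvg (fun n => re (phi n)) (re g) -> unif_cvg (fun n => im (phi n)) (im g) ->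
  lim (@dot R) (@iota R \o ptest B j \o phi) v -> ae_eq mu setT v gj ->
  (forall x, derivable (re g) x (dir R j) /\ derivable (im g) x (dir R j)) /\ mag j g = gj.
Proof.
move=> cr ci crj cij ur ui hv vgj.
have cp := smooth_cont (smooth_pot B j).
have sphi n : csmooth (phi n) by have [] := testT_test (phi n).
have spj n : csmooth (mag j (phi n)) by exact: csmooth_magnetic.
have uB (h : nat -> R * R -> R) k : unif_cvg h k -> unif_cvg (fun n x => h n x - k x) (fun=> 0).
  by move=> hk e /hk[N hN]; exists N => n Nn x; rewrite subr0; exact: hN.
have small e : 0 < e -> exists N : nat, forall n, (N <= n)%N -> nm (iota (ptest B j (phi n)) - v) ^+ 2 <= e.
  move=> e0; have se : 0 < Num.sqrt e by rewrite sqrtr_gt0.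
  have /cvgrPdist_le/(_ _ se)[N _ hN] := hv; exists N => n Nn.
  rewrite -(sqr_sqrtr (ltW e0)) lerXn2r // ?nnegrE ?nm_ge0 ?sqrtr_ge0 //.
  by have := hN n Nn; rewrite /= sub0r normrN ger0_norm ?nm_ge0.
have [mvr mvi _] := L2T_L2 v.
have aeint (p : (R * R -> R[i]) -> R * R -> R) n : (forall f g x, f x = g x -> p f x = p g x) ->
    continuous (p gj) -> measurable_fun [set: plane] (p v) -> continuous (p (mag j (phi n))) ->
    (\int[mu]_x ((p (mag j (phi n)) x - p gj x) ^+ 2)%:E =
     \int[mu]_x ((p (iota (ptest B j (phi n))) x - p v x) ^+ 2)%:E)%E.
  move=> pe cg mv cm'; apply: ge0_ae_eq_integral => //.
  - apply/measurable_EFinP/measurable_funX; apply: measurable_funB; exact: continuous_measurable_plane.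
  - apply/measurable_EFinP/measurable_funX; apply: measurable_funB => //; exact: continuous_measurable_plane.
  - by move=> x _; rewrite lee_fin sqr_ge0.
  - by move=> x _; rewrite lee_fin sqr_ge0.
  - by move: vgj; apply: filterS => x /[apply] e; rewrite (pe _ _ _ e).
have Dre n x : 'D_(dir R j) (re (phi n)) x = im (mag j (phi n)) x - pot B j x * im (phi n) x.
  by rewrite im_magnetic addrK.
have Dim n x : 'D_(dir R j) (im (phi n)) x = pot B j x * re (phi n) x - re (mag j (phi n)) x.
  by rewrite re_magnetic opprD opprK addrCA subrr addr0.
have dre : forall x, derivable (re g) x (dir R j) /\
    'D_(dir R j) (re g) x = im gj x - pot B j x * im g x.
  apply: (@derive_limit R j (re g) (fun x => im gj x - pot B j x * im g x) (fun x => - pot B j x)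
    (fun n => re (phi n)) (fun n x => im (phi n) x - im g x) (fun n x => im (mag j (phi n)) x - im gj x)) => //.
  - by move=> x; apply: cvgB; [exact: cij|apply: cvgM; [exact: cp|exact: ci]].
  - by move=> x; apply: cvgN; exact: cp.
  - by move=> n; have [] := sphi n.
  - move=> n x; apply: cvgB; last exact: cij.
    by have [_ si] := spj n; exact: (smooth_cont si).
  - exact: uB.
  - move=> n x; rewrite Dre.
    by move: (im (mag j (phi n)) x) (im (phi n) x) (im gj x) (im g x) (pot B j x) => *; ring.
  - move=> e e0; have [N hN] := small e e0; exists N => n Nn.
    rewrite (aeint (@im R)) //; last by have [_ si] := spj n; exact: (smooth_cont si).
      by apply: (le_trans (proj2 (int_sqr_diff _ _))); rewrite lee_fin hN.
    by move=> f1 f2 x; rewrite /im => ->.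
have dim : forall x, derivable (im g) x (dir R j) /\
    'D_(dir R j) (im g) x = pot B j x * re g x - re gj x.
  apply: (@derive_limit R j (im g) (fun x => pot B j x * re g x - re gj x) (pot B j)
    (fun n => im (phi n)) (fun n x => re (phi n) x - re g x) (fun n x => re gj x - re (mag j (phi n)) x)) => //.
  - by move=> x; apply: cvgB; [apply: cvgM; [exact: cp|exact: cr]|exact: crj].
  - by move=> n; have [] := sphi n.
  - move=> n x; apply: cvgB; first exact: crj.
    by have [sr _] := spj n; exact: (smooth_cont sr).
  - exact: uB.
  - move=> n x; rewrite Dim.
    by move: (re (mag j (phi n)) x) (re (phi n) x) (re gj x) (re g x) (pot B j x) => *; ring.
  - move=> e e0; have [N hN] := small e e0; exists N => n Nn.
    under eq_integral do rewrite -sqrrN opprB.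
    rewrite (aeint (@re R)) //; last by have [sr _] := spj n; exact: (smooth_cont sr).
      by apply: (le_trans (proj1 (int_sqr_diff _ _))); rewrite lee_fin hN.
    by move=> f1 f2 x; rewrite /re => ->.
split; first by move=> x; have [? _] := dre x; have [? _] := dim x.
apply: cfun_eqP => x.
  by rewrite re_magnetic; have [_ ->] := dim x; rewrite opprB addrC subrKC.
by rewrite im_magnetic; have [_ ->] := dre x; rewrite subrK.
Qed.

Definition nrm g : R := fine (L2norm g).

Lemma band_L2 E g : band E g -> L2 g /\ L2norm g = (nrm g)%:E.
Proof.
move=> [cr ci [f fE fg]].
have mr := continuous_measurable_plane cr; have mi := continuous_measurable_plane ci.
have e := L2norm_ae mr mi fg.
by rewrite /nrm e; split => //; split => //; rewrite e ltry.
Qed.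

(** The uniform limit of the core sequence is a continuous representative of f, hence equals g. The
    elements p_j f are again band limited and have continuous representatives, which
    [band_derivative] identifies with the magnetic derivatives of g. *)
Lemma band_step E g : 0 <= E -> band E g ->
  [/\ cderivable g, forall j, band (E + 2 * B) (mag j g) &
   nrm (mag ord0 g) ^+ 2 + nrm (mag o1 g) ^+ 2 <= E * nrm g ^+ 2].
Proof.
move=> E0 [cr ci [f fE fg]].
have [u [v0 [v1 [phi [hd b0 b1 hn]]]]] := bandlimited_dom dP (@L2T_complete R) B0 s0 s1 cm SA E0 fE.
have [g' [cr' ci' fg' ur ui]] := core_regularity B0 hd.
have gg' : ae_eq mu setT g g' by apply: ae_eq_trans fg'; exact: ae_eq_sym.
have er : re g' = re g.
  by apply: continuous_ae_eq => //; move: gg'; apply: filterS => x /[apply] e; rewrite /re e.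
have ei : im g' = im g.
  by apply: continuous_ae_eq => //; move: gg'; apply: filterS => x /[apply] e; rewrite /im e.
rewrite er in ur; rewrite ei in ui.
have [g0 G0 e0] := band_exists b0; have [g1 G1 e1] := band_exists b1.
have [_ _ h0 h1] := hd.
have [cr0 ci0 _] := G0; have [cr1 ci1 _] := G1.
have [d0 m0] := band_derivative cr ci cr0 ci0 ur ui h0 e0.
have [d1 m1] := band_derivative cr ci cr1 ci1 ur ui h1 e1.
have N (k : L2T R) (gk : R * R -> R[i]) (ck : continuous (re gk)) (ck' : continuous (im gk)) : ae_eq mu setT k gk -> nrm gk = nm k.
  by move=> /(L2norm_ae (continuous_measurable_plane ck) (continuous_measurable_plane ck')); rewrite /nrm => ->.
split.
- by move=> j x; case: (ord2_cases j) => ->; [exact: d0|exact: d1].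
- by move=> j; case: (ord2_cases j) => ->; rewrite ?m0 ?m1.
- by rewrite m0 m1 (N _ _ cr0 ci0 e0) (N _ _ cr1 ci1 e1) (N _ _ cr ci fg).
Qed.

(* Closed under partial derivatives, because d_j = - i pi_j up to multiplication by
   a linear function. *)
Inductive band_alg : (R * R -> R) -> Prop :=
| ga_base h of smooth h : band_alg h
| ga_re E g of 0 <= E & band E g : band_alg (re g)
| ga_im E g of 0 <= E & band E g : band_alg (im g)
| ga_add h k of band_alg h & band_alg k : band_alg (fun x => h x + k x)
| ga_mul h k of band_alg h & band_alg k : band_alg (fun x => h x * k x).

Lemma band_alg_smooth h : band_alg h -> smooth h.
Proof.
have E2 E : 0 <= E -> 0 <= E + 2 * B by move=> ?; rewrite addr_ge0 // mulr_ge0.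
have gaN k : band_alg k -> band_alg (fun x => - k x).
  move=> hk; rewrite (_ : (fun x => - k x) = (fun x => (fun=> -1) x * k x)).
    by apply: ga_mul => //; apply: ga_base; exact: smooth_cst.
  by apply/funext => x; rewrite mulN1r.
apply: smooth_coind => {}h; elim => {h}.
- move=> h sh; split; first exact: smooth_cont.
  by move=> j; split; [exact: smooth_derivable|apply: ga_base; exact: smooth_d].
- move=> E g E0 G; have [cr ci _] := G; have [dg mg _] := band_step E0 G; split => // j.
  split=> [x|]; first by have [] := dg j x.
  rewrite (_ : (fun x => _) = fun x => im (mag j g) x + (fun y => - pot B j y) x * im g x).
    apply: ga_add; first exact: (ga_im (E2 _ E0) (mg j)).
    by apply: ga_mul; [apply/ga_base/smoothN/smooth_pot|exact: (ga_im E0 G)].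
  by apply/funext => x; rewrite im_magnetic mulNr addrK.
- move=> E g E0 G; have [cr ci _] := G; have [dg mg _] := band_step E0 G; split => // j.
  split=> [x|]; first by have [] := dg j x.
  rewrite (_ : (fun x => _) = fun x => pot B j x * re g x + (fun y => - re (mag j g) y) x).
    apply: ga_add; last exact: gaN (ga_re (E2 _ E0) (mg j)).
    by apply: ga_mul; [apply/ga_base/smooth_pot|exact: (ga_re E0 G)].
  by apply/funext => x; rewrite re_magnetic opprD opprK addrCA subrr addr0.
- move=> h k gh [ch IHh] gk [ck IHk]; split.
    by move=> x; apply: cvgD; [exact: ch|exact: ck].
  move=> j; have [dh ah] := IHh j; have [dk ak] := IHk j; split.
    by move=> x; exact: derivableD.
  rewrite (_ : (fun x => _) = fun x => 'D_(dir R j) h x + 'D_(dir R j) k x); first exact: (ga_add ah ak).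
  by apply/funext => x; exact: dD.
- move=> h k gh [ch IHh] gk [ck IHk]; split.
    by move=> x; apply: cvgM; [exact: ch|exact: ck].
  move=> j; have [dh ah] := IHh j; have [dk ak] := IHk j; split.
    by move=> x; exact: derivableM.
  rewrite (_ : (fun x => _) = fun x => (h x * 'D_(dir R j) k x) + (k x * 'D_(dir R j) h x)).
    exact: (ga_add (ga_mul gh ak) (ga_mul gk ah)).
  by apply/funext => x; exact: dM.
Qed.

Lemma band_smooth E g : 0 <= E -> band E g -> csmooth g.
Proof. by move=> E0 G; split; apply: band_alg_smooth; [exact: (ga_re E0 G)|exact: (ga_im E0 G)]. Qed.
End BandFunctions.

(** * Magnetic derivatives and derivatives of |f|^2 *)

Section TupleSums.
Variables (I : finType) (V : Type) (idx : V) (op : Monoid.com_law idx).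

Lemma big_tuple0 (F : seq I -> V) : \big[op/idx]_(a : 0.-tuple I) F a = F [::].
Proof.
rewrite (bigD1 (nil_tuple I)) //= big1 ?Monoid.mulm1 // => a; rewrite (tuple0 a) => /eqP[].
exact: val_inj.
Qed.

Lemma big_tuple_cons k (F : seq I -> V) :
  \big[op/idx]_(a : k.+1.-tuple I) F a = \big[op/idx]_(j : I) \big[op/idx]_(a : k.-tuple I) F (j :: a).
Proof.
rewrite pair_big (reindex (fun p : I * k.-tuple I => [tuple of p.1 :: p.2])) //=.
exists (fun a : k.+1.-tuple I => (thead a, [tuple of behead a])).
  by move=> [j a] _ /=; congr pair; apply: val_inj.
by move=> a _; rewrite /= -tuple_eta.
Qed.

Lemma big_tuple_rcons k (F : seq I -> V) :
  \big[op/idx]_(a : k.+1.-tuple I) F a = \big[op/idx]_(a : k.-tuple I) \big[op/idx]_(j : I) F (rcons a j).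
Proof.
elim: k F => [|k IH] F.
  rewrite big_tuple_cons (big_tuple0 (fun a => \big[op/idx]_(j : I) F (rcons a j))) /=.
  by apply: eq_bigr => j _; rewrite (big_tuple0 (fun a => F (j :: a))).
rewrite big_tuple_cons; under eq_bigr do rewrite (IH (fun a => F (_ :: a))).
by rewrite (@big_tuple_cons k (fun a => \big[op/idx]_(j : I) F (rcons a j))).
Qed.
End TupleSums.

Section PartialsLinear.
Variable R : realType.
Implicit Types h k : R * R -> R.

Lemma partialsB a h k : smooth h -> smooth k ->
  partials a (fun x => h x - k x) = fun x => partials a h x - partials a k x.
Proof.
elim: a => [//|j a IH] sh sk; apply/funext => x; rewrite /= (IH sh sk).
by have [_ dh] := sh a; have [_ dk] := sk a; rewrite (dB (dh j x) (dk j x)).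
Qed.

Lemma partialsN a h : smooth h -> partials a (fun x => - h x) = fun x => - partials a h x.
Proof.
elim: a => [//|j a IH] sh; apply/funext => x; rewrite /= (IH sh).
by have [_ dh] := sh a; rewrite (dN (dh j x)).
Qed.
End PartialsLinear.

(* AM-GM, pairing the factors of index i and k - 1 - i. *)
Lemma prod_sqrt_arith (R : realType) (E B : R) k m : 0 <= E -> 0 <= B -> (k <= m)%N ->
  \prod_(i < k) Num.sqrt (2 * (E + 2 * B * i%:R)) <= Num.sqrt (2 * (E + B * m%:R)) ^+ k.
Proof.
move=> E0 B0 km; pose s (i : nat) := Num.sqrt (2 * (E + 2 * B * i%:R)).
have s0 i : 0 <= s i by exact: sqrtr_ge0.
have a0 (i : nat) : 0 <= 2 * (E + 2 * B * i%:R) by rewrite mulr_ge0 ?addr_ge0 ?mulr_ge0.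
have c0 : 0 <= 2 * (E + B * m%:R) by rewrite mulr_ge0 ?addr_ge0 ?mulr_ge0.
rewrite -(@ler_pXn2r _ 2) ?nnegrE ?prodr_ge0 ?exprn_ge0 ?sqrtr_ge0 //.
rewrite -exprM mulnC exprM sqr_sqrtr // expr2.
rewrite {2}(reindex_inj rev_ord_inj) /= -big_split /= -[X in _ ^+ X]card_ord -prodr_const.
apply: ler_prod => i _; rewrite mulr_ge0 //=.
have h := sqr_ge0 (s i - s (k - i.+1)%N).
rewrite sqrrB !sqr_sqrtr // in h.
have e : i%:R + (k - i.+1)%N%:R <= m%:R :> R.
  rewrite -natrD ler_nat (leq_trans _ km) // -[leqRHS](subnKC (ltnW (ltn_ord i))) leq_add2l.
  exact: leq_sub2l.
have : B * (i%:R + (k - i.+1)%N%:R) <= B * m%:R by exact: ler_wpM2l.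
move: h; rewrite -/(s i) -/(s (k - i.+1)%N); move: (s i) (s _) (i%:R : R) ((k - i.+1)%N%:R : R) (m%:R : R) => p q a b c h1 h2.
rewrite mulrDr in h2; move: h1 h2; rewrite -!mulrA mulr2n; move: (B * a) (B * b) (B * c) (p * q); clear => x y z w h1 h2; lra.
Qed.

Lemma sqrD_le (R : realType) (a b : R) : (a + b) ^+ 2 <= 2 * (a ^+ 2 + b ^+ 2).
Proof.
rewrite -subr_ge0 (_ : _ - _ = (a - b) ^+ 2) ?sqr_ge0 //; ring.
Qed.

(** * Iterated magnetic derivatives and the L^1 bound *)

Section Words.
Variables (R : realType) (B : R).
Hypothesis B0 : 0 <= B.
Implicit Types (j : 'I_2) (g : R * R -> R[i]).
Local Notation mag := (magnetic B).
Local Notation o1 := (lift ord0 ord0 : 'I_2).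
Local Notation H := (kin_closure (@dot R) (@iota R) (ptest B ord0) (ptest B o1)).
Hypothesis SA : forall v w : L2T R,
  (forall phi, dot v (iota (kin (ptest B ord0) (ptest B o1) phi)) = dot w (iota phi)) -> H v w.
Local Notation band := (band B).

Definition word (s : seq 'I_2) g := foldr (fun j => mag j) g s.

Lemma band_word E g s : 0 <= E -> band E g -> band (E + 2 * B * (size s)%:R) (word s g).
Proof.
move=> E0 G; elim: s => [|j s IH] /=; first by rewrite mulr0 addr0.
have E1 : 0 <= E + 2 * B * (size s)%:R by rewrite addr_ge0 ?mulr_ge0.
have [_ /(_ j) h _] := band_step B0 SA E1 IH.
by rewrite -(natr1 (size s)) mulrDr mulr1 addrA.
Qed.

Lemma nrm_ge0 g : 0 <= nrm g. Proof. exact/fine_ge0/L2norm_ge0. Qed.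

(** The factor 2 under the root is the price of (a + b)^2 <= 2 (a^2 + b^2), as [band_step] controls
    a sum of squares. *)
Lemma sum_nrm_mag E g : 0 <= E -> band E g ->
  \sum_(j < 2) nrm (mag j g) <= Num.sqrt (2 * E) * nrm g.
Proof.
move=> E0 G; have [_ _ h] := band_step B0 SA E0 G.
rewrite sum_ord2; have a0 := nrm_ge0 (mag ord0 g); have b0 := nrm_ge0 (mag o1 g).
rewrite -(@ler_pXn2r _ 2) ?nnegrE ?addr_ge0 ?mulr_ge0 ?sqrtr_ge0 ?nrm_ge0 //.
rewrite exprMn sqr_sqrtr ?mulr_ge0 // -mulrA.
apply: (@le_trans _ _ (2 * (nrm (mag ord0 g) ^+ 2 + nrm (mag o1 g) ^+ 2))); last exact: ler_wpM2l.
exact: sqrD_le.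
Qed.

(** One more derivative of a word of length k costs the root of 2 (E + 2 B k), the band edge having
    moved to E + 2 B k. The final bound has m in place of k, so that words of lengths p + q = m
    multiply to one m-th power. *)
Lemma sum_nrm_word E g (k m : nat) : 0 <= E -> band E g -> (k <= m)%N ->
  \sum_(s : k.-tuple 'I_2) nrm (word s g) <= Num.sqrt (2 * (E + B * m%:R)) ^+ k * nrm g.
Proof.
move=> E0 G km.
suff h : \sum_(s : k.-tuple 'I_2) nrm (word s g) <=
    (\prod_(i < k) Num.sqrt (2 * (E + 2 * B * i%:R))) * nrm g.
  by apply: (le_trans h); rewrite ler_wpM2r ?nrm_ge0 //; exact: prod_sqrt_arith.
elim: {m km} k => [|k IH]; first by rewrite (big_tuple0 _ (fun s => nrm (word s g))) big_ord0 mul1r.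
rewrite (big_tuple_cons _ _ (fun s => nrm (word s g))) exchange_big big_ord_recr /=.
apply: (@le_trans _ _ (Num.sqrt (2 * (E + 2 * B * k%:R)) * \sum_(s : k.-tuple 'I_2) nrm (word s g))).
  rewrite mulr_sumr; apply: ler_sum => s _; apply: sum_nrm_mag; first by rewrite addr_ge0 ?mulr_ge0.
  by have := @band_word _ _ s E0 G; rewrite size_tuple.
by rewrite [X in _ <= X * _]mulrC -[leRHS]mulrA ler_wpM2l ?sqrtr_ge0.
Qed.

Lemma band_bil_L1 E E' b g g' : band E g -> band E' g' -> (L1norm (bil b g g') <= (nrm g * nrm g')%:E)%E.
Proof.
move=> /band_L2[Lg e] /band_L2[Lg' e'].
have h := bil_L1 b (toL2 Lg) (toL2 Lg').
suff N (k : R * R -> R[i]) (Lk : L2 k) : nm (@dot R) (toL2 Lk) = nrm k by rewrite !N in h.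
by have := L2norm_nm (toL2 Lk) => /= ek; rewrite /nrm ek.
Qed.

(** The last letter of a multi-index is the derivative applied first; [derive_bil] lets it fall on
    either factor. *)
Lemma partials_bil_L1 a b j g g' : csmooth g -> csmooth g' ->
  (L1norm (partials (rcons a j) (bil b g g')) <=
   L1norm (partials a (bil (~~ b) g (mag j g'))) + L1norm (partials a (bil (~~ b) (mag j g) g')))%E.
Proof.
move=> sg sg'; have cg := cderivable_smooth sg; have cg' := cderivable_smooth sg'.
have s1 := smooth_bil (~~ b) sg (csmooth_magnetic B j sg').
have s2 := smooth_bil (~~ b) (csmooth_magnetic B j sg) sg'.
rewrite partials_rcons.
have -> : L1norm (partials a (fun x => 'D_(dir R j) (bil b g g') x)) =
    L1norm (partials a (fun x => bil (~~ b) g (mag j g') x - bil (~~ b) (mag j g) g' x)).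
  have -> : (fun x => 'D_(dir R j) (bil b g g') x) =
      fun x => (-1) ^+ (~~ b) * (bil (~~ b) g (mag j g') x - bil (~~ b) (mag j g) g' x).
    by apply/funext => x; have [_ ->] := derive_bil B b j x cg cg'.
  case: b s1 s2 => /= s1 s2; first by under eq_fun do rewrite expr0 mul1r.
  under eq_fun do rewrite expr1 mulN1r.
  rewrite (partialsN _ (smoothD s1 (smoothN s2))).
  by apply: eq_integral => x _; rewrite normrN.
rewrite (partialsB a s1 s2); apply: L1normB; first by have [] := s1 a.
by have [] := s2 a.
Qed.

(** Induction on the number M of ordinary derivatives still to be distributed, with p and q magnetic
    ones already placed on the two factors. Each step doubles the number of products, giving 2^M;
    when M = 0, Cauchy-Schwarz separates the sums over s and t. *)
Lemma sum_partials_bil E g m M p q b : 0 <= E -> band E g -> (p + q + M)%N = m ->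
  (\sum_(s : p.-tuple 'I_2) \sum_(t : q.-tuple 'I_2) \sum_(a : M.-tuple 'I_2)
     L1norm (partials a (bil b (word s g) (word t g))) <=
   (2 ^+ M * Num.sqrt (2 * (E + B * m%:R)) ^+ m * nrm g ^+ 2)%:E)%E.
Proof.
move=> E0 G; set c := Num.sqrt _; have c0 : 0 <= c by exact: sqrtr_ge0.
have GW s : band (E + 2 * B * (size s)%:R) (word s g) by exact: band_word.
have SW s : csmooth (word s g).
  by apply: (band_smooth B0 SA _ (GW s)); rewrite addr_ge0 ?mulr_ge0.
elim: M p q b => [|M IH] p q b pq.
  rewrite addn0 in pq.
  apply: (@le_trans _ _ (\sum_(s : p.-tuple 'I_2) \sum_(t : q.-tuple 'I_2) (nrm (word s g) * nrm (word t g)))%:E).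
    rewrite -sumEFin; apply: lee_sum => s _; rewrite -sumEFin; apply: lee_sum => t _.
    rewrite (big_tuple0 _ (fun a => L1norm (partials a (bil b (word s g) (word t g))))).
    exact: (band_bil_L1 b (GW s) (GW t)).
  rewrite lee_fin mul1r -pq exprD.
  under eq_bigr do rewrite -mulr_sumr.
  rewrite -mulr_suml.
  have -> : c ^+ p * c ^+ q * nrm g ^+ 2 = (c ^+ p * nrm g) * (c ^+ q * nrm g).
    by move: (c ^+ p) (c ^+ q) (nrm g) => x y z; ring.
  apply: ler_pM; [by apply: sumr_ge0 => *; exact: nrm_ge0|by apply: sumr_ge0 => *; exact: nrm_ge0| |].
    by apply: sum_nrm_word => //; rewrite -pq leq_addr.
  by apply: sum_nrm_word => //; rewrite -pq leq_addl.
have h1 := IH p q.+1 (~~ b); have h2 := IH p.+1 q (~~ b).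
have e1 : (p + q.+1 + M)%N = m by rewrite -pq addnS addSnnS.
have e2 : (p.+1 + q + M)%N = m by rewrite -pq addSn addSnnS.
have -> : 2 ^+ M.+1 * c ^+ m * nrm g ^+ 2 = 2 ^+ M * c ^+ m * nrm g ^+ 2 + 2 ^+ M * c ^+ m * nrm g ^+ 2.
  by rewrite exprS -!mulrA; move: (2 ^+ M * _) => y; ring.
rewrite EFinD; apply: le_trans (leeD (h1 e1) (h2 e2)).
pose F b s t := (\sum_(a : M.-tuple 'I_2) L1norm (partials a (bil b (word s g) (word t g))))%E.
have step s t : (\sum_(a : M.+1.-tuple 'I_2) L1norm (partials a (bil b (word s g) (word t g))) <=
    \sum_(j < 2) F (~~ b) s (j :: t) + \sum_(j < 2) F (~~ b) (j :: s) t)%E.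
  rewrite (big_tuple_rcons _ _ (fun a => L1norm (partials a (bil b (word s g) (word t g))))) exchange_big /=.
  rewrite -big_split /=; apply: lee_sum => j _; rewrite -big_split; apply: lee_sum => a _.
  exact: partials_bil_L1.
apply: (@le_trans _ _ (\sum_(s : p.-tuple 'I_2) \sum_(t : q.-tuple 'I_2)
    (\sum_(j < 2) F (~~ b) s (j :: t) + \sum_(j < 2) F (~~ b) (j :: s) t))%E).
  by apply: lee_sum => s _; apply: lee_sum => t _; exact: step.
under eq_bigr do rewrite big_split; rewrite big_split.
apply: leeD.
  by apply: lee_sum => s _; rewrite (big_tuple_cons _ _ (F (~~ b) s)) exchange_big.
rewrite (big_tuple_cons _ _ (fun s => \sum_(t : q.-tuple 'I_2) F (~~ b) s t)%E) [leRHS]exchange_big.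
by apply: lee_sum => s _; rewrite exchange_big.
Qed.
End Words.

(** * The constant and the passage from L^1 to L^infinity *)

Section Final.
Variable R : realType.
Local Notation mu := (leb2 R).
Implicit Types (h : R * R -> R) (j : 'I_2) (x : R * R) (g : R * R -> R[i]).
Local Notation o1 := (lift ord0 ord0 : 'I_2).

(** Rewrites 2^(3/2) as 2 * sqrt 2: one 2 per order for the products of [sum_partials_bil], one sqrt
    2 per order for [sum_nrm_mag]. *)
Lemma C'E (E B : R) m : 0 <= E -> 0 <= B ->
  C' E B m = 2 ^+ m * Num.sqrt (2 * (E + B * m%:R)) ^+ m.
Proof.
move=> E0 B0; have X0 : 0 <= E + B * m%:R by rewrite addr_ge0 ?mulr_ge0.
have half (y : R) : 0 <= y -> y `^ (m%:R / 2) = Num.sqrt y ^+ m.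
  by move=> y0; rewrite mulrC powRrM powR12_sqrt // powR_mulrn // sqrtr_ge0.
rewrite /C' -mulrA powRrM (powR_mulrn 3) // !half ?exprn_ge0 // -!exprMn; congr (_ ^+ m).
rewrite (@sqrtrM _ 2 (E + B * m%:R)) // mulrA; congr (_ * _).
by rewrite exprS sqrtrM // sqrtr_sqr ger0_norm // mulrC.
Qed.

Lemma abs2_bil g : abs2 g = bil true g g.
Proof. by apply/funext => x; rewrite /abs2 absf_sqr /bil -!expr2. Qed.

Lemma Lnorm_oo_le h (X : \bar R) : (0 <= X)%E -> (forall x, (`|h x|%:E <= X)%E) ->
  ('N[mu]_(+oo)[EFin \o h] <= X)%E.
Proof.
move=> X0 hX; rewrite unlock; case: ifP => // _.
by apply/ess_supP; apply: nearW => x /=; exact: hX.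
Qed.

(** Completes the selected derivatives of [sobolev_plane] to all those of order one and two above a,
    so that summing over a gives full sums over longer multi-indices. *)
Lemma sobolev_terms_le (P : seq 'I_2 -> \bar R) a : (forall b, 0 <= P b)%E ->
  ((P a + P (o1 :: a)) + (P (ord0 :: a) + P [:: o1, ord0 & a]) <=
   P a + (\sum_(j < 2) P (j :: a) + \sum_(j < 2) \sum_(i < 2) P [:: j, i & a]))%E.
Proof.
move=> P0; rewrite !sum_ord2 -addeA; apply: leeD2l; rewrite addeA; apply: leeD; first by rewrite addeC.
rewrite addeCA; apply: leeDl; apply: adde_ge0 => //; exact: adde_ge0.
Qed.

Lemma sum_sobolev_terms m (P : seq 'I_2 -> \bar R) :
  (\sum_(a : m.-tuple 'I_2) (P a + (\sum_(j < 2) P (j :: a) + \sum_(j < 2) \sum_(i < 2) P [:: j, i & a])) =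
   \sum_(a : m.-tuple 'I_2) P a + (\sum_(a : m.+1.-tuple 'I_2) P a + \sum_(a : m.+2.-tuple 'I_2) P a))%E.
Proof.
rewrite big_split big_split /= !big_tuple_cons; congr (_ + (_ + _))%E; rewrite exchange_big //=.
apply: eq_bigr => j _.
by rewrite (big_tuple_cons _ _ (fun a => P (j :: a))) exchange_big.
Qed.

(** [sobolev_plane] at each partial derivative of order m produces L^1 norms of orders m to m + 2;
    the summand of order m + 3 is nonnegative. *)
Lemma sum_Lnorm_oo h m : smooth h ->
  (\sum_(a : m.-tuple 'I_2) 'N[mu]_(+oo)[EFin \o partials a h] <=
   \sum_(m <= m' < m + 4) \sum_(a : m'.-tuple 'I_2) L1norm (partials a h))%E.
Proof.
move=> sh; pose S k := (\sum_(a : k.-tuple 'I_2) L1norm (partials a h))%E.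
have S0 k : (0 <= S k)%E by apply: sume_ge0 => a _; exact: L1norm_ge0.
apply: (@le_trans _ _ (\sum_(a : m.-tuple 'I_2)
    (L1norm (partials a h) + (\sum_(j < 2) L1norm (partials (j :: a) h) +
      \sum_(j < 2) \sum_(i < 2) L1norm (partials (j :: i :: a) h))))%E).
  apply: lee_sum => a _; apply: Lnorm_oo_le => [|x].
    apply: adde_ge0; [exact: L1norm_ge0|apply: adde_ge0; apply: sume_ge0 => j _; first exact: L1norm_ge0].
by apply: sume_ge0 => i _; exact: L1norm_ge0.
  have hs : (`|partials a h x|%:E <= (L1norm (partials a h) + L1norm (partials (o1 :: a) h)) +
      (L1norm (partials (ord0 :: a) h) + L1norm (partials [:: o1, ord0 & a] h)))%E.
    exact: (sobolev_plane x (smooth_partials a sh)).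
  exact: (le_trans hs (sobolev_terms_le a (fun b => L1norm_ge0 (partials b h)))).
have -> : (\sum_(m <= m' < m + 4) S m' = S m + (S m.+1 + S m.+2) + S m.+3)%E.
  by rewrite !addnS addn0 !big_nat_recr ?leqW //= big_geq // add0e addeA.
by rewrite (sum_sobolev_terms m (fun b => L1norm (partials b h))) leeDl.
Qed.
End Final.

Theorem theorem13 (R : realType) :
  exists2 Csob : R, 0 < Csob &
  forall (E B : R) (P : set R -> (R * R -> R[i]) -> (R * R -> R[i])),
    0 <= E -> 0 <= B -> spectral_measure (landau B) P ->
  forall (m : nat) (f : R * R -> R[i]), L2range (P `]-oo, E]%classic) f ->
  exists g : R * R -> R[i],
    [/\ csmooth g,
        ae_eq (leb2 R) setT f g,
        (\sum_(a : m.-tuple 'I_2)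
            'N[leb2 R]_1[EFin \o partials a (abs2 g)]
          <= (C' E B m)%:E * L2norm f ^+ 2)%E
      & (\sum_(a : m.-tuple 'I_2)
            'N[leb2 R]_(+oo)[EFin \o partials a (abs2 g)]
          <= Csob%:E * \sum_(m <= m' < m + 4) ((C' E B m')%:E * L2norm f ^+ 2))%E].
Proof.
exists 1 => // E B P E0 B0 HP m f hf; have [Lf _] := hf.
have SA := landau_SA HP.
have BL := range_bandlimited HP E0 (hf : L2range _ (toL2 Lf)).
have [g G fg] := band_exists B0 BL.
have sg := band_smooth B0 SA E0 G.
have [[mr mi _] _] := band_L2 G.
have nf : nm (@dot R) (toL2 Lf) = nrm g by rewrite /nrm (L2norm_ae mr mi fg).
have bound k : (\sum_(a : k.-tuple 'I_2) L1norm (partials a (abs2 g)) <= (C' E B k)%:E * L2norm f ^+ 2)%E.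
  (* The case p = q = 0: both words are empty and all k derivatives fall on |g|^2, which is
     [bil true g g]. *)
  have := @sum_partials_bil _ _ B0 SA E g k k 0 0 true E0 G erefl.
  rewrite (big_tuple0 _ (fun s => \sum_(t : 0.-tuple 'I_2) \sum_(a : k.-tuple 'I_2)
     L1norm (partials a (bil true (word B s g) (word B t g))))%E).
  rewrite (big_tuple0 _ (fun t => \sum_(a : k.-tuple 'I_2)
     L1norm (partials a (bil true (word B [::] g) (word B t g))))%E) /= -abs2_bil => /le_trans; apply.
  by rewrite C'E // -[f]/(L2val (toL2 Lf)) L2norm_nm nf EFinM EFin_expe.
exists g; split => //.
  by under eq_bigr do rewrite Lnorm1; exact: bound.
rewrite mul1e; apply: (le_trans (sum_Lnorm_oo m _)).
  by rewrite abs2_bil; exact: smooth_bil.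
by apply: lee_sum => k _; exact: bound.
Qed.
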